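(* Let $X$ be a Banach space, $1\le p<\infty$, let $\mu\in\mathcal{M}$ satisfy condition (M), and let $(A(t))_{t\in\mathbb{R}}$ satisfy: (H1) $(A(t))_{t\in\mathbb{R}}$ generates a strongly continuous evolution family $(U(t,s))_{t\ge s}$; (H2) $(U(t,s))_{t\ge s}$ has an exponential dichotomy on $\mathbb{R}$ with constants $M,\delta>0$ and Green's function $\Gamma$; (H3) for each $x\in X$, $(t,s)\mapsto\Gamma(t,s)x$ is bi-almost automorphic. Let $g\in PAAS^p(\mathbb{R},X,\mu)$. Then $u'(t)=A(t)u(t)+g(t)$, $t\in\mathbb{R}$, has a unique bounded mild solution, $u(t)=\int_{\mathbb{R}}\Gamma(t,s)g(s)\,ds$, and $u\in PAA(\mathbb{R},X,\mu)$.
   Context: Evolution family: $\{U(t,s)\}_{t\ge s}\subset\mathcal{L}(X)$ with $U(t,r)U(r,s)=U(t,s)$, $U(t,t)=I$, $(t,s)\mapsto U(t,s)x$ continuous. Exponential dichotomy: projections $P(t)$, strongly continuous in $t$, constants $M,\delta>0$, $Q(t)=I-P(t)$, with $U(t,s)P(s)=P(t)U(t,s)$, $U(t,s):Q(s)X\to Q(t)X$ invertible with inverse $\tilde U(t,s)$, $\|U(t,s)P(s)\|\le Me^{-\delta(t-s)}$, $\|\tilde U(s,t)Q(t)\|\le Me^{-\delta(t-s)}$ for $s\le t$. Green's function: $\Gamma(t,s)=U(t,s)P(s)$ ($s\le t$), $\Gamma(t,s)=-\tilde U(t,s)Q(s)$ ($s>t$). Bi-almost automorphic $F:\mathbb{R}^2\to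 X$: for every real sequence $(s_n')$ there are a subsequence $(s_n)$ and $G$ with $G(t,s)=\lim_nF(t+s_n,s+s_n)$, $F(t,s)=\lim_nG(t-s_n,s-s_n)$ for all $t,s$. $AA(\mathbb{R},X)$: continuous $f$ such that every real sequence has a subsequence $(s_n)$ and a function $h$ with $h(t)=\lim f(t+s_n)$, $f(t)=\lim h(t-s_n)$ for all $t$. $AAS^p(\mathbb{R},X)$: $f\in L^p_{loc}$ such that every real sequence has a subsequence $(s_n)$ and $h\in L^p_{loc}$ with $\int_t^{t+1}\|f(s+s_n)-h(s)\|^pds\to0$ and $\int_t^{t+1}\|h(s-s_n)-f(s)\|^pds\to0$ for each $t$. $BS^p(\mathbb{R},X)$: $f\in L^p_{loc}$ with $\|f\|_{BS^p}=\sup_t(\int_t^{t+1}\|f\|^p)^{1/p}<\infty$. $\mathcal{M}$: positive measures $\mu$ on the Lebesgue $\sigma$-field of $\mathbb{R}$ with $\mu(\mathbb{R})=\infty$ and $\mu([a,b])<\infty$ for all $a\le b$. Condition (M): for every $\tau\in\mathbb{R}$ there are $\beta>0$ and a bounded interval $I$ with $\mu(\{a+\tau:a\in A\})\le\beta\mu(A)$ for every measurable $A$ with $A\cap I=\emptyset$. $\mathcal{E}(\mathbb{R},X,\mu)$: bounded continuous $f$ with $\lim_{r\to\infty}\frac1{\mu([-r,r])}\int_{[-r,r]}\|f(t)\|d\mu(t)=0$. $\mathcal{E}^p(\mathbb{R},X,\mu)$: $f\in BS^p(\mathbb{R},X)$ with $\lim_{r\to\infty}\frac1{\mu([-r,r])}\int_{[-r,r]}(\int_t^{t+1}\|f(s)\|^pds)^{1/p}d\mu(t)=0$.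 $PAA(\mathbb{R},X,\mu)=\{g+\varphi: g\in AA(\mathbb{R},X),\varphi\in\mathcal{E}(\mathbb{R},X,\mu)\}$ (continuous functions). $PAAS^p(\mathbb{R},X,\mu)=\{g+\varphi: g\in AAS^p(\mathbb{R},X),\varphi\in\mathcal{E}^p(\mathbb{R},X,\mu)\}$. Mild solution of $u'=A(t)u+g$: continuous $u$ with $u(t)=U(t,s)u(s)+\int_s^tU(t,r)g(r)dr$ for $t\ge s$. *)

(* Defs.v *)
From HB Require Import structures.
From mathcomp Require Import all_boot all_order all_algebra.
From mathcomp Require Import all_classical all_reals all_analysis.
Set Implicit Arguments.
Unset Strict Implicit.
Unset Printing Implicit Defensive.
Import Order.TTheory GRing.Theory Num.Theory.
Import numFieldNormedType.Exports.
Local Open Scope classical_set_scope.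
Local Open Scope ring_scope.

(* The Lebesgue sigma-field on R: the carrier type of the completed    *)
(* Lebesgue measure (Caratheodory-measurable sets); its carrier is R.  *)
Definition LebR (R : realType) : measurableType _ :=
  ltac:(let t := type of (@completed_lebesgue_measure R) in
        match t with set ?T -> _ => exact T end).

Definition leb (R : realType) : {measure set (LebR R) -> \bar R} :=
  @completed_lebesgue_measure R.

Section Bochner.
Context {R : realType} {d : measure_display} {T : measurableType d}
        {X : normedModType R}.

Definition sfun_eval (s : seq (set T * X)) (x : T) : X :=
  \sum_(q <- s) (\1_(q.1) x : R) *: q.2.

Definition sfun_meas (s : seq (set T * X)) : Prop :=
  forall q, q \in s -> measurable q.1.

Definition strongly_measurable (mu : {measure set T -> \bar R}) (D : set T)
    (f : T -> X) : Prop :=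
  exists s : nat -> seq (set T * X), (forall n, sfun_meas (s n)) /\
    {ae mu, forall x, D x -> (fun n => sfun_eval (s n) x) @ \oo --> f x}.

Definition is_bochner (mu : {measure set T -> \bar R}) (D : set T)
    (f : T -> X) (v : X) : Prop :=
  strongly_measurable mu D f /\
  exists s : nat -> seq (set T * X),
    [/\ forall n q, q \in s n ->
          [/\ measurable q.1, q.1 `<=` D & (mu q.1 < +oo)%E],
        (fun n => (\int[mu]_(x in D) (`|f x - sfun_eval (s n) x|)%:E)%E) @ \oo
          --> 0%E
      & (fun n => \sum_(q <- s n) fine (mu q.1) *: q.2) @ \oo --> v].

End Bochner.

Section Spaces.
Context {R : realType} {X : normedModType R}.
Local Notation lam := (@leb R).

Definition bdd_fun (f : R -> X) : Prop :=
  exists C : R, forall t, `|f t| <= C.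

Definition bounded_linear_op (L : X -> X) : Prop :=
  (forall (a : R) (x y : X), L (a *: x + y) = a *: L x + L y) /\ continuous L.

Definition evolution_family (U : R -> R -> X -> X) : Prop :=
  [/\ forall t s, s <= t -> bounded_linear_op (U t s),
      forall t r s x, s <= r -> r <= t -> U t r (U r s x) = U t s x,
      forall t x, U t t x = x
    & forall x, {within [set q : (R * R)%type | q.2 <= q.1],
                   continuous (fun q => U q.1 q.2 x)}].

(* exponential dichotomy with projections P, constants M, delta, and
   Ut s t (s <= t) the inverse of U t s : Q(s)X -> Q(t)X, Q = I - P *)
Definition exp_dichotomy (U : R -> R -> X -> X) (P : R -> X -> X)
    (Ut : R -> R -> X -> X) (M delta : R) : Prop :=
  let Q := fun t x => x - P t x in
  [/\ 0 < M /\ 0 < delta,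
      forall t, bounded_linear_op (P t) /\ (forall x, P t (P t x) = P t x),
      (forall x, continuous (fun t => P t x)) /\
      (forall t s x, s <= t -> U t s (P s x) = P t (U t s x)),
      forall t s, s <= t ->
        [/\ forall y, Q s y = y -> Ut s t (U t s y) = y,
            forall y, Q t y = y -> U t s (Ut s t y) = y
          & forall y, Q t y = y -> Q s (Ut s t y) = Ut s t y]
    & (forall t s x, s <= t ->
        `|U t s (P s x)| <= M * expR (- delta * (t - s)) * `|x|) /\
      (forall t s x, s <= t ->
        `|Ut s t (Q t x)| <= M * expR (- delta * (t - s)) * `|x|)].

Definition green (U : R -> R -> X -> X) (P : R -> X -> X)
    (Ut : R -> R -> X -> X) (t s : R) (x : X) : X :=
  if s <= t then U t s (P s x) else - Ut t s (x - P s x).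

Definition bi_almost_automorphic (F : R -> R -> X) : Prop :=
  forall s' : nat -> R, exists (phi : nat -> nat) (G : R -> R -> X),
    (forall n, (phi n < phi n.+1)%N) /\
    forall t s,
      (fun n => F (t + s' (phi n)) (s + s' (phi n))) @ \oo --> G t s /\
      (fun n => G (t - s' (phi n)) (s - s' (phi n))) @ \oo --> F t s.

Definition almost_automorphic (f : R -> X) : Prop :=
  continuous f /\
  forall s' : nat -> R, exists (phi : nat -> nat) (h : R -> X),
    (forall n, (phi n < phi n.+1)%N) /\
    forall t : R,
      (fun n => f (t + s' (phi n))) @ \oo --> h t /\
      (fun n => h (t - s' (phi n))) @ \oo --> f t.

Definition Lploc (p : R) (f : R -> X) : Prop :=
  strongly_measurable lam setT f /\
  forall a b : R, (\int[lam]_(s in `[a, b]%classic) (`|f s| `^ p)%:E < +oo)%E.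

Definition AAS (p : R) (f : R -> X) : Prop :=
  Lploc p f /\
  forall s' : nat -> R, exists (phi : nat -> nat) (h : R -> X),
    [/\ forall n, (phi n < phi n.+1)%N, Lploc p h &
    forall t : R,
      (fun n => (\int[lam]_(s in `[t, (t + 1)%R]%classic)
                   (`|f (s + s' (phi n)) - h s| `^ p)%:E)%E) @ \oo --> 0%E /\
      (fun n => (\int[lam]_(s in `[t, (t + 1)%R]%classic)
                   (`|h (s - s' (phi n)) - f s| `^ p)%:E)%E) @ \oo --> 0%E].

Definition BS (p : R) (f : R -> X) : Prop :=
  Lploc p f /\
  exists C : R, forall t,
    (\int[lam]_(s in `[t, (t + 1)%R]%classic) (`|f s| `^ p)%:E <= C%:E)%E.

Definition measure_class (mu : {measure set (LebR R) -> \bar R}) : Prop :=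
  mu setT = +oo%E /\ forall a b : R, a <= b -> (mu `[a, b]%classic < +oo)%E.

Definition condition_M (mu : {measure set (LebR R) -> \bar R}) : Prop :=
  forall tau : R, exists (beta : R) (a b : R), 0 < beta /\ a <= b /\
    forall A : set (LebR R), measurable A -> A `&` `[a, b]%classic = set0 ->
      (mu [set ((x : R) + tau)%R | x in A]%classic <= beta%:E * mu A)%E.

Definition ergodic0 (mu : {measure set (LebR R) -> \bar R}) (f : R -> X)
    : Prop :=
  bdd_fun f /\ continuous f /\
  (fun r : R => ((fine (mu `[(- r)%R, r]%classic))^-1)%:E *
       \int[mu]_(t in `[(- r)%R, r]%classic) (`|f t|)%:E)%E @ +oo --> 0%E.

Definition ergodicp (mu : {measure set (LebR R) -> \bar R}) (p : R)
    (f : R -> X) : Prop :=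
  BS p f /\
  (fun r : R => ((fine (mu `[(- r)%R, r]%classic))^-1)%:E *
       \int[mu]_(t in `[(- r)%R, r]%classic)
          ((fine (\int[lam]_(s in `[t, (t + 1)%R]%classic) (`|f s| `^ p)%:E)) `^ p^-1)%:E)%E
    @ +oo --> 0%E.

Definition PAA (mu : {measure set (LebR R) -> \bar R}) (f : R -> X) : Prop :=
  exists g phi : R -> X,
    [/\ almost_automorphic g, ergodic0 mu phi & f = g \+ phi].

Definition PAAS (mu : {measure set (LebR R) -> \bar R}) (p : R) (f : R -> X)
    : Prop :=
  exists g phi : R -> X,
    [/\ AAS p g, ergodicp mu p phi & f = g \+ phi].

(* mild solution of u' = A(t) u + g, A(t) generating U *)
Definition mild_solution (U : R -> R -> X -> X) (g u : R -> X) : Prop :=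
  continuous u /\
  forall t s, s <= t -> exists v : X,
    is_bochner lam `[s, t]%classic (fun r => U t r (g r)) v /\
    u t = U t s (u s) + v.

End Spaces.

(* Main.v *)
(**
The solution is u(t) = \int Gamma(t,s) g(s) ds.  Slicing the line into the unit
intervals at distance j from t and using Hoelder on each,
  |u(t)| <= M \sum_j e^(- delta j) (Phi(t + j) + Phi(t - j - 1)) with
  Phi(a) = (\int_a^(a+1) |g|^p)^(1/p),
so every estimate reduces to Stepanov norms of translates of g.  Uniqueness: a
bounded solution w of the homogeneous equation satisfies
|P(t) w(t)| <= M e^(- delta (t - s)) |w(s)| for s -> -oo, and symmetrically for I - P.

Almost automorphic part: f is a.e. a limit of simple functions, so a diagonal
extraction over the countably many vectors they involve gives one subsequence
along which Gamma(t + s_n, s + s_n) x converges and comes back for all those x.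
The vectors with that property form a closed subspace, which therefore contains
f(s) for a.e. s, and dominated convergence passes to the limit in the integral.

Ergodic part: the means of Phi(. + c) tend to 0 for each c. Away from a bounded
set, condition (M) bounds the measure of a level set {Phi(. + c) > e} by a
multiple of that of its translate {Phi > e}, and Markov's inequality bounds the
latter; the geometric weights then handle the sum over j.
*)
Require Import Defs.
From HB Require Import structures.
From mathcomp Require Import all_boot all_order all_algebra.
From mathcomp Require Import all_classical all_reals all_analysis.
Import Order.TTheory GRing.Theory Num.Theory.
Import numFieldNormedType.Exports.
From mathcomp Require Import measurable_realfun ring lra.
Local Open Scope classical_set_scope.
Local Open Scope ring_scope.
Set Implicit Arguments.
Unset Strict Implicit.
Unset Printing Implicit Defensive.

(** * Strongly measurable functions and the Bochner integral *)

(** The Bochner integral is a relation, [is_bochner], so existence, uniqueness, linearity and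
    dominated convergence are derived from simple functions given as lists of possibly overlapping
    sets. Measurability is tested on norms only; the approximation holds almost everywhere, so
    completeness of the measure is what makes these norms measurable.

    Two features of Gamma shape the rest. It is strongly continuous in each variable off the
    diagonal, which costs a null set in every integral. And (H3) gives a subsequence and a limit
    that depend on the vector; the limit kernel is therefore used only on vectors for which both
    limits exist along one fixed sequence. These must include the values of f and also those of its
    Stepanov limit h, because the way back integrates the limit kernel against translates of h.

    In the ergodic part, the exceptional interval of (M) costs an additive constant, harmless
    because mu([-r, r]) tends to infinity. A translate also leaves the window [-r, r], so the window
    is enlarged, and (M) applied in both directions bounds the measure of the larger one. *)

Lemma measure_mono d (T : measurableType d) (R : realType)
    (mu : {measure set T -> \bar R}) (A B : set T) :
  measurable A -> measurable B -> A `<=` B -> (mu A <= mu B)%E.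
Proof. by move=> mA mB AB; apply: le_measure; rewrite ?inE. Qed.

Section SimpleFunctions.
Context {R : realType} {d : measure_display} {T : measurableType d}
        {X : normedModType R}.
Implicit Types (s : seq (set T * X)) (mu : {measure set T -> \bar R}).

Lemma sfun_eval_cons q s x :
  sfun_eval (q :: s) x = (\1_(q.1) x : R) *: q.2 + sfun_eval s x.
Proof. by rewrite /sfun_eval big_cons. Qed.

Lemma sfun_eval_cat s1 s2 x :
  sfun_eval (s1 ++ s2) x = sfun_eval s1 x + sfun_eval s2 x.
Proof. by rewrite /sfun_eval big_cat. Qed.

Definition sfun_restr (E : set T) s := [seq (q.1 `&` E, q.2) | q <- s].

Lemma sfun_eval_restr E s x :
  sfun_eval (sfun_restr E s) x = (\1_E x : R) *: sfun_eval s x.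
Proof.
rewrite /sfun_eval big_map scaler_sumr; apply: eq_bigr => q _ /=.
by rewrite indicI /= scalerA mulrC.
Qed.

Definition sfun_map {Y : normedModType R} (L : X -> Y) s :=
  [seq (q.1, L q.2) | q <- s].

Definition sfun_int (mu : set T -> \bar R) s : X :=
  \sum_(q <- s) fine (mu q.1) *: q.2.

Lemma sfun_int_cat mu s1 s2 :
  sfun_int mu (s1 ++ s2) = sfun_int mu s1 + sfun_int mu s2.
Proof. by rewrite /sfun_int big_cat. Qed.

Lemma sfun_meas_cons q s :
  sfun_meas (q :: s) -> measurable q.1 /\ sfun_meas s.
Proof.
move=> ms; split; first by apply: ms; rewrite mem_head.
by move=> r rs; apply: ms; rewrite in_cons rs orbT.
Qed.

Lemma sfun_meas_cat s1 s2 :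
  sfun_meas s1 -> sfun_meas s2 -> sfun_meas (s1 ++ s2).
Proof. by move=> h1 h2 q; rewrite mem_cat => /orP[/h1|/h2]. Qed.

Lemma sfun_meas_restr E s : measurable E -> sfun_meas s ->
  sfun_meas (sfun_restr E s).
Proof. by move=> mE ms _ /mapP[q qs ->] /=; apply: measurableI => //; exact: ms. Qed.

(** The additive constant [c] closes the induction: on the head set [A] the head vector is absorbed
    into [c], off [A] it disappears. No measurability of X-valued sums is invoked. *)
Lemma measurable_norm_sfun (D : set T) s (c : X) : sfun_meas s ->
  measurable_fun D (fun x => `|sfun_eval s x + c|).
Proof.
elim: s c => [|[A y] s IH] c ms.
  have -> : (fun x : T => `|sfun_eval [::] x + c|) = cst `|c|.
    by apply/funext => x; rewrite /sfun_eval big_nil add0r.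
  exact: measurable_cst.
have [mA ms'] := sfun_meas_cons ms.
have -> : (fun x => `|sfun_eval ((A, y) :: s) x + c|) =
  (fun x => \1_A x * `|sfun_eval s x + (y + c)|) \+
  (fun x => \1_(~` A) x * `|sfun_eval s x + c|).
  apply/funext => x; rewrite sfun_eval_cons /= !indicE in_setC.
  case: (x \in A) => /=.
    by rewrite scale1r mul1r mul0r addr0 -addrA addrCA addrA.
  by rewrite scale0r mul0r mul1r !add0r.
apply: measurable_funD; apply: measurable_funM; try exact: IH.
  exact: measurable_indic.
by apply: measurable_indic; exact: measurableC.
Qed.

Lemma measurable_norm_sfun0 (D : set T) s : sfun_meas s ->
  measurable_fun D (fun x => `|sfun_eval s x|).
Proof.
move=> ms; have := @measurable_norm_sfun D s 0 ms.
by congr measurable_fun; apply/funext => x; rewrite addr0.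
Qed.

(** The sets in [s] may overlap, so there is no disjoint form to read the bound from. Quantifying
    over [E] and [c] allows an induction that splits [E] along the head set, adds the head vector to
    [c] on one half, and concludes by the triangle inequality. *)
Lemma sfun_int_le_on mu s (E : set T) (c : X) : measurable E ->
  (mu E < +oo)%E -> sfun_meas s ->
  (`|fine (mu E) *: c + sfun_int mu (sfun_restr E s)|%:E <=
   \int[mu]_(x in E) (`|sfun_eval s x + c|)%:E)%E.
Proof.
elim: s E c => [|[A y] s IH] E c mE fE ms.
  rewrite /sfun_int big_nil addr0 normrZ.
  have -> : (fun x : T => `|sfun_eval [::] x + c|%:E) = (cst `|c|%:E : T -> \bar R).
    by apply/funext => x; rewrite /sfun_eval big_nil add0r.
  rewrite integral_cst//= ger0_norm ?fine_ge0// mulrC EFinM fineK//.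
  by rewrite ge0_fin_numE.
have [mA ms'] := sfun_meas_cons ms; simpl in mA.
have mEA : measurable (E `&` A) by exact: measurableI.
have mED : measurable (E `\` A) by exact: measurableD.
have fEA : (mu (E `&` A) < +oo)%E.
  by apply: le_lt_trans fE; apply: measure_mono => //; exact: subIsetl.
have fED : (mu (E `\` A) < +oo)%E.
  by apply: le_lt_trans fE; apply: measure_mono => //; exact: subDsetl.
have finE q : measurable q -> fine (mu (q `&` E)) =
    fine (mu (q `&` (E `&` A))) + fine (mu (q `&` (E `\` A))).
  move=> mq.
  have le1 B : measurable B -> (mu (B `&` E) \is a fin_num).
    move=> mB; rewrite ge0_fin_numE//; apply: le_lt_trans fE.
    by apply: measure_mono => //; exact: measurableI.
  have e1 : q `&` (E `&` A) = (q `&` A) `&` E by rewrite setIA setIAC.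
  have e2 : q `&` (E `\` A) = (q `&` ~` A) `&` E by rewrite setDE setIA setIAC.
  rewrite -fineD; last 2 first.
  - by rewrite e1; apply: le1; exact: measurableI.
  - by rewrite e2; apply: le1; apply: measurableI => //; exact: measurableC.
  have m1 : measurable (q `&` (E `&` A)) by exact: measurableI.
  have m2 : measurable (q `&` (E `\` A)) by exact: measurableI.
  have d12 : (q `&` (E `&` A)) `&` (q `&` (E `\` A)) = set0.
    by apply/seteqP; split=> x //= -[[_ [_ ?]] [_ [_]]].
  rewrite -measureU//.
  by rewrite -setIUr setDE -setIUr setUCr setIT.
have EE : (E `&` A) `|` (E `\` A) = E by rewrite setDE -setIUr setUCr setIT.
have sE : sfun_int mu (sfun_restr E s) =
    sfun_int mu (sfun_restr (E `&` A) s) + sfun_int mu (sfun_restr (E `\` A) s).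
  rewrite /sfun_int !big_map -big_split /= big_seq [RHS]big_seq.
  by apply: eq_bigr => q qs; rewrite -scalerDl -finE//; exact: ms'.
have fE1 : fine (mu E) = fine (mu (E `&` A)) + fine (mu (E `\` A)).
  by have := finE setT measurableT; rewrite !setTI.
have -> : fine (mu E) *: c + sfun_int mu (sfun_restr E ((A, y) :: s)) =
   (fine (mu (E `&` A)) *: (y + c) + sfun_int mu (sfun_restr (E `&` A) s)) +
   (fine (mu (E `\` A)) *: c + sfun_int mu (sfun_restr (E `\` A) s)).
  rewrite {1}/sfun_int big_cons -/(sfun_int mu (sfun_restr E s)) sE fE1 /=.
  rewrite setIC scalerDl scalerDr.
  set a := _ *: c; set b := _ *: c; set e := _ *: y; set f := sfun_int _ _.
  set g := sfun_int _ _.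
  by rewrite [RHS]addrACA [LHS]addrA [a + b + e]addrC (addrA e).
rewrite -[in leRHS]EE ge0_integral_setU//=; last first.
- by apply/disj_set2P; rewrite setDE setIACA setICr setI0.
- by rewrite EE; apply/measurable_EFinP; exact: measurable_norm_sfun.
apply: le_trans (le_trans _ (leeD (IH _ (y + c) mEA fEA ms') (IH _ c mED fED ms'))) _.
  by rewrite -EFinD lee_fin ler_normD.
rewrite le_eqVlt; apply/orP; left; apply/eqP; congr (_ + _)%E;
  apply: eq_integral => x; rewrite inE /= => -[_ Ax]; rewrite sfun_eval_cons /= indicE.
  by rewrite mem_set// scale1r -addrA addrCA addrA.
by rewrite memNset// scale0r add0r.
Qed.

Lemma sfun_int_le mu s (D : set T) : measurable D ->
  (forall q, q \in s -> [/\ measurable q.1, q.1 `<=` D & (mu q.1 < +oo)%E]) ->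
  (`|sfun_int mu s|%:E <= \int[mu]_(x in D) (`|sfun_eval s x|)%:E)%E.
Proof.
move=> mD hs.
have ms : sfun_meas s by move=> q /hs[].
(* [D] may have infinite measure; the union of the sets of [s] has finite measure and contains all
   of them, so the bound is applied there with [c = 0]. *)
pose E := \big[setU/set0]_(q <- s) q.1.
have hE : [/\ measurable E, E `<=` D & (mu E < +oo)%E].
  rewrite /E; clear E ms; elim: s hs => [|q s IH] hs.
    by rewrite big_nil; split => //; rewrite measure0.
  have [mq qD fq] := hs q (mem_head _ _).
  have [|mE ED fE] := IH; first by move=> r rs; apply: hs; rewrite in_cons rs orbT.
  rewrite big_cons; split; first exact: measurableU.
    by rewrite subUset.
  by apply: le_lt_trans (measureU2 _ mq mE) _; exact: lte_add_pinfty.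
have [mE ED fE] := hE.
have sE : sfun_restr E s = s.
  rewrite /sfun_restr -[RHS]map_id; apply/eq_in_map => -[A y] qs /=.
  congr pair; apply: setIidl; rewrite /E => x Ax.
  by rewrite -bigcup_seq; exists (A, y).
have := @sfun_int_le_on mu s E 0 mE fE ms; rewrite scaler0 add0r sE.
move/le_trans; apply.
have -> : (fun x => `|sfun_eval s x + 0|%:E) = (fun x => `|sfun_eval s x|%:E).
  by apply/funext => x; rewrite addr0.
apply: ge0_subset_integral => //.
by apply/measurable_EFinP; exact: measurable_norm_sfun0.
Qed.

End SimpleFunctions.

Section StrongMeasurability.
Context {R : realType} {d : measure_display} {T : measurableType d}
        {X : normedModType R} (mu : {measure set T -> \bar R}).
Implicit Types (f g : T -> X) (D : set T).

Lemma sfun_strongly_measurable D (s : seq (set T * X)) : sfun_meas s ->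
  strongly_measurable mu D (sfun_eval s).
Proof.
move=> ms; exists (fun=> s); split=> //.
by apply: aeW => x _; exact: cvg_cst.
Qed.

Lemma sfun_eval_opp (s : seq (set T * X)) x :
  sfun_eval (sfun_map -%R s) x = - sfun_eval s x.
Proof. by rewrite /sfun_eval big_map -sumrN; apply: eq_bigr => q _; rewrite scalerN. Qed.

Lemma strongly_measurable_sub D f g :
  strongly_measurable mu D f -> strongly_measurable mu D g ->
  strongly_measurable mu D (fun x => f x - g x).
Proof.
move=> [s [ms hs]] [r [mr hr]].
exists (fun n => s n ++ sfun_map -%R (r n)); split.
  by move=> n; apply: sfun_meas_cat => // _ /mapP[q qs ->]; exact: mr qs.
apply: filterS2 hs hr => x hs hr Dx.
under eq_cvg => n do rewrite sfun_eval_cat sfun_eval_opp.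
by apply: cvgB; [exact: hs|exact: hr].
Qed.

Lemma strongly_measurable_ae_eq D f g :
  {ae mu, forall x, D x -> f x = g x} ->
  strongly_measurable mu D f -> strongly_measurable mu D g.
Proof.
move=> fg [s [ms hs]]; exists s; split => //.
by apply: filterS2 fg hs => x fg hs Dx; rewrite -fg//; exact: hs.
Qed.

Lemma strongly_measurable_subset D E f : E `<=` D ->
  strongly_measurable mu D f -> strongly_measurable mu E f.
Proof.
move=> ED [s [ms hs]]; exists s; split => //.
by apply: filterS hs => x hs /ED; exact: hs.
Qed.

Hypothesis mu_complete : measure_is_complete mu.

(** Replacing sequence and limit by 0 on a null set turns a.e. convergence into convergence
    everywhere on [D]; completeness of [mu] then allows the limit to be changed back on that null
    set. *)
Lemma measurable_ae_cvg D (h : (T -> \bar R)^nat) (f : T -> \bar R) :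
  measurable D -> (forall n, measurable_fun D (h n)) ->
  {ae mu, forall x, D x -> h ^~ x @ \oo --> f x} -> measurable_fun D f.
Proof.
move=> mD mh [N [mN N0 hN]].
have mN' : measurable (~` N) by exact: measurableC.
pose k x := if x \in N then 0%E else f x.
have mk : measurable_fun D k.
  apply: (emeasurable_fun_cvg (fun n x => if x \in N then 0%E else h n x)).
    move=> n; apply: measurable_fun_if => //.
    - by apply: (@measurable_fun_bool _ _ _ _ true); rewrite preimage_mem_true; exact: measurableI.
    - by apply: measurable_funS (mh n) => //; exact: subIsetl.
  move=> x Dx; rewrite /k; case: ifPn => xN; first exact: cvg_cst.
  apply: contrapT => nh; move/negP: xN; apply; rewrite inE; apply: hN => /= /(_ Dx).
  exact: nh.
apply: (ae_measurable_fun mu_complete _ mk).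
exists N; split => // x /= nx; apply: contrapT => Nx; apply: nx => _.
by rewrite /k memNset.
Qed.

Lemma strongly_measurable_norm D f : measurable D -> strongly_measurable mu D f ->
  measurable_fun D (fun x => `|f x|%:E).
Proof.
move=> mD [s [ms hs]].
apply: (@measurable_ae_cvg D (fun n x => `|sfun_eval (s n) x|%:E)) => //.
  by move=> n; apply/measurable_EFinP; exact: measurable_norm_sfun0.
apply: filterS hs => x hs Dx; apply: cvg_EFin; first by near=> n.
by apply: cvg_norm; exact: hs.
Unshelve. all: by end_near. Qed.

End StrongMeasurability.

Section BochnerIntegral.
Context {R : realType} {d : measure_display} {T : measurableType d}
        {X : normedModType R} (mu : {measure set T -> \bar R}).
Hypothesis mu_complete : measure_is_complete mu.
Implicit Types (f g : T -> X) (D : set T).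

Lemma strongly_measurable_norm_sub D f g : measurable D ->
  strongly_measurable mu D f -> strongly_measurable mu D g ->
  measurable_fun D (fun x => `|f x - g x|%:E).
Proof.
move=> mD mf mg; apply: (strongly_measurable_norm mu_complete mD).
exact: strongly_measurable_sub.
Qed.

Lemma strongly_measurable_norm_sub_sfun D f (s : seq (set T * X)) :
  measurable D -> sfun_meas s -> strongly_measurable mu D f ->
  measurable_fun D (fun x => `|f x - sfun_eval s x|%:E).
Proof.
move=> mD ms mf; apply: strongly_measurable_norm_sub => //.
exact: sfun_strongly_measurable.
Qed.

Lemma bochner_norm_le D f (v : X) : measurable D -> is_bochner mu D f v ->
  (`|v|%:E <= \int[mu]_(x in D) `|f x|%:E)%E.
Proof.
move=> mD [mf [s [hs sf sv]]].
have ms n : sfun_meas (s n) by move=> q /hs[].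
have mfs n : measurable_fun D (fun x => `|f x - sfun_eval (s n) x|%:E).
  exact: strongly_measurable_norm_sub_sfun.
have mnf := strongly_measurable_norm mu_complete mD mf.
have le n : (`|sfun_int mu (s n)|%:E <=
    \int[mu]_(x in D) `|f x - sfun_eval (s n) x|%:E + \int[mu]_(x in D) `|f x|%:E)%E.
  apply: le_trans (sfun_int_le mD (hs n)) _.
  rewrite -ge0_integralD//; apply: ge0_le_integral => //.
  - by apply/measurable_EFinP; exact: measurable_norm_sfun0.
  - by apply: emeasurable_funD.
  - move=> x _; rewrite -EFinD lee_fin addrC.
    by rewrite -{1}(subKr (f x) (sfun_eval (s n) x)) ler_normB.
have lim1 : (fun n => `|sfun_int mu (s n)|%:E) @ \oo --> `|v|%:E.
  by apply: cvg_EFin; [near=> n|exact: (cvg_norm sv)].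
have lim2 : (fun n => \int[mu]_(x in D) `|f x - sfun_eval (s n) x|%:E +
    \int[mu]_(x in D) `|f x|%:E)%E @ \oo --> (0 + \int[mu]_(x in D) `|f x|%:E)%E.
  by apply: cvgeD => //; exact: cvg_cst.
rewrite -(cvg_lim _ lim1)// -[leRHS]add0e -(cvg_lim _ lim2)//.
apply: lee_lim; [by apply/cvg_ex; eexists; exact: lim1|by apply/cvg_ex; eexists; exact: lim2|].
by near=> n.
Unshelve. all: by end_near. Qed.

Lemma sfun_int_map (Y : normedModType R) (L : X -> Y) s :
  (forall (a : R) x y, L (a *: x + y) = a *: L x + L y) ->
  sfun_int mu (sfun_map L s) = L (sfun_int mu s).
Proof.
move=> hL; have L0 : L 0 = 0.
  by have := hL 1 0 0; rewrite !scale1r addr0 => /eqP; rewrite -subr_eq0 opprD addNKr oppr_eq0 => /eqP.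
elim: s => [|q s IH]; first by rewrite /sfun_int !big_nil L0.
by rewrite /sfun_int /= !big_cons hL; congr (_ + _); exact: IH.
Qed.

Lemma sfun_eval_map (Y : normedModType R) (L : X -> Y) (s : seq (set T * X)) (x : T) :
  (forall (a : R) x y, L (a *: x + y) = a *: L x + L y) ->
  sfun_eval (sfun_map L s) x = L (sfun_eval s x).
Proof.
move=> hL; have L0 : L 0 = 0.
  by have := hL 1 0 0; rewrite !scale1r addr0 => /eqP; rewrite -subr_eq0 opprD addNKr oppr_eq0 => /eqP.
elim: s => [|q s IH]; first by rewrite /sfun_eval !big_nil L0.
by rewrite /= !sfun_eval_cons hL IH.
Qed.

Lemma bounded_linear_op_bound (L : X -> X) : bounded_linear_op L ->
  exists C : R, 0 < C /\ forall x, `|L x| <= C * `|x|.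
Proof.
move=> [hL cL].
have L0 : L 0 = 0.
  by have := hL 1 0 0; rewrite !scale1r addr0 => /eqP; rewrite -subr_eq0 opprD addNKr oppr_eq0 => /eqP.
have LZ (a : R) x : L (a *: x) = a *: L x.
  by have := hL a x 0; rewrite L0 !addr0.
have /cvgrPdist_lt/(_ 1 ltr01) := cL 0; rewrite L0.
case/nbhs_norm0P => e /= e0 he.
(* The map stays below 1 on the ball of radius [e]; a nonzero [x] is rescaled to norm [e / 2],
   strictly inside that ball. *)
exists (2 / e); split; first by rewrite divr_gt0.
move=> x; have [->|x0] := eqVneq x 0; first by rewrite L0 !normr0 mulr0.
have nx : 0 < `|x| by rewrite normr_gt0.
pose a := e / 2 / `|x|; have a0 : 0 < a by rewrite !divr_gt0.
have := he (a *: x); rewrite /= sub0r normrN LZ (normrZ a x) (normrZ a (L x)) (gtr0_norm a0).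
rewrite divfK ?gt_eqF// => h; have {h} : a * `|L x| < 1.
  by apply: h; rewrite gtr_pMr// invf_lt1// ltr1n.
rewrite -ltr_pdivlMl // => /ltW/le_trans; apply.
have -> : a^-1 * 1 = 2 / e * `|x|; last by [].
by rewrite /a; field; rewrite !gt_eqF.
Qed.

Lemma bochner_linear D f (v : X) (L : X -> X) : measurable D ->
  bounded_linear_op L -> is_bochner mu D f v ->
  is_bochner mu D (L \o f) (L v).
Proof.
move=> mD hL [mf [s [hs sf sv]]].
have [C [C0 hC]] := bounded_linear_op_bound hL.
have [lL cL] := hL.
have LB x y : L (x - y) = L x - L y.
  by rewrite addrC -scaleN1r lL scaleN1r addrC.
have mLf : strongly_measurable mu D (L \o f).
  have [r [mr hr]] := mf; exists (fun n => sfun_map L (r n)); split.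
    by move=> n _ /mapP[q qs ->]; exact: (mr n q qs).
  apply: filterS hr => x hr Dx; under eq_cvg => n do rewrite sfun_eval_map//.
  by apply: (cvg_comp _ _ (hr Dx)); exact: cL.
split=> //; exists (fun n => sfun_map L (s n)); split.
- by move=> n _ /mapP[q qs ->]; exact: (hs n q qs).
- have ms n : sfun_meas (s n) by move=> q /hs[].
  have mfs n : measurable_fun D (fun x => `|f x - sfun_eval (s n) x|%:E).
    exact: strongly_measurable_norm_sub_sfun.
  apply: (@squeeze_cvge _ _ _ _ (cst 0%E) _ (fun n => C%:E * \int[mu]_(x in D) `|f x - sfun_eval (s n) x|%:E)%E).
  + near=> n; apply/andP; split; first exact: integral_ge0.
    rewrite -ge0_integralZl_EFin//; last exact: ltW.
    apply: ge0_le_integral => //.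
    * apply: strongly_measurable_norm_sub => //; apply: sfun_strongly_measurable.
      by move=> _ /mapP[q qs ->]; have [] := hs n q qs.
    * by apply: emeasurable_funM => //.
    * by move=> x _; rewrite -EFinM lee_fin sfun_eval_map//= -LB.
  + exact: cvg_cst.
  + by rewrite -[X in _ --> X](mule0 C%:E); apply: cvgeZl.
- under eq_cvg => n do rewrite -/(sfun_int mu _) sfun_int_map//.
  by apply: (cvg_comp _ _ sv); exact: cL.
Unshelve. all: by end_near. Qed.

Lemma bochner_sub D f g (v w : X) : measurable D ->
  is_bochner mu D f v -> is_bochner mu D g w ->
  is_bochner mu D (fun x => f x - g x) (v - w).
Proof.
move=> mD [mf [s [hs sf sv]]] [mg [r [hr rg rw]]].
split; first exact: strongly_measurable_sub.
have ms n : sfun_meas (s n) by move=> q /hs[].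
have mr n : sfun_meas (r n) by move=> q /hr[].
have mN n : sfun_meas (sfun_map -%R (r n)).
  by move=> _ /mapP[q qs ->]; exact: (mr n q qs).
exists (fun n => s n ++ sfun_map -%R (r n)); split.
- by move=> n q; rewrite mem_cat => /orP[/hs//|/mapP[q' /hr h ->]].
- have mfs n : measurable_fun D (fun x => `|f x - sfun_eval (s n) x|%:E).
    exact: strongly_measurable_norm_sub_sfun.
  have mgr n : measurable_fun D (fun x => `|g x - sfun_eval (r n) x|%:E).
    exact: strongly_measurable_norm_sub_sfun.
  apply: (@squeeze_cvge _ _ _ _ (cst 0%E) _ (fun n => \int[mu]_(x in D) `|f x - sfun_eval (s n) x|%:E +
     \int[mu]_(x in D) `|g x - sfun_eval (r n) x|%:E)%E).
  + near=> n; apply/andP; split; first exact: integral_ge0.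
    rewrite -ge0_integralD//; apply: ge0_le_integral => //.
    * apply: strongly_measurable_norm_sub => //; first exact: strongly_measurable_sub.
      by apply: sfun_strongly_measurable; exact: sfun_meas_cat.
    * exact: emeasurable_funD.
    * move=> x _; rewrite -EFinD lee_fin sfun_eval_cat sfun_eval_opp opprD opprK addrACA.
      by rewrite -[- g x + _]opprK opprD opprK ler_normB.
  + exact: cvg_cst.
  + by rewrite -[X in _ --> X](adde0 0%E); apply: cvgeD.
- under eq_cvg => n do rewrite -/(sfun_int mu _) sfun_int_cat.
  apply: cvgD; first exact: sv.
  under eq_cvg => n do rewrite /sfun_int big_map/= (eq_bigr _ (fun q _ => scalerN _ _)) sumrN.
  by apply: cvgN; exact: rw.
Unshelve. all: by end_near. Qed.

(** The difference of the values is an integral of the zero function, hence has norm at most 0. This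
    is what allows the relation to be treated as an integral. *)
Lemma bochner_unique D f (v w : X) : measurable D ->
  is_bochner mu D f v -> is_bochner mu D f w -> v = w.
Proof.
move=> mD hv hw; have := bochner_norm_le mD (bochner_sub mD hv hw).
under eq_integral do rewrite subrr normr0.
rewrite integral0 lee_fin normr_le0 subr_eq0 => /eqP //.
Qed.

Lemma bochner_ae_eq D f g (v : X) : measurable D ->
  {ae mu, forall x, D x -> f x = g x} -> is_bochner mu D f v -> is_bochner mu D g v.
Proof.
move=> mD fg [mf [s [hs sf sv]]].
have mg := strongly_measurable_ae_eq fg mf.
split=> //; exists s; split=> //.
rewrite [X in X @ _ --> _](_ : _ = (fun n => \int[mu]_(x in D) `|f x - sfun_eval (s n) x|%:E)%E)//.
apply/funext => n.
have ms : sfun_meas (s n) by move=> q /hs[].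
apply: ge0_ae_eq_integral => //.
- exact: strongly_measurable_norm_sub_sfun.
- exact: strongly_measurable_norm_sub_sfun.
- by apply: filterS fg => x fg Dx; rewrite fg.
Qed.

End BochnerIntegral.

Lemma cvg_dist_EFin0 {R : realType} {V : normedModType R} {I : Type}
    (F : set_system I) {FF : Filter F} (u : I -> V) (l : V) :
  u @ F --> l -> (fun n => `|l - u n|%:E) @ F --> 0%E.
Proof.
move=> ul; apply: cvg_EFin; first by near=> n.
apply/cvgrPdist_lt => e e0; move/cvgrPdist_lt : ul => /(_ e e0).
by apply: filterS => n; rewrite /= sub0r normrN normr_id.
Unshelve. all: by end_near. Qed.

(** * Existence of Bochner integrals and dominated convergence *)

Section BochnerExistence.
Context {R : realType} {d : measure_display} {T : measurableType d}
        {X : completeNormedModType R} (mu : {measure set T -> \bar R}).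
Hypothesis mu_complete : measure_is_complete mu.
Implicit Types (f g : T -> X) (D : set T).

Lemma cvge0_lt (u : (\bar R)^nat) (e : R) : 0 < e -> u @ \oo --> 0%E ->
  \forall n \near \oo, (u n < e%:E)%E.
Proof.
move=> e0 /fine_cvgP[fu /cvgrPdist_lt/(_ _ e0) hu].
apply: filterS2 fu hu => n fn; rewrite sub0r normrN => /(le_lt_trans (ler_norm _)).
by rewrite -lte_fin fineK.
Qed.

(** The integrals of the [s n] are Cauchy: the difference of two of them is the integral of a
    concatenated list, and the L^1 distance of two approximants is controlled through [f].
    Completeness of X supplies the value. *)
Lemma bochner_approx D f (s : nat -> seq (set T * X)) : measurable D ->
  strongly_measurable mu D f ->
  (forall n q, q \in s n -> [/\ measurable q.1, q.1 `<=` D & (mu q.1 < +oo)%E]) ->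
  (\int[mu]_(x in D) `|f x - sfun_eval (s n) x|%:E)%E @[n --> \oo] --> 0%E ->
  exists v, is_bochner mu D f v.
Proof.
move=> mD mf hs sf.
have ms n : sfun_meas (s n) by move=> q /hs[].
have mfs n : measurable_fun D (fun x => `|f x - sfun_eval (s n) x|%:E).
  exact: (strongly_measurable_norm_sub_sfun mu_complete mD (ms n) mf).
have le n m : (`|sfun_int mu (s n) - sfun_int mu (s m)|%:E <=
    \int[mu]_(x in D) `|f x - sfun_eval (s n) x|%:E +
    \int[mu]_(x in D) `|f x - sfun_eval (s m) x|%:E)%E.
  have mN : sfun_meas (sfun_map -%R (s m)).
    by move=> _ /mapP[q qs ->]; exact: (ms m q qs).
  have -> : sfun_int mu (s n) - sfun_int mu (s m) =
      sfun_int mu (s n ++ sfun_map -%R (s m)).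
    rewrite sfun_int_cat; congr (_ + _).
    by rewrite /sfun_int big_map/= (eq_bigr _ (fun q _ => scalerN _ _)) sumrN.
  apply: le_trans (sfun_int_le mD _) _.
    by move=> q; rewrite mem_cat => /orP[/hs//|/mapP[q' /hs h ->]].
  rewrite -ge0_integralD//; apply: ge0_le_integral => //.
  - apply/measurable_EFinP; apply: measurable_norm_sfun0; exact: sfun_meas_cat.
  - exact: emeasurable_funD.
  - move=> x _; rewrite -EFinD lee_fin sfun_eval_cat sfun_eval_opp.
    rewrite [leRHS]addrC -[X in X <= _](_ : `|(f x - sfun_eval (s m) x) - (f x - sfun_eval (s n) x)| = _).
      exact: ler_normB.
    by rewrite opprB addrC addrA subrK.
have : cvgn (fun n => sfun_int mu (s n)).
  apply: cauchy_cvg; apply: cauchy_exP => _/posnumP[e].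
  have e2 : 0 < e%:num / 2 by [].
  have [N _ hN] := cvge0_lt e2 sf.
  exists (sfun_int mu (s N)); exists N => // n /= Nn.
  rewrite -ball_normE /=.
  rewrite -lte_fin; apply: le_lt_trans (le N n) _.
  rewrite [e%:num]splitr EFinD; apply: lteD; apply: hN => //=.
move=> /cvg_ex[v sv]; exists v; split => //; exists s; split=> //.
Qed.

Lemma bochner_exists D f : sigma_finite setT mu -> measurable D ->
  strongly_measurable mu D f -> (\int[mu]_(x in D) `|f x|%:E < +oo)%E ->
  exists v, is_bochner mu D f v.
Proof.
move=> [F0 F0T hF0] mD mf intf.
pose F n := \big[setU/set0]_(i < n) F0 i.
have hF n : measurable (F n) /\ (mu (F n) < +oo)%E.
  elim: n => [|n [mF fF]]; first by rewrite /F big_ord0 measure0.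
  have [m1 f1] := hF0 n.
  rewrite /F big_ord_recr /=; split; first exact: measurableU.
  by apply: le_lt_trans (measureU2 _ mF m1) _; exact: lte_add_pinfty.
have memF x : \forall n \near \oo, F n x.
  have : [set: T] x by []. 
  rewrite F0T => -[i _ Fix]; exists i.+1 => // n /= ni.
  by rewrite /F -(bigcup_mkord n F0); exists i.
have mnf := strongly_measurable_norm mu_complete mD mf.
have [s [ms hs]] := mf.
(* A.e. convergence alone gives neither a majorant nor supports of finite measure. Cutting the
   approximants off where they exceed twice the norm of [f], and outside [F n], gives both, with
   majorant 3|f|. *)
pose E n := [set x | D x /\ (`|sfun_eval (s n) x| <= 2 * `|f x|)] `&` F n.
have mE n : measurable (E n).
  apply: measurableI; last exact: (hF n).1.
  have m1 : measurable_fun D (fun x => (2 * `|f x| - `|sfun_eval (s n) x|)).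
    apply: measurable_funB; last exact: measurable_norm_sfun0.
    by apply: measurable_funM => //; exact/measurable_EFinP.
  have := m1 mD `[0, +oo[%classic (measurable_itv _).
  congr measurable; apply/seteqP; split => x /=; rewrite in_itv/= andbT subr_ge0//.
pose s' n := sfun_restr (E n) (s n).
have hs' n q : q \in s' n -> [/\ measurable q.1, q.1 `<=` D & (mu q.1 < +oo)%E].
  move=> /mapP[r rs ->] /=.
  have mr : measurable (r.1 `&` E n) by apply: measurableI => //; exact: (ms n r rs).
  split => //; first by move=> x [_ [[]]].
  apply: le_lt_trans (hF n).2; apply: measure_mono => //; first exact: (hF n).1.
  by move=> x [_ []].
apply: (bochner_approx mD mf hs').
have ms' n : sfun_meas (s' n) by move=> q /hs'[].
have bnd n x : D x -> `|f x - sfun_eval (s' n) x| <= 3 * `|f x|.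
  move=> Dx; rewrite sfun_eval_restr indicE; case: (boolP (x \in E n)).
    rewrite inE scale1r => -[[_ le2] _]; apply: le_trans (ler_normB _ _) _.
    by have := normr_ge0 (f x); lra.
  by rewrite scale0r subr0; have := normr_ge0 (f x); lra.
have [|||||_ _] := @dominated_convergence _ _ _ mu D mD
  (fun n x => `|f x - sfun_eval (s' n) x|%:E) (cst 0%E) (fun x => (3 * `|f x|)%:E).
- by move=> n; exact: (strongly_measurable_norm_sub_sfun mu_complete mD (ms' n) mf).
- exact: measurable_cst.
- apply: filterS hs => x hs Dx; have {}hs := hs Dx.
  apply: cvg_dist_EFin0.
  (* At a zero of [f] the cut-off forces the value 0; elsewhere |f x| < 2 |f x| makes it inactive
     for large n. *)
  have [fx0|fx0] := eqVneq (f x) 0.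
    rewrite fx0; apply: cvg_near_cst; near=> n.
    rewrite sfun_eval_restr indicE; case: (boolP (x \in E n)); last by rewrite scale0r.
    rewrite inE scale1r => -[[_]]; rewrite fx0 normr0 mulr0 normr_le0 => /eqP //.
  have nf : `|f x| < 2 * `|f x| by rewrite ltr_pMl ?ltr1n// normr_gt0.
  have le2 : \forall n \near \oo, `|sfun_eval (s n) x| <= 2 * `|f x|.
    apply: filterS (cvgr_lt _ (cvg_norm hs) _ nf) => n /ltW //.
  apply: cvg_trans hs; apply: near_eq_cvg; near=> n.
  rewrite sfun_eval_restr indicE mem_set ?scale1r//; split; last by near: n; exact: memF.
  by split=> //; near: n.
- apply/integrableP; split.
    by apply/measurable_EFinP; apply: measurable_funM => //; exact/measurable_EFinP.
  rewrite (_ : (fun x => _) = (fun x => (3%:E * `|f x|%:E)%E)); last first.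
    by apply/funext => x; rewrite -EFinM /= ger0_norm// mulr_ge0.
  by rewrite ge0_integralZl_EFin//; exact: lte_mul_pinfty.
- apply: aeW => x n Dx; rewrite /= lee_fin ger0_norm//; exact: bnd.
by rewrite integral0.
Unshelve. all: by end_near. Qed.


(** The delicate point is strong measurability of the limit. Simple functions within 2^-(n+1) of
    [fn n] in L^1 have a.e. summable distances to it, so they too converge a.e. to [f]. Existence
    and convergence of the integrals then follow from scalar dominated convergence. *)
Lemma bochner_dominated_cvg D (fn : nat -> T -> X) (vn : nat -> X) f
    (psi : T -> R) : sigma_finite setT mu -> measurable D ->
  measurable_fun D (fun x => (psi x)%:E) -> (forall x, D x -> 0 <= psi x) ->
  (\int[mu]_(x in D) (psi x)%:E < +oo)%E ->
  (forall n, is_bochner mu D (fn n) (vn n)) ->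
  {ae mu, forall x, D x -> fn ^~ x @ \oo --> f x} ->
  {ae mu, forall x, D x -> forall n, `|fn n x| <= psi x} ->
  exists v, is_bochner mu D f v /\ vn @ \oo --> v.
Proof.
move=> smu mD mpsi psi0 ipsi hfn fnf dom.
have mfn n : strongly_measurable mu D (fn n) by have [] := hfn n.
have /choice[s hs] : forall n, exists s : seq (set T * X), sfun_meas s /\
    (\int[mu]_(x in D) `|fn n x - sfun_eval s x|%:E <= (1 / (2 ^ n.+1)%:R)%:E)%E.
  move=> n; have [_ [s [hs sf _]]] := hfn n.
  have e0 : 0 < 1 / (2 ^ n.+1)%:R :> R by rewrite divr_gt0// ltr0n expn_gt0.
  have [N _ hN] := cvge0_lt e0 sf.
  exists (s N); split; first by move=> q /hs[].
  exact/ltW/(hN N)/leqnn.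
pose h n x := `|fn n x - sfun_eval (s n) x|%:E.
have mh n : measurable_fun D (h n).
  exact: (strongly_measurable_norm_sub_sfun mu_complete mD (hs n).1 (mfn n)).
have h0 n x : (0 <= h n x)%E by rewrite lee_fin.
have isum : mu.-integrable D (fun x => \sum_(0 <= n <oo) h n x)%E.
  apply/integrableP; split; first by apply: ge0_emeasurable_sum => // k x _ _.
  under eq_integral do rewrite gee0_abs ?nneseries_ge0//.
  rewrite integral_nneseries//.
  apply: (@le_lt_trans _ _ (\sum_(0 <= n <oo) (0 + (1 / (2 ^ n.+1)%:R)%:E))%E).
    apply: lee_nneseries => [n _ _|n _]; first exact: integral_ge0.
    by rewrite add0e; exact: (hs n).2.
  apply: le_lt_trans (@epsilon_trick R (fun=> 0%E) 1 xpredT _ _) _ => //.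
  by rewrite eseries0// add0e ltry.
have mf : strongly_measurable mu D f.
  exists s; split; first by move=> n; exact: (hs n).1.
  apply: filterS2 fnf (integrable_ae mD isum) => x fnf fin Dx.
  have {}fnf := fnf Dx; have {}fin := fin Dx.
  have hx0 : (fun n => h n x) @ \oo --> 0%E.
    have tail : (\sum_(0 <= n <oo) h n x < +oo)%E by rewrite ltey_eq fin.
    apply: (@squeeze_cvge _ _ _ _ (cst 0%E) _ (fun n => \sum_(n <= k <oo) h k x)%E).
    - near=> n; rewrite h0/=.
      have := @nneseries_lim_ge R (fun k => h k x) xpredT n n.+1 (fun k _ _ => h0 k x).
      by rewrite big_nat1.
    - exact: cvg_cst.
    - exact: (nneseries_tail_cvg tail).
  apply/cvgrPdist_lt => e e0.
  have e2 : 0 < e / 2 by rewrite divr_gt0.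
  near=> n; rewrite -(subrKA (fn n x)) (splitr e).
  apply: le_lt_trans (ler_normD _ _) _; apply: ltrD.
    by near: n; move/cvgrPdist_lt : fnf; apply.
  by rewrite -lte_fin; near: n; exact: cvge0_lt.
have mnf := strongly_measurable_norm mu_complete mD mf.
have fpsi : {ae mu, forall x, D x -> `|f x| <= psi x}.
  apply: filterS2 fnf dom => x fnf dom Dx.
  rewrite -(cvg_lim _ (cvg_norm (fnf Dx)))//.
  apply: limr_le; first by apply/cvg_ex; exists `|f x|; exact: (cvg_norm (fnf Dx)).
  by near=> n; exact: dom.
have intf : (\int[mu]_(x in D) `|f x|%:E < +oo)%E.
  apply: le_lt_trans ipsi; apply: ae_ge0_le_integral => //.
have [v hv] := bochner_exists smu mD mf intf.
exists v; split => //.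
have [|||||_ _ lim0] := @dominated_convergence _ _ _ mu D mD
  (fun n x => `|fn n x - f x|%:E) (cst 0%E) (fun x => (2 * psi x)%:E).
- by move=> n; exact: (strongly_measurable_norm_sub mu_complete mD (mfn n) mf).
- exact: measurable_cst.
- apply: filterS fnf => x fnf Dx.
  under eq_cvg => n do rewrite distrC.
  by apply: cvg_dist_EFin0; exact: fnf.
- apply/integrableP; split.
    by apply/measurable_EFinP; apply: measurable_funM => //; exact/measurable_EFinP.
  rewrite (eq_integral (fun x => (2%:E * (psi x)%:E)%E)); last first.
    by move=> x; rewrite inE => Dx; rewrite -EFinM /= ger0_norm// mulr_ge0// psi0.
  by rewrite ge0_integralZl_EFin//; exact: lte_mul_pinfty.
- apply: filterS2 fpsi dom => x fpsi dom n Dx; rewrite /= lee_fin normr_id.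
  by apply: le_trans (ler_normB _ _) _; have := fpsi Dx; have := dom Dx n; lra.
rewrite integral0 in lim0.
apply/cvgrPdist_lt => e e0.
have := cvge0_lt e0 lim0; apply: filterS => n; rewrite -lte_fin; apply: le_lt_trans.
rewrite distrC; apply: (bochner_norm_le mu_complete mD).
exact: (bochner_sub mu_complete mD).
Unshelve. all: by end_near. Qed.

(** This is how an integral over [s, t] is read off from one over the whole line, in the
    verification of the mild solution formula. *)
Lemma bochner_subset D E f k (v : X) : measurable D -> measurable E -> E `<=` D ->
  {ae mu, forall x, E x -> k x = f x} -> (forall x, D x -> ~ E x -> k x = 0) ->
  is_bochner mu D k v -> is_bochner mu E f v.
Proof.
move=> mD mE ED kf k0 [mk [s [hs sf sv]]].
apply: (bochner_ae_eq mu_complete mE kf).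
have ms n : sfun_meas (s n) by move=> q /hs[].
have mkE : strongly_measurable mu E k := strongly_measurable_subset ED mk.
split => //.
have msE n : sfun_meas (sfun_restr E (s n)) by exact: sfun_meas_restr.
have mks n := strongly_measurable_norm_sub_sfun mu_complete mD (ms n) mk.
exists (fun n => sfun_restr E (s n)); split.
- move=> n _ /mapP[q qs ->] /=; have [mq qD fq] := hs n q qs.
  have mqE : measurable (q.1 `&` E) by exact: measurableI.
  split => //; apply: le_lt_trans fq; apply: measure_mono => //.
- apply: (@squeeze_cvge _ _ _ _ (cst 0%E) _ (fun n => \int[mu]_(x in D) `|k x - sfun_eval (s n) x|%:E)%E).
  + near=> n; apply/andP; split; first exact: integral_ge0.
    rewrite (eq_integral (fun x => `|k x - sfun_eval (s n) x|%:E)); last first.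
      by move=> x xE; rewrite sfun_eval_restr indicE xE scale1r.
    by apply: ge0_subset_integral => //.
  + exact: cvg_cst.
  + exact: sf.
- apply/cvgrPdist_lt => e e0.
  have e2 : 0 < e / 2 by rewrite divr_gt0.
  near=> n.
  rewrite -(subrKA (sfun_int mu (s n))) (splitr e).
  apply: le_lt_trans (ler_normD _ _) _; apply: ltrD.
    by near: n; move/cvgrPdist_lt : sv; apply.
  (* What restriction to [E] discards is the integral of the simple function over [D] minus [E].
     There [k] vanishes, so the norm of the simple function equals its distance to [k], which is
     small in L^1. *)
  have mDE : measurable (D `\` E) by exact: measurableD.
  have -> : sfun_int mu (s n) - \sum_(q <- sfun_restr E (s n)) fine (mu q.1) *: q.2 =
      sfun_int mu (sfun_restr (D `\` E) (s n)).
    rewrite /sfun_int !big_map -sumrB big_seq [RHS]big_seq; apply: eq_bigr => q qs /=.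
    have [mq qD fq] := hs n q qs.
    have m1 : measurable (q.1 `&` E) by exact: measurableI.
    have m2 : measurable (q.1 `&` (D `\` E)) by exact: measurableI.
    have d12 : (q.1 `&` E) `&` (q.1 `&` (D `\` E)) = set0.
      by apply/seteqP; split=> x //= -[[_ ?] [_ [_]]].
    have qq : q.1 = (q.1 `&` E) `|` (q.1 `&` (D `\` E)).
      apply/seteqP; split => x; last by move=> [[]|[]].
      by move=> qx; have [Ex|Ex] := pselect (E x); [left|right; split => //; split => //; exact: qD].
    have f1 : (mu (q.1 `&` E) < +oo)%E by apply: le_lt_trans fq; apply: measure_mono.
    have f2 : (mu (q.1 `&` (D `\` E)) < +oo)%E by apply: le_lt_trans fq; apply: measure_mono.
    rewrite [in X in X - _]qq measureU// fineD ?ge0_fin_numE//.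
    by rewrite -scalerBl addrAC subrr add0r.
  rewrite -lte_fin.
  apply: (@le_lt_trans _ _ (\int[mu]_(x in D) `|k x - sfun_eval (s n) x|%:E)%E).
    apply: le_trans (@sfun_int_le _ _ _ _ mu _ (D `\` E) mDE _) _.
      move=> _ /mapP[q qs ->] /=; have [mq qD fq] := hs n q qs.
      have m2 : measurable (q.1 `&` (D `\` E)) by exact: measurableI.
      by split => //; apply: le_lt_trans fq; apply: measure_mono.
    rewrite (eq_integral (fun x => `|k x - sfun_eval (s n) x|%:E)); last first.
      move=> x xE; rewrite sfun_eval_restr indicE xE scale1r.
      by move: xE; rewrite inE => -[Dx nEx]; rewrite k0// sub0r normrN.
    by apply: ge0_subset_integral => // x [].
  by near: n; exact: cvge0_lt.
Unshelve. all: by end_near. Qed.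

End BochnerExistence.

(** * Lebesgue measure and translations *)

Section LebesgueField.
Context {R : realType}.
Local Notation lam := (@leb R).
Local Notation lout := (mu_ext (wlength (R:=R) idfun)).

Lemma leb_complete : measure_is_complete lam.
Proof. exact: completed_lebesgue_measure_is_complete. Qed.

Lemma leb_sigma_finite : sigma_finite setT lam.
Proof. exact: (sigma_finiteT (@completed_lebesgue_measure R)). Qed.

Lemma borel_measurable_LebR (A : set R) :
  measurable (A : set (measurableTypeR R)) -> measurable (A : set (LebR R)).
Proof. exact: sub_caratheodory. Qed.

Lemma continuous_measurable_LebR (D : set (LebR R)) (f : R -> R) :
  continuous f -> measurable_fun D (f : LebR R -> R).
Proof.
move=> cf; apply: (@measurable_funS _ _ _ _ setT) => //.
move=> _ B mB; rewrite setTI; apply: borel_measurable_LebR.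
by have := continuous_measurable_fun cf measurableT mB; rewrite setTI.
Qed.

Lemma leb_itvcc (a b : R) : a <= b -> lam `[a, b]%classic = (b - a)%:E.
Proof.
move=> ab; have := @lebesgue_measure_itv R `[a, b]; rewrite /= => h.
transitivity (lebesgue_measure `[a, b]%classic); first by [].
rewrite h lte_fin; case: ltP => //= ba; by rewrite (le_anti (introT andP (conj ab ba))) subrr.
Qed.

Lemma leb_set1 (a : R) : lam [set a] = 0%E.
Proof. exact: lebesgue_measure_set1. Qed.

Lemma ocitv_shift (t : R) (F : set (ocitv_type R)) : ocitv F ->
  ocitv [set x : R | F (x + t)] /\
  wlength (R:=R) idfun [set x : R | F (x + t)] = wlength idfun F.
Proof.
case=> [[a b] _ <-] /=.
have -> : [set x | a < x + t <= b] = `]a - t, b - t]%classic.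
  by apply/seteqP; split => x /=; rewrite in_itv/= ltrBlDr lerBrDr.
have -> : [set x | a < x <= b] = `]a, b]%classic.
  by apply/seteqP; split => x /=; rewrite in_itv.
split; first exact: is_ocitv.
by rewrite !wlength_itv /= !lte_fin ltrBlDr subrK -!EFinB; case: ifP => // _; congr EFin; lra.
Qed.

(** Translating a countable cover by half-open intervals gives a cover of the translate with the
    same total length. *)
Lemma lout_shift_le (t : R) (A : set R) :
  (lout [set x : R | A (x + t)%R] <= lout A)%E.
Proof.
apply: le_ereal_inf_tmp => _ [F [mF AF] <-].
apply: ereal_inf_lbound.
exists (fun k => [set x : R | F k (x + t)]).
  split; first by move=> i; exact: (ocitv_shift t (mF i)).1.
  by move=> x /AF [k _ Fk]; exists k.
by apply: eq_eseriesr => k _; exact: (ocitv_shift t (mF k)).2.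
Qed.

Lemma lout_shift (t : R) (A : set R) : lout [set x : R | A (x + t)] = lout A.
Proof.
apply/eqP; rewrite eq_le lout_shift_le /=.
have := lout_shift_le (- t) [set x : R | A (x + t)].
by rewrite (_ : [set x | _] = A)//; apply/seteqP; split => x /=; rewrite addrNK.
Qed.

(** On the completed sigma-field, continuity of the translation is not enough. The Caratheodory
    criterion for [A] is tested on the translated set, and invariance of the outer measure moves it
    back. *)
Lemma measurable_shift (t : R) (A : set (LebR R)) : measurable A ->
  measurable ([set x : R | A (x + t)] : set (LebR R)).
Proof.
move=> mA0; have mA : caratheodory_measurable lout A := mA0.
suff : caratheodory_measurable lout [set x : R | A (x + t)] by [].
move=> X.
have := mA [set x : R | X (x - t)].
rewrite -(lout_shift t [set x : R | X (x - t)]) -(lout_shift t ([set x : R | X (x - t)] `&` A))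
  -(lout_shift t ([set x : R | X (x - t)] `&` ~` A)).
set X1 := (X in lout X = _).
have -> : X1 = X by apply/seteqP; split => x; rewrite /X1 /= addrK.
set X2 := (X in _ = (lout X + _)%E); set X3 := (X in _ = (_ + lout X)%E).
have -> : X2 = X `&` [set x : R | A (x + t)].
  by apply/seteqP; split => x; rewrite /X2 /= addrK.
have -> : X3 = X `&` ~` [set x : R | A (x + t)].
  by apply/seteqP; split => x; rewrite /X3 /= addrK.
done.
Qed.

Lemma leb_shift (t : R) (A : set (LebR R)) :
  lam [set x : R | A (x + t)] = lam A.
Proof. exact: lout_shift. Qed.

Definition shift_LebR (t : R) (x : LebR R) : LebR R := ((x : R) + t)%R.

Lemma measurable_fun_shift (t : R) : measurable_fun setT (shift_LebR t).
Proof. by move=> _ A mA; rewrite setTI; exact: measurable_shift. Qed.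

Lemma ge0_integral_shift (t : R) (D : set (LebR R)) (f : R -> \bar R) :
  measurable D -> measurable_fun D (f : LebR R -> \bar R) ->
  (forall x, D x -> (0 <= f x)%E) ->
  (\int[lam]_(x in [set x : R | D (x + t)%R]) f ((x : R) + t)%R = \int[lam]_(x in D) f x)%E.
Proof.
move=> mD mf f0.
have := @ge0_integral_pushforward _ _ _ _ R (shift_LebR t) (measurable_fun_shift t) lam D f mD mf.
move=> /(_ _)/wrap[|<-].
  by move=> x; rewrite inE; exact: f0.
apply: eq_measure_integral; first exact: measurable_fun_shift.
by move=> ? A mA AD; exact: (leb_shift t A).
Qed.

Lemma ae_shift (t : R) (P : LebR R -> Prop) : {ae lam, forall x, P x} ->
  {ae lam, forall x, P (shift_LebR t x)}.
Proof.
case=> N [mN N0 hN]; exists [set x : R | N (x + t)]; split.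
- exact: measurable_shift.
- by rewrite leb_shift.
- by move=> x; exact: hN.
Qed.

Lemma ae_notin_set1 (a : R) : {ae lam, forall x : LebR R, (x : R) <> a}.
Proof.
exists [set a]; split.
- exact: borel_measurable_LebR.
- exact: leb_set1.
- by move=> x /= /contrapT.
Qed.

Context {X : normedModType R}.

Definition sfun_shift (t : R) (s : seq (set (LebR R) * X)) :=
  [seq ([set x : R | q.1 (x + t)] : set (LebR R), q.2) | q <- s].

Lemma sfun_eval_shift t s x : sfun_eval (sfun_shift t s) x = sfun_eval s (shift_LebR t x).
Proof.
by rewrite /sfun_eval big_map; apply: eq_bigr => q _ /=; rewrite !indicE.
Qed.

Lemma strongly_measurable_shift t (f : R -> X) : strongly_measurable lam setT f ->
  strongly_measurable lam setT (fun x => f (x + t)).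
Proof.
move=> [s [ms hs]]; exists (fun n => sfun_shift t (s n)); split.
  by move=> n _ /mapP[q qs ->]; exact: (measurable_shift t (ms n q qs)).
apply: filterS (ae_shift t hs) => x hx _.
by under eq_cvg => n do rewrite sfun_eval_shift; exact: hx.
Qed.

Lemma bochner_shift t (f : R -> X) (v : X) : is_bochner lam setT f v ->
  is_bochner lam setT (fun x => f (x + t)) v.
Proof.
move=> [mf [s [hs sf sv]]]; split; first exact: strongly_measurable_shift.
have ms n : sfun_meas (s n) by move=> q /hs[].
exists (fun n => sfun_shift t (s n)); split.
- move=> n _ /mapP[q qs ->] /=; have [mq _ fq] := hs n q qs; split => //.
    exact: measurable_shift.
  by rewrite leb_shift.
- rewrite [X in X @ _ --> _](_ : _ = (fun n => \int[lam]_x `|f x - sfun_eval (s n) x|%:E)%E)//.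
  apply/funext => n.
  have mn := strongly_measurable_norm_sub_sfun leb_complete measurableT (ms n) mf.
  have H := ge0_integral_shift t measurableT mn (fun x _ => normr_ge0 _).
  rewrite -H; apply: eq_integral => x _; rewrite sfun_eval_shift //.
- rewrite [X in X @ _ --> _](_ : _ = (fun n => \sum_(q <- s n) fine (lam q.1) *: q.2))//.
  by apply/funext => n; rewrite big_map; apply: eq_bigr => q _ /=; rewrite leb_shift.
Qed.


Lemma ge0_integral_shift_itv (t a b : R) (f : R -> \bar R) :
  measurable_fun setT (f : LebR R -> \bar R) -> (forall x, (0 <= f x)%E) ->
  (\int[lam]_(x in `[a, b]%classic) f ((x : R) + t)%R =
   \int[lam]_(x in `[(a + t)%R, (b + t)%R]%classic) f x)%E.
Proof.
move=> mf f0.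
have mI : measurable (`[a + t, b + t]%classic : set (LebR R)).
  exact: borel_measurable_LebR.
rewrite -(ge0_integral_shift t mI)//; last exact: measurable_funS mf.
congr (integral _ _ _); apply/seteqP; split => x /=; by rewrite !in_itv/= !lerD2r.
Qed.

End LebesgueField.

(** * Green's function of an exponential dichotomy *)

Section GreenFunction.
Context {R : realType} {X : completeNormedModType R}.
Variables (U : R -> R -> X -> X) (P : R -> X -> X) (Ut : R -> R -> X -> X)
  (M delta : R).
Hypothesis evU : evolution_family U.
Hypothesis dich : exp_dichotomy U P Ut M delta.
Local Notation Gam := (green U P Ut).

Lemma dich_M_gt0 : 0 < M. Proof. by case: dich => -[]. Qed.

Lemma dich_delta_gt0 : 0 < delta. Proof. by case: dich => -[]. Qed.

Lemma dich_P_lin t a x y : P t (a *: x + y) = a *: P t x + P t y.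
Proof. by case: dich => _ /(_ t)[[h _] _] _ _ _; exact: h. Qed.

Lemma dich_P_cont t : continuous (P t).
Proof. by case: dich => _ /(_ t)[[_ h] _] _ _ _. Qed.

Lemma dich_P_idem t x : P t (P t x) = P t x.
Proof. by case: dich => _ /(_ t)[_ h] _ _ _. Qed.

Lemma dich_PU t s x : s <= t -> U t s (P s x) = P t (U t s x).
Proof. by case: dich => _ _ [_ h] _ _; exact: h. Qed.

Lemma evU_lin t s a x y : s <= t -> U t s (a *: x + y) = a *: U t s x + U t s y.
Proof. by case: evU => h _ _ _ /h[]. Qed.

Lemma evU_comp t r s x : s <= r -> r <= t -> U t r (U r s x) = U t s x.
Proof. by case: evU => _ h _ _; exact: h. Qed.

Lemma evU_id t x : U t t x = x.
Proof. by case: evU => _ _ h _; exact: h. Qed.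

Lemma dich_PB t x y : P t (x - y) = P t x - P t y.
Proof. by rewrite addrC -scaleN1r dich_P_lin scaleN1r addrC. Qed.

Lemma evU_B t s x y : s <= t -> U t s (x - y) = U t s x - U t s y.
Proof. by move=> st; rewrite addrC -scaleN1r evU_lin// scaleN1r addrC. Qed.

Lemma evU_0 t s : s <= t -> U t s 0 = 0.
Proof. by move=> st; rewrite -[X in U t s X](subrr (0 : X)) evU_B// subrr. Qed.

Lemma dich_P_compl t x : P t (x - P t x) = 0.
Proof. by rewrite dich_PB dich_P_idem subrr. Qed.

(* On the range of Q(t), i.e. the kernel of P(t), Ut t s is characterised as the inverse of U s t. *)
Lemma dich_Ut_unique t s x y : t <= s -> P t y = 0 ->
  U s t y = x - P s x -> Ut t s (x - P s x) = y.
Proof.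
move=> ts Py <-; case: dich => _ _ _ /(_ s t ts)[h _ _] _.
by apply: h; rewrite Py subr0.
Qed.

Lemma dich_Ut_P t s x : t <= s -> P t (Ut t s (x - P s x)) = 0.
Proof.
move=> ts; case: dich => _ _ _ /(_ s t ts)[_ _ h] _.
have := h (x - P s x); rewrite dich_P_compl subr0 => /(_ erefl) /eqP.
by rewrite -subr_eq0 addrAC subrr sub0r oppr_eq0 => /eqP.
Qed.

Lemma dich_UUt t s x : t <= s -> U s t (Ut t s (x - P s x)) = x - P s x.
Proof.
move=> ts; case: dich => _ _ _ /(_ s t ts)[_ h _] _.
by apply: h; rewrite dich_P_compl subr0.
Qed.

Lemma evU_N t s x : s <= t -> U t s (- x) = - U t s x.
Proof. by move=> st; rewrite -sub0r evU_B// evU_0// sub0r. Qed.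

Lemma green_le t s x : s <= t -> Gam t s x = U t s (P s x).
Proof. by rewrite /green => ->. Qed.

Lemma green_gt t s x : t < s -> Gam t s x = - Ut t s (x - P s x).
Proof. by rewrite /green ltNge => /negbTE ->. Qed.

(** [Ut] is given only as an inverse on the range of Q; its linearity comes from uniqueness of
    preimages under [U s t] within the kernel of [P t]. *)
Lemma green_lin t s a x y : Gam t s (a *: x + y) = a *: Gam t s x + Gam t s y.
Proof.
rewrite /green; case: ifPn => [st|]; first by rewrite dich_P_lin evU_lin.
rewrite -ltNge => /ltW ts.
rewrite (@dich_Ut_unique t s _ (a *: Ut t s (x - P s x) + Ut t s (y - P s y))) //.
- by rewrite opprD scalerN.
- by rewrite dich_P_lin !dich_Ut_P// scaler0 addr0.
- by rewrite evU_lin// !dich_UUt// dich_P_lin scalerBr opprD addrACA.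
Qed.

Lemma green_bound t s x : `|Gam t s x| <= M * expR (- delta * `|t - s|) * `|x|.
Proof.
case: dich => _ _ _ _ [h1 h2]; rewrite /green; case: ifPn => [st|].
  by rewrite ger0_norm ?subr_ge0//; exact: h1.
by rewrite -ltNge => /ltW ts; rewrite normrN distrC ger0_norm ?subr_ge0//; exact: h2.
Qed.

Lemma green_bound0 t s x : `|Gam t s x| <= M * `|x|.
Proof.
apply: le_trans (green_bound t s x) _; rewrite ler_wpM2r//.
rewrite ler_piMr ?(ltW dich_M_gt0)// -expR0 ler_expR mulNr oppr_le0.
by rewrite mulr_ge0// ltW// dich_delta_gt0.
Qed.

Lemma evU_cvg {I : Type} (F : set_system I) {FF : Filter F} (a b : I -> R) t0 s0 x :
  s0 <= t0 -> a @ F --> t0 -> b @ F --> s0 -> (\forall i \near F, b i <= a i) ->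
  U (a i) (b i) x @[i --> F] --> U t0 s0 x.
Proof.
move=> st at0 bs0 ba; case: evU => _ _ _ /(_ x)/subspace_continuousP/(_ (t0, s0) st) h.
move=> B /h {}h.
have : nbhs (t0, s0) (fun q => q.2 <= q.1 -> B (U q.1 q.2 x)) := h.
move=> {}h; have ab := cvg_pair at0 bs0 h.
by apply: (@filterS2 _ F FF _ _ _ _ (ab _ _ _) ba) => i /=; exact.
Qed.

(** Pushing both backward vectors forward to time [s'] shows that their difference is [Ut t s']
    applied to the Q-part of U(s', s)x - x. Continuity in [s] above the diagonal thus reduces to
    continuity of U at the identity. *)
Lemma green_cvg_le t s s' x : t < s -> s <= s' ->
  `|Gam t s x - Gam t s' x| <= M * `|U s' s x - x|.
Proof.
move=> ts ss'.
rewrite (green_gt _ ts) (green_gt _ (lt_le_trans ts ss')).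
have ts' := le_trans (ltW ts) ss'.
set y := Ut t s _; set y' := Ut t s' _.
rewrite -opprD normrN.
have e1 : U s' t (y - y') = (U s' s x - x) - P s' (U s' s x - x).
  rewrite evU_B// /y' dich_UUt// -(evU_comp _ (ltW ts) ss') /y dich_UUt ?(ltW ts)//.
  rewrite evU_B// dich_PU// dich_PB !opprB.
  by rewrite [P s' x - x]addrC addrACA; congr (_ + _); exact: addrC.
rewrite -(@dich_Ut_unique t s' (U s' s x - x) (y - y') ts' _ e1); last first.
  by rewrite dich_PB !dich_Ut_P ?subrr// ltW.
case: dich => _ _ _ _ [_ h]; apply: le_trans (h _ _ _ ts') _.
rewrite ler_wpM2r// ler_piMr ?(ltW dich_M_gt0)// -expR0 ler_expR mulNr oppr_le0.
by rewrite mulr_ge0 ?subr_ge0// ltW// dich_delta_gt0.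
Qed.

Lemma green_continuous_s t s0 x : s0 != t -> {for s0, continuous (fun s => Gam t s x)}.
Proof.
rewrite neq_lt => /orP[st|ts]; rewrite /prop_for /continuous_at.
- have -> : Gam t s0 x = P t (U t s0 x) by rewrite /green (ltW st) dich_PU// ltW.
  have h : (fun s => P t (U t s x)) @ s0 --> P t (U t s0 x).
    apply: (@cvg_comp _ _ _ (fun s => U t s x) (P t) _ (nbhs (U t s0 x))).
      apply: evU_cvg; [exact: ltW|exact: cvg_cst|exact: cvg_id|].
      by apply: filterS (lt_nbhsl st) => s /ltW.
    exact: dich_P_cont.
  apply: cvg_trans h; apply: near_eq_cvg.
  apply: filterS (lt_nbhsl st) => s /ltW lst.
  by rewrite /green lst dich_PU.
- apply/cvgrPdist_lt => e e0.
  (* Maximum and minimum order the two times, so that one limit serves for [s] on either side of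
     [s0]. *)
  have h : U (Num.max s s0) (Num.min s s0) x @[s --> s0] --> x.
    rewrite -[X in _ --> X](evU_id s0); apply: evU_cvg => //.
    + apply/cvgrPdist_lt => d d0; near=> s.
      have : `|s0 - s| < d by near: s; exact: cvgr_dist_lt.
      by rewrite !ltr_norml; case: (leP s s0); lra.
    + apply/cvgrPdist_lt => d d0; near=> s.
      have : `|s0 - s| < d by near: s; exact: cvgr_dist_lt.
      by rewrite !ltr_norml; case: (leP s s0); lra.
    + by near=> s; rewrite ge_min le_max lexx.
  have eM : 0 < e / M by rewrite divr_gt0// dich_M_gt0.
  near=> s.
  have tls : t < s by near: s; exact: lt_nbhsr.
  have : `|x - U (Num.max s s0) (Num.min s s0) x| < e / M.
    by near: s; move/cvgrPdist_lt : h; exact.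
  rewrite ltr_pdivlMr ?dich_M_gt0// mulrC distrC; apply: le_lt_trans.
  case: (leP s s0) => ss0; last first.
    by apply: green_cvg_le => //; exact: ltW.
  by rewrite [X in X <= _]distrC; exact: green_cvg_le.
Unshelve. all: by end_near. Qed.

Lemma green_continuous_t t0 s x : t0 != s -> {for t0, continuous (fun t => Gam t s x)}.
Proof.
rewrite neq_lt => /orP[ts|st]; rewrite /prop_for /continuous_at.
(* Before [s], backward evolution is rewritten as forward evolution of one fixed vector [y] from an
   earlier time [a]; any [a] below [t0] serves. *)
- pose a := t0 - 1; have at0 : a < t0 by rewrite /a; lra.
  pose y := Ut a s (x - P s x).
  have las : a <= s by apply: ltW; exact: lt_trans ts.
  have E t : a <= t -> t < s -> Gam t s x = - U t a y.
    move=> la ls; rewrite green_gt//; congr (- _).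
    apply: dich_Ut_unique; first exact: ltW.
      by rewrite -dich_PU// /y dich_Ut_P// evU_0.
    by rewrite evU_comp// ?(ltW ls)// /y dich_UUt.
  rewrite E//; last exact: ltW.
  have h : (fun t => - U t a y) @ t0 --> - U t0 a y.
    apply: cvgN; apply: evU_cvg; [exact: ltW|exact: cvg_id|exact: cvg_cst|].
    by apply: filterS (lt_nbhsr at0) => t /ltW.
  apply: cvg_trans h; apply: near_eq_cvg; near=> t.
  by rewrite E//; [apply: ltW; near: t; exact: lt_nbhsr|near: t; exact: lt_nbhsl].
- rewrite {2}/green (ltW st).
  have h : (fun t => U t s (P s x)) @ t0 --> U t0 s (P s x).
    apply: evU_cvg; [exact: ltW|exact: cvg_id|exact: cvg_cst|].
    by apply: filterS (lt_nbhsr st) => t /ltW.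
  apply: cvg_trans h; apply: near_eq_cvg.
  by apply: filterS (lt_nbhsr st) => t /ltW lst; rewrite /green lst.
Unshelve. all: by end_near. Qed.

Lemma green_evol_le t s r x : s <= t -> r <= s -> U t s (Gam s r x) = Gam t r x.
Proof.
by move=> st rs; rewrite /green rs (le_trans rs st) evU_comp.
Qed.

Lemma green_evol_gt t s r x : s <= t -> t < r -> U t s (Gam s r x) = Gam t r x.
Proof.
move=> st tr; have sr := le_lt_trans st tr.
rewrite !green_gt// evU_N//; congr (- _); apply/esym.
apply: dich_Ut_unique; first exact: ltW.
  by rewrite -dich_PU// dich_Ut_P ?evU_0// ltW.
by rewrite evU_comp ?dich_UUt// ltW.
Qed.

(** With the two identities above, Gamma(t, r) - U(t, s) Gamma(s, r) is U(t, r) for r in ]s, t] and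
    0 for all other r. Integrated in r, this is the variation of constants formula. *)
Lemma green_evol_in t s r x : s < r -> r <= t ->
  Gam t r x - U t s (Gam s r x) = U t r x.
Proof.
move=> sr rt; have st := le_trans (ltW sr) rt.
rewrite green_le// green_gt// evU_N// opprK.
rewrite -(evU_comp _ (ltW sr) rt) dich_UUt ?(ltW sr)//.
by rewrite evU_B// addrC subrK.
Qed.

End GreenFunction.

(** * Strong measurability of an operator family applied to a function *)

Section OperatorFamily.
Context {R : realType} {X : normedModType R}.
Local Notation lam := (@leb R).

(** Grid of mesh 1/(n+1) starting at -(n+1), with left endpoints [node n j]; the form without
    division matches [truncn], which picks the index of a point. *)
Let cell (n j : nat) : set (LebR R) :=
  [set x : R | j%:R <= (x + n.+1%:R) * n.+1%:R < j.+1%:R].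

Let node (n j : nat) : R := j%:R / n.+1%:R - n.+1%:R.

Let measurable_cell n j : measurable (cell n j).
Proof.
have -> : cell n j = `[node n j, node n j.+1[%classic.
  apply/seteqP; split => x; rewrite /cell /node /= in_itv /=.
    by rewrite -ler_pdivrMr// -ltr_pdivlMr// lerBlDr ltrBrDr.
  by rewrite -[X in X -> _]/(is_true _) lerBlDr ltrBrDr ler_pdivrMr// ltr_pdivlMr.
exact: borel_measurable_LebR.
Qed.

Let dist_aux (a b c x : R) : a <= x + c -> x + c < a + b -> 0 <= b ->
  `|a - c - x| <= b.
Proof. by move=> h1 h2 h3; rewrite ler_norml; apply/andP; split; lra. Qed.

Let cell_node n j (x : R) : cell n j x -> `|node n j - x| <= n.+1%:R^-1.
Proof.
rewrite /cell /node /= => /andP[].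
rewrite -ler_pdivrMr// -ltr_pdivlMr// -[j.+1%:R]natr1 mulrDl mul1r => h1 h2.
have h3 : 0 <= n.+1%:R^-1 :> R by rewrite invr_ge0.
exact: dist_aux h1 h2 h3.
Qed.

(** The operator is frozen at the left endpoint of each grid cell and applied to simple approximants
    of [k]. Strong continuity handles the moving operator off the null set {t0}, and the uniform
    bound [C] handles the error in [k]. *)
Lemma strongly_measurable_opfamily (L : R -> X -> X) (C t0 : R) (k : R -> X) :
  0 <= C ->
  (forall s (a : R) x y, L s (a *: x + y) = a *: L s x + L s y) ->
  (forall s x, `|L s x| <= C * `|x|) ->
  (forall s x, s != t0 -> {for s, continuous (fun s => L s x)}) ->
  strongly_measurable lam setT k ->
  strongly_measurable lam setT (fun s => L s (k s)).
Proof.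
move=> C0 Llin Lbd Lcont [sn [ms hs]].
have L0 s : L s 0 = 0.
  by have := Lbd s 0; rewrite normr0 mulr0 normr_le0 => /eqP.
have LB s x y : L s (x - y) = L s x - L s y.
  by rewrite addrC -scaleN1r Llin scaleN1r addrC.
(* 2 (n+1)^2 cells of length 1/(n+1) tile [-(n+1), n+1[, so every point is eventually covered. *)
pose Nn n := (2 * n.+1 ^ 2)%N.
pose r n := flatten [seq sfun_restr (cell n j) (sfun_map (L (node n j)) (sn n)) | j <- iota 0 (Nn n)].
have rE n x : sfun_eval (r n) x =
   \sum_(j <- iota 0 (Nn n)) (\1_(cell n j) x : R) *: L (node n j) (sfun_eval (sn n) x).
  rewrite /r; elim: (iota _ _) => [|j l IH]; first by rewrite /sfun_eval !big_nil.
  by rewrite /= sfun_eval_cat big_cons IH sfun_eval_restr sfun_eval_map.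
exists r; split.
  move=> n q /flattenP[_ /mapP[j _ ->]] /mapP[q' q's ->] /=.
  apply: measurableI; last exact: measurable_cell.
  by move: q's => /mapP[q'' q''s ->]; exact: (ms n q'' q''s).
apply: filterS2 hs (ae_notin_set1 t0) => x hs xt0 _.
have {}hs := hs I.
have xx0 : (x : R) != t0 by apply/eqP.
have cell_ex : \forall n \near \oo, exists j, (j < Nn n)%N /\ cell n j x.
  have hx : \forall n \near \oo, `|x : R| < n.+1%:R.
    near=> n; apply: (@lt_le_trans _ _ n%:R); last by rewrite ler_nat.
    near: n; exact: nbhs_infty_gtr.
  apply: filterS hx => n; rewrite ltr_norml => /andP[x1 x2].
  pose y := ((x : R) + n.+1%:R) * n.+1%:R.
  have y0 : 0 <= y by rewrite /y mulr_ge0// -lerBlDr sub0r ltW.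
  exists (Num.truncn y); split; last by rewrite /cell /=; exact: truncn_itv.
  rewrite -(ltr_nat R); apply: (@le_lt_trans _ _ y).
    by have /andP[] := truncn_itv y0.
  by rewrite /Nn natrM natrX expr2 mulrA ltr_pM2r// mulr_natl mulr2n ltrD2r.
have key : \forall n \near \oo, exists a, `|a - (x : R)| <= n.+1%:R^-1 /\
    sfun_eval (r n) x = L a (sfun_eval (sn n) x).
  apply: filterS cell_ex => n [j [jN cj]]; exists (node n j); split; first exact: cell_node.
  rewrite rE (bigD1_seq j) ?mem_iota ?iota_uniq//= indicE mem_set// scale1r.
  rewrite big1 ?addr0// => i ij; rewrite indicE memNset ?scale0r// => ci.
  move: ij; apply/negP/negPn; move: ci cj; rewrite /cell /= => /andP[a1 a2] /andP[b1 b2].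
  have := le_lt_trans a1 b2; have := le_lt_trans b1 a2.
  by rewrite !ltr_nat !ltnS => ? ?; rewrite eqn_leq; apply/andP.
apply/cvgrPdist_lt => e e0.
have e2 : 0 < e / 2 by rewrite divr_gt0.
(* [C] may be 0, hence the division by [C + 1]. *)
have eC : 0 < e / 2 / (C + 1) by rewrite divr_gt0//; lra.
have /cvgrPdist_lt/(_ _ e2)/nbhs_ballP[d /= d0 hd] := Lcont x (k x) xx0.
near=> n.
have [a [ax ->]] : exists a, `|a - (x : R)| <= n.+1%:R^-1 /\
    sfun_eval (r n) x = L a (sfun_eval (sn n) x) by near: n.
rewrite -(subrKA (L a (k x))) (splitr e).
apply: le_lt_trans (ler_normD _ _) _; apply: ltrD.
  apply: hd; rewrite -ball_normE /= distrC; apply: le_lt_trans ax _.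
  by near: n; exact: near_infty_natSinv_lt (PosNum d0).
rewrite -LB; apply: le_lt_trans (Lbd _ _) _.
apply: (@le_lt_trans _ _ ((C + 1) * `|k x - sfun_eval (sn n) x|)).
  by rewrite ler_wpM2r//; lra.
rewrite mulrC -ltr_pdivlMr; last by lra.
by near: n; move/cvgrPdist_lt : hs; apply.
Unshelve. all: by end_near. Qed.

End OperatorFamily.

(** * Exponential kernels and Stepanov norms *)

Lemma measurable_itv_LebR {R : realType} (i : interval R) :
  measurable ([set` i] : set (LebR R)).
Proof. by apply: borel_measurable_LebR; exact: measurable_itv. Qed.

Section GeometricWeights.
Context {R : realType}.

Lemma geometric_sum_tail (q : R) (a : nat -> R) (B : R) (N N' : nat) :
  0 < q -> q < 1 ->
  (forall j, 0 <= a j <= B) ->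
  \sum_(j < N') q ^+ j * a j <= \sum_(j < N) q ^+ j * a j + B * q ^+ N / (1 - q).
Proof.
move=> q0 q1 ha.
have q1' : 0 < 1 - q by lra.
have B0 : 0 <= B by have /andP[h1 h2] := ha 0%N; exact: le_trans h2.
have tail0 n : 0 <= B * q ^+ n / (1 - q).
  by rewrite divr_ge0 ?(ltW q1')// mulr_ge0// exprn_ge0// ltW.
case: (leqP N' N) => [NN|/ltnW NN].
  apply: ler_wpDr; first exact: tail0.
  rewrite -(subnK NN) addnC big_split_ord /= lerDl; apply: sumr_ge0 => i _.
  by rewrite mulr_ge0 ?exprn_ge0 ?(ltW q0)//; have /andP[] := ha (N' + i)%N.
(* Adding the remainder at [N'] makes the claim inductive: each new term, at most [q ^+ n * B], is
   exactly what the remainder loses. *)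
suff : \sum_(j < N') q ^+ j * a j + B * q ^+ N' / (1 - q) <=
    \sum_(j < N) q ^+ j * a j + B * q ^+ N / (1 - q).
  by apply: le_trans; rewrite lerDl.
elim: N' NN => [|n IH]; first by rewrite leqn0 => /eqP ->.
rewrite leq_eqVlt => /predU1P[->//|]; rewrite ltnS => /IH; apply: le_trans.
rewrite big_ord_recr /= -addrA lerD2l.
have -> : B * q ^+ n / (1 - q) = q ^+ n * B + B * q ^+ n.+1 / (1 - q).
  by rewrite exprS; field; lra.
rewrite lerD2r ler_wpM2l// ?exprn_ge0 ?(ltW q0)//.
by have /andP[] := ha n.
Qed.

(** [N] is chosen first to make the geometric remainder small, and the finite sum is then sent to 0
    along [F]; no uniformity in [j] is required. Both the Stepanov limits and the ergodic means pass
    through this criterion. *)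
Lemma geometric_cvg0 (q : R) {I : Type} (F : set_system I) {FF : Filter F} (K : I -> \bar R)
    (a : I -> nat -> R) (C : R) : 0 < q -> q < 1 ->
  (forall N, \forall i \near F, (0 <= K i)%E /\
     (K i <= (\sum_(j < N) q ^+ j * a i j + C * q ^+ N)%:E)%E) ->
  (forall j, a^~ j @ F --> (0 : R)) -> K @ F --> 0%E.
Proof.
move=> q0 q1 hK ha.
have hsum N : (fun i => \sum_(j < N) q ^+ j * a i j) @ F --> (0 : R).
  elim: N => [|N IH].
    by under eq_fun do rewrite big_ord0; exact: cvg_cst.
  under eq_fun do rewrite big_ord_recr /=.
  have h : (fun i => q ^+ N * a i N) @ F --> q ^+ N * 0 by apply: cvgMr; exact: ha.
  have := cvgD IH h; rewrite mulr0 addr0; exact.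
have hq : (fun N => C * q ^+ N) @ \oo --> (0 : R).
  rewrite -[X in _ --> X](mulr0 C); apply: cvgMr.
  by apply: cvg_expr; rewrite ger0_norm ?ltW.
have small e : 0 < e -> \forall i \near F, (0 <= K i)%E /\ (K i <= e%:E)%E.
  move=> e0; have e2 : 0 < e / 2 by rewrite divr_gt0.
  have /cvgrPdist_lt/(_ _ e2)[N _ hN] := hq.
  have {}hN := hN N (leqnn _); rewrite /= sub0r normrN in hN.
  have /cvgrPdist_lt/(_ _ e2) hs := hsum N.
  apply: filterS2 (hK N) hs => i [K0 KN]; rewrite sub0r normrN => hs.
  split => //; apply: le_trans KN _; rewrite lee_fin (splitr e).
  apply: lerD; first exact: le_trans (ler_norm _) (ltW hs).
  exact: le_trans (ler_norm _) (ltW hN).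
apply/fine_cvgP; split.
  apply: filterS (small 1 ltr01) => i [K0 K1].
  by rewrite ge0_fin_numE//; exact: le_lt_trans K1 (ltry _).
apply/cvgrPdist_le => e e0; apply: filterS (small e e0) => i [K0 Ke].
rewrite sub0r normrN ger0_norm ?fine_ge0//= -lee_fin fineK//.
by rewrite ge0_fin_numE//; exact: le_lt_trans Ke (ltry _).
Qed.

End GeometricWeights.

(** Young's inequality for the product of [y] and 1 with exponents p and p/(p-1). The case p = 1,
    which has no finite conjugate exponent, is separate. *)
Lemma le_powR_div {R : realType} (p y : R) : 1 <= p -> 0 <= y -> y <= y `^ p / p + (1 - p^-1).
Proof.
rewrite le_eqVlt => /predU1P[<-|p1] y0.
  by rewrite powRr1// invr1 mulr1 subrr addr0.
have p0 : 0 < p by lra.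
have q0 : 0 < p / (p - 1) by rewrite divr_gt0//; lra.
have := @conjugate_powR R y 1 p (p / (p - 1)) y0 ler01 p0 q0.
rewrite mulr1 powR1 invf_div mul1r => h; apply: le_trans (h _) _.
  by field; lra.
by rewrite lerD2l le_eqVlt; apply/orP; left; apply/eqP; field; lra.
Qed.

Section IntegralCover.
Context {R : realType} d (T : measurableType d) (mu : {measure set T -> \bar R}).

Lemma ge0_integral_setU_le (A B : set T) (f : T -> \bar R) :
  measurable A -> measurable B -> measurable_fun setT f -> (forall x, (0 <= f x)%E) ->
  (\int[mu]_(x in A `|` B) f x <= \int[mu]_(x in A) f x + \int[mu]_(x in B) f x)%E.
Proof.
move=> mA mB mf f0.
have mBA : measurable (B `\` A) by exact: measurableD.
have -> : A `|` B = A `|` (B `\` A).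
  apply/seteqP; split => x; last by move=> [|[]]; [left|right].
  by move=> [|Bx]; [left|have [Ax|Ax] := pselect (A x); [left|right]].
rewrite ge0_integral_setU//; last 2 first.
- exact: measurable_funS mf.
- by apply/disj_set2P; apply/seteqP; split => x //= -[? []].
apply: leeD => //; apply: ge0_subset_integral => //; exact: measurable_funS mf.
Qed.

Lemma ge0_integral_leZ (D : set T) (w k : T -> R) (c : R) : measurable D ->
  measurable_fun D w -> measurable_fun D k -> 0 <= c -> (forall x, 0 <= k x) ->
  (forall x, 0 <= w x) -> (forall x, D x -> w x <= c * k x) ->
  (\int[mu]_(x in D) (w x)%:E <= c%:E * \int[mu]_(x in D) (k x)%:E)%E.
Proof.
move=> mD mw mk c0 k0 w0 wk.
rewrite -ge0_integralZl_EFin//; last 2 first.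
- by move=> x _; rewrite lee_fin.
- exact/measurable_EFinP.
apply: ge0_le_integral => //.
- by move=> x _; rewrite lee_fin.
- exact/measurable_EFinP.
- by apply: emeasurable_funM => //; exact/measurable_EFinP.
Qed.

(** Hoelder's inequality against the constant 1 on a set of measure one, obtained by integrating a
    rescaled Young inequality. *)
Lemma integral_le_powR (p : R) (D : set T) (k : T -> R) : 1 <= p ->
  measurable D -> mu D = 1%E -> measurable_fun D k -> (forall x, 0 <= k x) ->
  (\int[mu]_(s in D) (k s `^ p)%:E < +oo)%E ->
  (\int[mu]_(s in D) (k s)%:E <=
   ((fine (\int[mu]_(s in D) (k s `^ p)%:E)) `^ p^-1)%:E)%E.
Proof.
move=> p1 mD D1 mk k0.
have p0 : 0 < p by lra.
have mkp : measurable_fun D (fun s => (k s `^ p)%:E).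
  by apply/measurable_EFinP; apply: (measurableT_comp (measurable_powR p)).
set J := (\int[mu]_(s in D) (k s `^ p)%:E)%E => fin.
have J0 : (0 <= J)%E by apply: integral_ge0 => x _; rewrite lee_fin powR_ge0.
have Jfin : J = (fine J)%:E by rewrite fineK// ge0_fin_numE.
have j0 : 0 <= fine J by exact: fine_ge0.
(* Young's inequality is applied to [k s / l]. A level [l] slightly above J^(1/p) stays positive
   even when J = 0, so nothing is divided by zero. *)
have main (l : R) : 0 < l -> fine J <= l `^ p -> (\int[mu]_(s in D) (k s)%:E <= l%:E)%E.
  move=> l0 jl.
  have lp0 : 0 < l `^ p by rewrite powR_gt0.
  pose c1 := l / (l `^ p * p); pose c2 := l * (1 - p^-1).
  have c10 : 0 <= c1 by rewrite divr_ge0 ?mulr_ge0// ltW.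
  have c20 : 0 <= c2.
    by rewrite mulr_ge0 ?(ltW l0)// subr_ge0 invf_le1.
  have bnd s : k s <= c1 * (k s `^ p) + c2.
    have lE : k s = l * (k s / l) by rewrite mulrCA divff ?mulr1// gt_eqF.
    have kl0 : 0 <= k s / l by rewrite divr_ge0// ltW.
    have -> : k s `^ p = l `^ p * (k s / l) `^ p by rewrite -powRM ?(ltW l0)// -lE.
    rewrite {1}lE.
    have -> : c1 * (l `^ p * (k s / l) `^ p) + c2 = l * ((k s / l) `^ p / p + (1 - p^-1)).
      by rewrite /c1 /c2; field; rewrite !gt_eqF.
    by rewrite ler_wpM2l ?(ltW l0)//; exact: le_powR_div.
  apply: (@le_trans _ _ (\int[mu]_(s in D) (c1%:E * (k s `^ p)%:E + c2%:E)%E)%E).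
    apply: ge0_le_integral => //.
    - by move=> x _; rewrite lee_fin.
    - exact/measurable_EFinP.
    - apply: emeasurable_funD => //; apply: emeasurable_funM => //.
    - by move=> x _; rewrite -EFinM -EFinD lee_fin.
  rewrite ge0_integralD//; last 2 first.
  - by move=> x _; rewrite -EFinM lee_fin mulr_ge0// powR_ge0.
  - by apply: emeasurable_funM.
  rewrite ge0_integralZl_EFin//; last by move=> x _; rewrite lee_fin powR_ge0.
  rewrite -/J Jfin integral_cst//= D1 mule1.
  rewrite -EFinM -EFinD lee_fin.
  apply: (@le_trans _ _ (c1 * l `^ p + c2)); first by rewrite lerD2r ler_wpM2l.
  by rewrite le_eqVlt; apply/orP; left; apply/eqP; rewrite /c1 /c2; field; rewrite !gt_eqF.
apply/lee_addgt0Pr => e e0; rewrite -EFinD; apply: main.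
  by rewrite ltr_wpDl// powR_ge0.
have {1}-> : fine J = (fine J `^ p^-1) `^ p by rewrite -powRrM mulVf ?gt_eqF// powRr1.
by apply: ge0_ler_powR => //; rewrite ?nnegrE ?powR_ge0 ?addr_ge0 ?powR_ge0 ?lerDl// ltW.
Qed.

End IntegralCover.

Section KernelEstimate.
Context {R : realType}.
Local Notation lam := (@leb R).

(** Each step enlarges the window by one unit interval on either side. On both, |t - s| is at least
    N, so the kernel is at most the N-th power of exp(-delta). *)
Lemma integral_expR_kernel_itv (delta t : R) (k : R -> R) (Phi : R -> R) (N : nat) :
  0 < delta -> measurable_fun setT (k : LebR R -> R) -> (forall x, 0 <= k x) ->
  (forall a, (\int[lam]_(s in `[a, (a + 1)%R]%classic) (k s)%:E <= (Phi a)%:E)%E) ->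
  (\int[lam]_(s in `[(t - N%:R)%R, (t + N%:R)%R]%classic)
      (expR (- delta * `|t - s|) * k s)%:E <=
   (\sum_(j < N) expR (- delta) ^+ j * (Phi (t + j%:R) + Phi (t - j%:R - 1)))%:E)%E.
Proof.
move=> d0 mk k0 hPhi.
pose w (s : R) := expR (- delta * `|t - s|) * k s.
have w0 s : 0 <= w s by rewrite mulr_ge0// expR_ge0.
have mwR : measurable_fun setT (w : LebR R -> R).
  apply: (measurable_funM _ mk).
  apply: continuous_measurable_LebR => s.
  apply: continuous_comp; last exact: continuous_expR.
  by apply: cvgMr; apply: cvg_norm; apply: cvgB; [exact: cvg_cst|exact: cvg_id].
have mw : measurable_fun setT (fun s : LebR R => (w s)%:E) := (measurable_EFinP _ _).2 mwR.
have mI a b : measurable (`[a, b]%classic : set (LebR R)) by exact: borel_measurable_LebR.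
have q0 : 0 <= expR (- delta) by exact: expR_ge0.
have piece j a : (forall s : R, a <= s <= a + 1 -> j%:R <= `|t - s|) ->
    (\int[lam]_(s in `[a, (a + 1)%R]%classic) (w s)%:E <= (expR (- delta) ^+ j * Phi a)%:E)%E.
  move=> hj.
  apply: le_trans (@ge0_integral_leZ _ _ _ lam (`[a, (a + 1)%R]%classic) w k (expR (- delta) ^+ j) (mI _ _) _ _ _ k0 w0 _) _.
  - exact: (measurable_funS _ _ mwR).
  - exact: (measurable_funS _ _ mk).
  - exact: exprn_ge0.
  - move=> s; rewrite /= in_itv/= => /hj js; rewrite /w ler_wpM2r//.
    by rewrite -expRM_natl ler_expR mulrC ler_wnM2r// oppr_le0 ltW.
  by rewrite EFinM lee_wpmul2l// lee_fin exprn_ge0.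
elim: N => [|N IH].
  rewrite big_ord0 subr0 addr0 set_itv1.
  have mt : measurable ([set t] : set (LebR R)) by exact: borel_measurable_LebR.
  rewrite (@ge0_negligible_integral _ _ _ lam [set t] [set t] (fun s => (w s)%:E) mt mt _ _ (leb_set1 t)).
  - by rewrite setDv integral_set0.
  - exact: (measurable_funS _ _ mw).
  - by move=> x _; rewrite lee_fin; exact: w0.
pose I1 : set (LebR R) := `[t - N%:R, t + N%:R]%classic.
pose I2 : set (LebR R) := `[t + N%:R, t + N%:R + 1]%classic.
pose I3 : set (LebR R) := `[t - N%:R - 1, t - N%:R - 1 + 1]%classic.
have w0' (x : LebR R) : (0 <= (w x)%:E)%E by rewrite lee_fin; exact: w0.
have mI12 : measurable (I1 `|` I2) := measurableU _ _ (mI _ _) (mI _ _).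
have mI123 : measurable (I1 `|` I2 `|` I3) := measurableU _ _ mI12 (mI _ _).
have sub : `[(t - N.+1%:R)%R, (t + N.+1%:R)%R]%classic `<=` I1 `|` I2 `|` I3.
  move=> s; rewrite /I1 /I2 /I3 /= !in_itv/= -natr1 => /andP[s1 s2].
  have [h1|h1] := leP s (t - N%:R - 1 + 1); first by right; apply/andP; split => //; lra.
  have [h2|h2] := leP s (t + N%:R); first by left; left; apply/andP; split => //; lra.
  by left; right; apply/andP; split; lra.
apply: le_trans (ge0_subset_integral lam (mI _ _) mI123 (measurable_funS _ _ mw) (fun x _ => w0' x) sub) _ => //.
have H1 := ge0_integral_setU_le lam mI12 (mI _ _ : measurable I3) mw w0'.
have H2 := ge0_integral_setU_le lam (mI _ _ : measurable I1) (mI _ _ : measurable I2) mw w0'.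
have p2 : (\int[lam]_(x in I2) (w x)%:E <= (expR (- delta) ^+ N * Phi (t + N%:R))%:E)%E.
  by apply: piece => s /andP[s1 s2]; rewrite ler_normr; apply/orP; right; lra.
have p3 : (\int[lam]_(x in I3) (w x)%:E <= (expR (- delta) ^+ N * Phi (t - N%:R - 1))%:E)%E.
  by apply: piece => s /andP[s1 s2]; rewrite ler_normr; apply/orP; left; lra.
apply: le_trans H1 _; apply: le_trans (leeD (le_trans H2 (leeD IH p2)) p3) _.
by rewrite big_ord_recr /= mulrDr addrA -!EFinD.
Qed.

(** The windows exhaust the line by monotone convergence, and the partial sums are cut at [N]
    uniformly in the window. [B *+ 2] appears because two unit intervals lie at each distance. *)
Lemma integral_expR_kernel (delta t B : R) (k : R -> R) (Phi : R -> R) (N : nat) :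
  0 < delta -> measurable_fun setT (k : LebR R -> R) -> (forall x, 0 <= k x) ->
  (forall a, 0 <= Phi a <= B) ->
  (forall a, (\int[lam]_(s in `[a, (a + 1)%R]%classic) (k s)%:E <= (Phi a)%:E)%E) ->
  (\int[lam]_s (expR (- delta * `|t - s|) * k s)%:E <=
   (\sum_(j < N) expR (- delta) ^+ j * (Phi (t + j%:R) + Phi (t - j%:R - 1)) +
    (B *+ 2 / (1 - expR (- delta))) * expR (- delta) ^+ N)%:E)%E.
Proof.
move=> d0 mk k0 hB hPhi.
have q0 : 0 < expR (- delta) by exact: expR_gt0.
have q1 : expR (- delta) < 1 by rewrite -expR0 ltr_expR oppr_lt0.
pose F (n : nat) : set (LebR R) := `[t - n%:R, t + n%:R]%classic.
have mF n : measurable (F n) by exact: measurable_itv_LebR.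
pose w (s : R) := expR (- delta * `|t - s|) * k s.
have w0 s : 0 <= w s by rewrite mulr_ge0// expR_ge0.
have mwR : measurable_fun setT (w : LebR R -> R).
  apply: (measurable_funM _ mk).
  apply: continuous_measurable_LebR => s.
  apply: continuous_comp; last exact: continuous_expR.
  by apply: cvgMr; apply: cvg_norm; apply: cvgB; [exact: cvg_cst|exact: cvg_id].
have mw : measurable_fun setT (fun s : LebR R => (w s)%:E) := (measurable_EFinP _ _).2 mwR.
have ndF : nondecreasing_seq F.
  move=> m n mn; rewrite subsetEset => s; rewrite /F /= !in_itv/= => /andP[s1 s2].
  have : m%:R <= n%:R :> R by rewrite ler_nat.
  by move=> mn'; apply/andP; split; lra.
have FT : \bigcup_n F n = setT.
  rewrite -subTset => s _; exists (Num.bound `|s - t : R|) => //.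
  have := ltW (archi_boundP (normr_ge0 (s - t : R))).
  by rewrite ler_norml /F /= in_itv/= => /andP[h1 h2]; apply/andP; split; lra.
have := @ge0_nondecreasing_set_cvg_integral _ _ _ F (fun s => (w s)%:E) lam ndF mF
  (fun i => measurable_funS measurableT (@subsetT _ _) mw) (fun _ x _ => w0 x).
rewrite FT => lim.
rewrite -(cvg_lim _ lim)//; apply: lime_le; first by apply/cvg_ex; eexists; exact: lim.
near=> n.
apply: le_trans (integral_expR_kernel_itv t n d0 mk k0 hPhi) _.
rewrite lee_fin [_ / _ * _]mulrAC.
apply: (@geometric_sum_tail _ _ (fun j => Phi (t + j%:R) + Phi (t - j%:R - 1)) (B *+ 2) N n q0 q1) => j.
have /andP[a1 a2] := hB (t + j%:R); have /andP[b1 b2] := hB (t - j%:R - 1).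
by rewrite addr_ge0//= mulr2n lerD.
Unshelve. all: by end_near. Qed.

End KernelEstimate.

Section WeightedBochner.
Context {R : realType} {d : measure_display} {T : measurableType d}
        {X : completeNormedModType R} (mu : {measure set T -> \bar R}).
Hypothesis mu_complete : measure_is_complete mu.
Hypothesis mu_sigma_finite : sigma_finite setT mu.
Variables (M : R) (W : T -> R).
Hypothesis M_ge0 : 0 <= M.
Hypothesis W_ge0 : forall x, 0 <= W x.
Hypothesis measurable_W : measurable_fun setT W.

Let measurable_MW : measurable_fun setT (fun x => (M * W x)%:E).
Proof. by apply/measurable_EFinP; apply: measurable_funM. Qed.

Let integral_MW : (\int[mu]_x (M * W x)%:E = M%:E * \int[mu]_x (W x)%:E)%E.
Proof.
under eq_integral do rewrite EFinM.
rewrite ge0_integralZl_EFin//; first by move=> x _; rewrite lee_fin.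
exact/measurable_EFinP.
Qed.

Let integral_norm_le (y : T -> X) : strongly_measurable mu setT y ->
  {ae mu, forall s, `|y s| <= M * W s} ->
  (\int[mu]_x `|y x|%:E <= M%:E * \int[mu]_x (W x)%:E)%E.
Proof.
move=> my yW; rewrite -integral_MW; apply: ae_ge0_le_integral => //.
- exact: (strongly_measurable_norm mu_complete measurableT my).
- by move=> x _; rewrite lee_fin mulr_ge0.
- by apply: filterS yW => s ys _; rewrite lee_fin.
Qed.

Lemma bochner_weight_le (y : T -> X) (v : X) : is_bochner mu setT y v ->
  {ae mu, forall s, `|y s| <= M * W s} ->
  (`|v|%:E <= M%:E * \int[mu]_x (W x)%:E)%E.
Proof.
move=> hy yW; apply: le_trans (bochner_norm_le mu_complete measurableT hy) _.
exact: (integral_norm_le hy.1).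
Qed.

Hypothesis W_int : (\int[mu]_x (W x)%:E < +oo)%E.

Lemma bochner_weight_exists (y : T -> X) : strongly_measurable mu setT y ->
  {ae mu, forall s, `|y s| <= M * W s} ->
  exists v, is_bochner mu setT y v.
Proof.
move=> my yW; apply: (bochner_exists mu_complete mu_sigma_finite measurableT my).
by apply: le_lt_trans (integral_norm_le my yW) _; exact: lte_mul_pinfty.
Qed.

Lemma bochner_weight_cvg (y : T -> X) (yn : nat -> T -> X) (vn : nat -> X) :
  (forall n, is_bochner mu setT (yn n) (vn n)) ->
  {ae mu, forall s, forall n, `|yn n s| <= M * W s} ->
  {ae mu, forall s, yn ^~ s @ \oo --> y s} ->
  exists v, is_bochner mu setT y v /\ vn @ \oo --> v.
Proof.
move=> hy yW lim.
apply: (@bochner_dominated_cvg _ _ _ _ mu mu_complete setT yn vn y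
  (fun s => M * W s) mu_sigma_finite measurableT measurable_MW) => //.
- by move=> x _; rewrite mulr_ge0.
- by rewrite integral_MW; exact: lte_mul_pinfty.
- by apply: filterS lim => s h _.
- by apply: filterS yW => s h _.
Qed.

End WeightedBochner.

Section Stepanov.
Context {R : realType} {X : completeNormedModType R}.
Local Notation lam := (@leb R).

Definition stepanov_norm (p : R) (k : R -> X) (a : R) : R :=
  (fine (\int[lam]_(s in `[a, (a + 1)%R]%classic) (`|k s| `^ p)%:E)) `^ p^-1.

Lemma measurable_norm_LebR (D : set (LebR R)) (k : R -> X) : measurable D ->
  strongly_measurable lam setT k ->
  measurable_fun D (fun s : LebR R => `|k s|).
Proof.
move=> mD mk; apply/measurable_EFinP.
apply: (measurable_funS measurableT (@subsetT _ _)).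
exact: (strongly_measurable_norm leb_complete measurableT mk).
Qed.

Lemma integral_unit_le_stepanov (p a : R) (k : R -> X) : 1 <= p -> Lploc p k ->
  (\int[lam]_(s in `[a, (a + 1)%R]%classic) `|k s|%:E <= (stepanov_norm p k a)%:E)%E.
Proof.
move=> p1 [mk fin].
have mI : measurable (`[a, (a + 1)%R]%classic : set (LebR R)) := measurable_itv_LebR _.
have m1 : lam `[a, (a + 1)%R]%classic = 1%E.
  by rewrite leb_itvcc ?lerDl// [a + 1]addrC addrK.
exact: (@integral_le_powR _ _ _ lam p _ (fun s => `|k s|) p1 mI m1
  (measurable_norm_LebR mI mk) (fun s => normr_ge0 _) (fin _ _)).
Qed.

Lemma stepanov_norm_bounded (p : R) (k : R -> X) : 1 <= p -> BS p k ->
  exists B, forall a, 0 <= stepanov_norm p k a <= B.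
Proof.
move=> p1 [[mk fin] [C hC]]; exists (C `^ p^-1) => a.
rewrite powR_ge0 /=.
have I0 : (0 <= \int[lam]_(s in `[a, (a + 1)%R]%classic) (`|k s| `^ p)%:E)%E.
  by apply: integral_ge0 => x _; rewrite lee_fin powR_ge0.
have C0 : 0 <= C by rewrite -lee_fin; exact: le_trans (hC a).
apply: ge0_ler_powR; rewrite ?nnegrE ?invr_ge0 ?fine_ge0//.
- by apply: le_trans p1.
- rewrite -lee_fin fineK; first exact: hC.
  by rewrite ge0_fin_numE//; exact: fin.
Qed.

Definition kernel_int (delta : R) (k : R -> X) (t : R) : \bar R :=
  (\int[lam]_s (expR (- delta * `|t - s|) * `|k s|)%:E)%E.

Lemma kernel_int_le (delta p t B : R) (k : R -> X) (N : nat) : 0 < delta -> 1 <= p ->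
  Lploc p k -> (forall a, 0 <= stepanov_norm p k a <= B) ->
  (kernel_int delta k t <=
   (\sum_(j < N) expR (- delta) ^+ j *
        (stepanov_norm p k (t + j%:R) + stepanov_norm p k (t - j%:R - 1)) +
    (B *+ 2 / (1 - expR (- delta))) * expR (- delta) ^+ N)%:E)%E.
Proof.
move=> d0 p1 kp hB.
exact: (integral_expR_kernel t N d0 (measurable_norm_LebR measurableT kp.1)
  (fun s => normr_ge0 _) hB (fun a => integral_unit_le_stepanov a p1 kp)).
Qed.

Lemma kernel_int_fin (delta p t : R) (k : R -> X) : 0 < delta -> 1 <= p ->
  BS p k -> (kernel_int delta k t < +oo)%E.
Proof.
move=> d0 p1 bk; have [B hB] := stepanov_norm_bounded p1 bk.
by apply: le_lt_trans (kernel_int_le t 0 d0 p1 bk.1 hB) (ltry _).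
Qed.

Lemma measurable_kernel (delta t : R) (k : R -> X) : strongly_measurable lam setT k ->
  measurable_fun setT (fun s : LebR R => expR (- delta * `|t - s|) * `|k s|).
Proof.
move=> mk; apply: (measurable_funM _ (measurable_norm_LebR measurableT mk)).
apply: continuous_measurable_LebR => s.
apply: continuous_comp; last exact: continuous_expR.
by apply: cvgMr; apply: cvg_norm; apply: cvgB; [exact: cvg_cst|exact: cvg_id].
Qed.

Let kernel_ge0 (delta t : R) (k : R -> X) (s : LebR R) :
  0 <= expR (- delta * `|t - s|) * `|k s|.
Proof. by rewrite mulr_ge0 ?expR_ge0. Qed.

Lemma bochner_kernel_le (delta t M : R) (k y : R -> X) (v : X) : 0 <= M ->
  strongly_measurable lam setT k -> is_bochner lam setT y v ->
  {ae lam, forall s : LebR R, `|y s| <= M * (expR (- delta * `|t - s|) * `|k s|)} ->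
  (`|v|%:E <= M%:E * kernel_int delta k t)%E.
Proof.
move=> M0 mk hy yk.
exact: (bochner_weight_le leb_complete M0 (kernel_ge0 delta t k)
  (measurable_kernel delta t mk) hy yk).
Qed.

Lemma bochner_kernel_exists (delta t M : R) (k y : R -> X) : 0 <= M ->
  strongly_measurable lam setT k -> strongly_measurable lam setT y ->
  (kernel_int delta k t < +oo)%E ->
  {ae lam, forall s : LebR R, `|y s| <= M * (expR (- delta * `|t - s|) * `|k s|)} ->
  exists v, is_bochner lam setT y v.
Proof.
move=> M0 mk my fin yk.
exact: (bochner_weight_exists leb_complete leb_sigma_finite M0 (kernel_ge0 delta t k)
  (measurable_kernel delta t mk) fin my yk).
Qed.

Lemma bochner_kernel_cvg (delta t M : R) (k y : R -> X) (yn : nat -> R -> X)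
    (vn : nat -> X) : 0 <= M ->
  strongly_measurable lam setT k -> (kernel_int delta k t < +oo)%E ->
  (forall n, is_bochner lam setT (yn n) (vn n)) ->
  {ae lam, forall s : LebR R, forall n, `|yn n s| <= M * (expR (- delta * `|t - s|) * `|k s|)} ->
  {ae lam, forall s : LebR R, yn ^~ s @ \oo --> y s} ->
  exists v, is_bochner lam setT y v /\ vn @ \oo --> v.
Proof.
move=> M0 mk fin hy yk lim.
exact: (bochner_weight_cvg leb_complete leb_sigma_finite M0 (kernel_ge0 delta t k)
  (measurable_kernel delta t mk) fin hy yk lim).
Qed.

End Stepanov.

(** Only sequences within distance 1 of [x] are tested, so that one majorant can serve the whole
    sequence in dominated convergence. *)
Lemma continuous_at_seq {R : realType} {V : normedModType R} (f : R -> V) (x : R) :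
  (forall u : nat -> R, (forall n, `|x - u n| <= 1) -> u @ \oo --> x ->
     f \o u @ \oo --> f x) ->
  {for x, continuous f}.
Proof.
move=> H; apply/cvgrPdist_lt => e e0; apply: contrapT => nh.
have /choice[u hu] : forall n, exists y : R, `|x - y| < n.+1%:R^-1 /\ ~ (`|f x - f y| < e).
  move=> n; apply: contrapT => h; apply: nh.
  have n0 : 0 < n.+1%:R^-1 :> R by rewrite invr_gt0.
  exists n.+1%:R^-1 => //= y xy.
  by apply: contrapT => hy; apply: h; exists y.
have ux : u @ \oo --> x.
  apply/cvgrPdist_lt => d d0; near=> n; apply: lt_trans (hu n).1 _.
  by near: n; exact: near_infty_natSinv_lt (PosNum d0).
have u1 n : `|x - u n| <= 1.
  by apply: le_trans (ltW (hu n).1) _; rewrite invf_le1// ler1n.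
have /cvgrPdist_lt/(_ _ e0)[N _ hN] := H u u1 ux.
exact: (hu N).2 (hN N (leqnn N)).
Unshelve. all: by end_near. Qed.

(** * The bounded mild solution: existence, regularity, uniqueness *)

Section Solution.
Context {R : realType} {X : completeNormedModType R}.
Local Notation lam := (@leb R).
Variables (U : R -> R -> X -> X) (P : R -> X -> X) (Ut : R -> R -> X -> X)
  (M delta : R).
Hypothesis evU : evolution_family U.
Hypothesis dich : exp_dichotomy U P Ut M delta.
Local Notation Gam := (green U P Ut).
Let M0 : 0 <= M := ltW (dich_M_gt0 dich).
Let d0 : 0 < delta := dich_delta_gt0 dich.

Lemma green_strongly_measurable t (k : R -> X) :
  strongly_measurable lam setT k ->
  strongly_measurable lam setT (fun s => Gam t s (k s)).
Proof.
move=> mk; apply: (@strongly_measurable_opfamily R X (Gam t) M t) => //.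
- by move=> s a x y; exact: (green_lin evU dich).
- by move=> s x; exact: (green_bound0 dich).
- by move=> s x st; exact: (green_continuous_s evU dich).
Qed.

Lemma green_le_kernel t (k : R -> X) s :
  `|Gam t s (k s)| <= M * (expR (- delta * `|t - s|) * `|k s|).
Proof. by rewrite mulrA; exact: (green_bound dich). Qed.

Lemma green_bochner_exists p t (k : R -> X) : 1 <= p -> BS p k ->
  exists v, is_bochner lam setT (fun s => Gam t s (k s)) v.
Proof.
move=> p1 bk.
apply: (bochner_kernel_exists M0 bk.1.1 (green_strongly_measurable t bk.1.1)
  (kernel_int_fin t d0 p1 bk)).
by apply: aeW => s; exact: green_le_kernel.
Qed.

Section GivenSolution.
Variables (p : R) (k u : R -> X).
Hypothesis p1 : 1 <= p.
Hypothesis bk : BS p k.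
Hypothesis hu : forall t, is_bochner lam setT (fun s => Gam t s (k s)) (u t).

Lemma green_solution_le t : (`|u t|%:E <= M%:E * kernel_int delta k t)%E.
Proof.
apply: (bochner_kernel_le M0 bk.1.1 (hu t)).
by apply: aeW => s; exact: green_le_kernel.
Qed.

Lemma green_solution_bounded : bdd_fun u.
Proof.
have [B hB] := stepanov_norm_bounded p1 bk.
exists (M * (B *+ 2 / (1 - expR (- delta)))) => t.
rewrite -lee_fin; apply: le_trans (green_solution_le t) _.
rewrite EFinM lee_wpmul2l ?lee_fin//.
have := kernel_int_le t 0 d0 p1 bk.1 hB.
by rewrite big_ord0 add0r expr0 mulr1.
Qed.

Lemma green_solution_continuous : continuous u.
Proof.
move=> t; apply: continuous_at_seq => tn tn1 tnt.
(* The factor [expR delta] pays for replacing [tn n] by [t] in the kernel, as |t - tn n| is at most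
   1. *)
have Me : 0 <= M * expR delta by rewrite mulr_ge0// expR_ge0.
have bnd : {ae lam, forall s : LebR R, forall n,
    `|Gam (tn n) s (k s)| <= M * expR delta * (expR (- delta * `|t - s|) * `|k s|)}.
  apply: aeW => s n; apply: le_trans (green_le_kernel _ _ _) _.
  rewrite -[leRHS]mulrA ler_wpM2l// mulrA ler_wpM2r// -expRD ler_expR.
  have h1 := ler_distD (tn n) t (s : R); have h2 := tn1 n.
  have : delta * `|t - (s : R)| <= delta * (1 + `|tn n - (s : R)|).
    by rewrite ler_pM2l//; apply: le_trans h1 _; rewrite lerD2r.
  by rewrite mulrDr mulr1 !mulNr => h; rewrite lerBrDr [- _ + _]addrC lerBlDr.
have lim : {ae lam, forall s : LebR R, (fun n => Gam (tn n) s (k s)) @ \oo --> Gam t s (k s)}.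
  apply: filterS (ae_notin_set1 t) => s st.
  have ts : t != s :> R by apply/eqP => /esym.
  have c := green_continuous_t evU dich (x := k s) ts; rewrite /prop_for /continuous_at in c.
  exact: (@cvg_comp _ _ _ tn (fun r => Gam r s (k s)) _ _ _ tnt c).
have [v [hv vlim]] := bochner_kernel_cvg Me bk.1.1 (kernel_int_fin t d0 p1 bk)
  (fun n => hu (tn n)) bnd lim.
by rewrite (bochner_unique leb_complete measurableT (hu t) hv).
Qed.

Lemma green_solution_mild : mild_solution U k u.
Proof.
split; first exact: green_solution_continuous.
(* The difference is an integral over the line whose integrand vanishes outside ]s, t] and equals
   U(t, r) k(r) inside. Only r = s disagrees with the closed interval, and it is null. *)
move=> t s st; exists (u t - U t s (u s)); split; last by rewrite addrC subrK.
have bU : bounded_linear_op (U t s) by case: evU => h _ _ _; exact: h.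
have hb := bochner_sub leb_complete measurableT (hu t)
  (bochner_linear leb_complete measurableT bU (hu s)).
have mI : measurable (`[s, t]%classic : set (LebR R)) := measurable_itv_LebR _.
apply: (bochner_subset leb_complete measurableT mI (@subsetT _ _) _ _ hb).
- apply: filterS (ae_notin_set1 s) => r rs; rewrite /= in_itv/= => /andP[sr rt].
  by apply: (green_evol_in evU dich) => //; rewrite lt_neqAle sr andbT; apply/eqP => /esym.
- move=> r _ /=; rewrite in_itv/= => /negP; rewrite negb_and -!ltNge => /orP[rs|tr].
    by rewrite (green_evol_le _ _ evU)// ?subrr// ltW.
  by rewrite (green_evol_gt evU dich)// subrr.
Qed.

Lemma green_solution_unique w : bdd_fun w -> mild_solution U k w -> w = u.
Proof.
move=> [C1 hC1] [_ mw].
have [C2 hC2] := green_solution_bounded.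
have [_ mu] := green_solution_mild.
pose d t := w t - u t.
have dE t s : s <= t -> d t = U t s (d s).
  move=> st; have [v [hv wv]] := mw t s st; have [v' [hv' uv]] := mu t s st.
  have mI : measurable (`[s, t]%classic : set (LebR R)) := measurable_itv_LebR _.
  rewrite /d wv uv (bochner_unique leb_complete mI hv hv').
  by rewrite (evU_B evU)// opprD addrACA subrr addr0.
pose C := C1 + C2.
have dC t : `|d t| <= C by apply: le_trans (ler_normB _ _) _; exact: lerD.
have [_ _ _ _ [h1 h2]] := dich.
have decay (x : X) : (forall n : nat, `|x| <= M * expR (- delta * n%:R) * C) -> x = 0.
  move=> hx; apply/eqP; rewrite -normr_le0.
  have lim : (fun n : nat => M * expR (- delta * n%:R) * C) @ \oo --> (0 : R).
    have -> : (fun n : nat => M * expR (- delta * n%:R) * C) = geometric (M * C) (expR (- delta)).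
      by apply/funext => n; rewrite /geometric /= mulrAC [_ * n%:R]mulrC expRM_natl.
    apply: cvg_geometric; rewrite ger0_norm ?expR_ge0//.
    by rewrite -expR0 ltr_expR oppr_lt0.
  rewrite -(cvg_lim _ lim)//; apply: limr_ge; first by apply/cvg_ex; exists 0.
  by near=> n.
have Pd0 t : P t (d t) = 0.
  apply: decay => n.
  have st : t - n%:R <= t by rewrite lerBlDr lerDl.
  rewrite {1}(dE _ _ st) -(dich_PU dich)//.
  apply: le_trans (h1 _ _ _ st) _.
  by rewrite subKr ler_wpM2l// mulr_ge0// expR_ge0.
apply/funext => t; apply/eqP; rewrite -subr_eq0 -/(d t); apply/eqP.
apply: decay => n.
have ts : t <= t + n%:R by rewrite lerDl.
(* Now that [d t] lies in the kernel of [P t], it is the backward image of its own future value,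
   which the dichotomy makes exponentially small. *)
have Ud : U (t + n%:R) t (d t) = d (t + n%:R) - P (t + n%:R) (d (t + n%:R)).
  by rewrite Pd0 subr0 -dE.
rewrite -(dich_Ut_unique dich ts (Pd0 t) Ud).
apply: le_trans (h2 _ _ _ ts) _.
by rewrite [t + _]addrC addrK ler_wpM2l// mulr_ge0// expR_ge0.
Unshelve. all: by end_near. Qed.

End GivenSolution.
End Solution.

(** * Almost automorphic forcing *)

Lemma cvg_extraction (phi : nat -> nat) : (forall n, (n <= phi n)%N) ->
  phi @ \oo --> \oo.
Proof.
move=> h A [N _ hN]; exists N => // n /= Nn; apply: hN => /=.
exact: leq_trans (h n).
Qed.

Lemma extraction_ge (phi : nat -> nat) : (forall n, (phi n < phi n.+1)%N) ->
  forall n, (n <= phi n)%N.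
Proof. by move=> h; elim=> // n IH; exact: leq_ltn_trans (h n). Qed.

(** The sum is at most twice the larger term. The constant is crude, but only finiteness and limits
    to 0 depend on it. *)
Lemma powR_addr_le {R : realType} (p a b : R) : 0 < p -> 0 <= a -> 0 <= b ->
  (a + b) `^ p <= 2 `^ p * (a `^ p + b `^ p).
Proof.
move=> p0 a0 b0.
wlog ab : a b a0 b0 / a <= b.
  move=> H; have [ab|/ltW ba] := leP a b; first exact: H.
  by rewrite addrC [a `^ p + _]addrC; exact: H.
apply: (@le_trans _ _ (2 `^ p * b `^ p)).
  rewrite -powRM//; apply: ge0_ler_powR; rewrite ?nnegrE ?addr_ge0 ?mulr_ge0 ?(ltW p0)//.
  by rewrite mulr_natl mulr2n lerD2r.
by rewrite ler_wpM2l ?powR_ge0// lerDr powR_ge0.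
Qed.

Lemma powR_inv_cvg0 {R : realType} {I : Type} (F : set_system I) {FF : Filter F}
    (p : R) (x : I -> R) : 0 < p -> (forall i, 0 <= x i) -> x @ F --> (0 : R) ->
  (fun i => x i `^ p^-1) @ F --> (0 : R).
Proof.
move=> p0 x0 lim; apply/cvgrPdist_lt => e e0.
have ep : 0 < e `^ p by rewrite powR_gt0.
move/cvgrPdist_lt : lim => /(_ _ ep); apply: filterS => i.
rewrite !sub0r !normrN ger0_norm// ger0_norm ?powR_ge0// => h.
have -> : e = (e `^ p) `^ p^-1 by rewrite -powRrM mulfV ?gt_eqF// powRr1// ltW.
by apply: gt0_ltr_powR; rewrite ?nnegrE ?invr_gt0// ltW.
Qed.

Section PowerIntegral.
Context {R : realType} {d : measure_display} {T : measurableType d}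
        (mu : {measure set T -> \bar R}).

Lemma integral_powR_add_le (p : R) (D : set T) (a b c : T -> R) : 0 < p ->
  measurable D -> measurable_fun D a -> measurable_fun D b -> measurable_fun D c ->
  (forall x, 0 <= a x) -> (forall x, 0 <= b x) -> (forall x, 0 <= c x <= a x + b x) ->
  (\int[mu]_(x in D) (c x `^ p)%:E <= (2 `^ p)%:E *
     (\int[mu]_(x in D) (a x `^ p)%:E + \int[mu]_(x in D) (b x `^ p)%:E))%E.
Proof.
move=> p0 mD ma mb mc a0 b0 cab.
have mp f : measurable_fun D f -> measurable_fun D (fun x => (f x `^ p)%:E).
  by move=> mf; apply/measurable_EFinP; apply: (measurableT_comp (measurable_powR p)).
rewrite -ge0_integralD//; [|by move=> x _; rewrite lee_fin powR_ge0|exact: mp|by move=> x _; rewrite lee_fin powR_ge0|exact: mp].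
rewrite -ge0_integralZl_EFin ?powR_ge0//; last 2 first.
- by move=> x _; rewrite -EFinD lee_fin addr_ge0// powR_ge0.
- by apply: emeasurable_funD; exact: mp.
apply: ge0_le_integral => //.
- by move=> x _; rewrite lee_fin powR_ge0.
- exact: mp.
- by apply: emeasurable_funM => //; apply: emeasurable_funD; exact: mp.
move=> x _; rewrite -EFinD -EFinM lee_fin.
have /andP[c0 cle] := cab x.
apply: le_trans (powR_addr_le p0 (a0 x) (b0 x)).
by apply: ge0_ler_powR; rewrite ?nnegrE ?addr_ge0 ?(ltW p0).
Qed.

End PowerIntegral.

Section StepanovShift.
Context {R : realType} {X : completeNormedModType R}.
Local Notation lam := (@leb R).
Variable p : R.
Hypothesis p1 : 1 <= p.
Implicit Types f g h k : R -> X.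

Let p0 : 0 < p. Proof. exact: lt_le_trans p1. Qed.

Definition pow_int k (a b : R) : \bar R :=
  (\int[lam]_(s in `[a, b]%classic) (`|k s| `^ p)%:E)%E.

Lemma pow_int_ge0 k a b : (0 <= pow_int k a b)%E.
Proof. by apply: integral_ge0 => x _; rewrite lee_fin powR_ge0. Qed.

Lemma pow_int_sub_le f g a b : strongly_measurable lam setT f ->
  strongly_measurable lam setT g ->
  (pow_int (fun s => f s - g s)%R a b <= (2 `^ p)%:E * (pow_int f a b + pow_int g a b))%E.
Proof.
move=> mf mg; have mI : measurable (`[a, b]%classic : set (LebR R)) := measurable_itv_LebR _.
apply: (integral_powR_add_le lam p0 mI (measurable_norm_LebR mI mf)
  (measurable_norm_LebR mI mg)
  (measurable_norm_LebR mI (strongly_measurable_sub mf mg))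
  (fun _ => normr_ge0 _) (fun _ => normr_ge0 _)) => x.
by rewrite normr_ge0 ler_normB.
Qed.

Lemma pow_int_le_sub f g a b : strongly_measurable lam setT f ->
  strongly_measurable lam setT g ->
  (pow_int f a b <= (2 `^ p)%:E * (pow_int (fun s => f s - g s)%R a b + pow_int g a b))%E.
Proof.
move=> mf mg; have mI : measurable (`[a, b]%classic : set (LebR R)) := measurable_itv_LebR _.
apply: (integral_powR_add_le lam p0 mI
  (measurable_norm_LebR mI (strongly_measurable_sub mf mg))
  (measurable_norm_LebR mI mg) (measurable_norm_LebR mI mf)
  (fun _ => normr_ge0 _) (fun _ => normr_ge0 _)) => x.
by rewrite normr_ge0 /= -{1}(subrK (g x) (f x)) ler_normD.
Qed.

Lemma pow_int_dist f g a b :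
  pow_int (fun s => f s - g s) a b = pow_int (fun s => g s - f s) a b.
Proof. by apply: eq_integral => s _; rewrite distrC. Qed.

Lemma pow_int_shift f t a b : strongly_measurable lam setT f ->
  pow_int (fun s => f (s + t)) a b = pow_int f (a + t) (b + t).
Proof.
move=> mf; rewrite /pow_int.
have mp : measurable_fun setT (fun s : LebR R => (`|f s| `^ p)%:E).
  apply/measurable_EFinP; apply: (measurableT_comp (measurable_powR p)).
  exact: measurable_norm_LebR.
have f0 (x : R) : (0 <= (`|f x| `^ p)%:E)%E by rewrite lee_fin powR_ge0.
exact: (ge0_integral_shift_itv t a b mp f0).
Qed.

Lemma Lploc_shift f t : Lploc p f -> Lploc p (fun s => f (s + t)).
Proof.
move=> [mf fin]; split; first exact: strongly_measurable_shift.
by move=> a b; rewrite -/(pow_int _ a b) pow_int_shift//; exact: fin.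
Qed.

Lemma Lploc_sub f g : Lploc p f -> Lploc p g -> Lploc p (fun s => f s - g s).
Proof.
move=> [mf ff] [mg fg]; split; first exact: strongly_measurable_sub.
move=> a b; apply: le_lt_trans (pow_int_sub_le a b mf mg) _.
by apply: lte_mul_pinfty; rewrite ?lee_fin ?powR_ge0//; apply: lte_add_pinfty; [exact: ff|exact: fg].
Qed.

Lemma stepanov_norm_le k a C : Lploc p k -> (pow_int k a (a + 1) <= C%:E)%E ->
  0 <= stepanov_norm p k a <= C `^ p^-1.
Proof.
move=> [mk fin] hC; rewrite powR_ge0 /=.
have C0 : 0 <= C by rewrite -lee_fin; exact: le_trans (pow_int_ge0 _ _ _) hC.
apply: ge0_ler_powR; rewrite ?nnegrE ?invr_ge0 ?fine_ge0 ?(ltW p0)//.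
- exact: pow_int_ge0.
- rewrite -lee_fin fineK; first exact: hC.
  by rewrite ge0_fin_numE; [exact: fin|exact: pow_int_ge0].
Qed.

(** Convergence is assumed on each unit window separately; the bound [C], uniform in the window,
    lets the geometric weights control the distant ones. *)
Lemma kernel_int_cvg0 {I : Type} (F : set_system I) {FF : Filter F} (delta t C : R) (kn : I -> R -> X) :
  0 < delta -> (forall n, Lploc p (kn n)) ->
  (forall n a, (pow_int (kn n) a (a + 1) <= C%:E)%E) ->
  (forall a, (fun n => pow_int (kn n) a (a + 1)) @ F --> 0%E) ->
  (fun n => kernel_int delta (kn n) t) @ F --> 0%E.
Proof.
move=> d0 hk hC lim.
have q0 : 0 < expR (- delta) by exact: expR_gt0.
have q1 : expR (- delta) < 1 by rewrite -expR0 ltr_expR oppr_lt0.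
pose B := C `^ p^-1.
apply: (@geometric_cvg0 _ (expR (- delta)) _ _ FF _
  (fun n j => stepanov_norm p (kn n) (t + j%:R) + stepanov_norm p (kn n) (t - j%:R - 1))
  (B *+ 2 / (1 - expR (- delta))) q0 q1).
- move=> N; apply: filterE => n; split.
    by apply: integral_ge0 => x _; rewrite lee_fin mulr_ge0// expR_ge0.
  by apply: (kernel_int_le t N d0 p1 (hk n)) => a; exact: stepanov_norm_le.
- have lim' a : (fun n => stepanov_norm p (kn n) a) @ F --> (0 : R).
    apply: powR_inv_cvg0 => //; first by move=> n; rewrite fine_ge0//; exact: pow_int_ge0.
    by have /fine_cvgP[] := lim a.
  by move=> j; have := cvgD (lim' (t + j%:R)) (lim' (t - j%:R - 1)); rewrite addr0; exact.
Qed.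

(** If the window integrals starting at [s n] exceeded n, a subsequence of the translates would
    still approach a fixed [h] on [0, 1], which keeps them bounded. *)
Lemma AAS_BS f : AAS p f -> BS p f.
Proof.
move=> [lf haa]; split=> //; apply: contrapT => nb.
have /choice[s hs] : forall n : nat, exists t : R, ~ (pow_int f t (t + 1) <= n%:R%:E)%E.
  move=> n; apply: contrapT => h; apply: nb; exists n%:R => t.
  by apply: contrapT => ht; apply: h; exists t.
have [phi [h [incr lh lim]]] := haa s.
have [lim0 _] := lim 0.
have [N _ hN] := cvge0_lt ltr01 lim0.
have H0 := pow_int_ge0 h 0 (0 + 1).
have Hfin : pow_int h 0 (0 + 1) = (fine (pow_int h 0 (0 + 1)))%:E.
  by rewrite fineK// ge0_fin_numE//; exact: lh.2.
pose C := 2 `^ p * (1 + fine (pow_int h 0 (0 + 1))).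
have C0 : 0 <= C by rewrite mulr_ge0 ?powR_ge0// addr_ge0// fine_ge0.
(* Beyond [N] the translate is close to [h], so its integral is at most [C]; and [phi n] is at least
   n, hence at least [C], against the choice of [s]. *)
pose n := maxn N (Num.bound C).
apply: (hs (phi n)).
have <- : pow_int (fun x => f (x + s (phi n))) 0 (0 + 1) = pow_int f (s (phi n)) (s (phi n) + 1).
  by rewrite (pow_int_shift _ _ _ lf.1) !add0r [1 + _]addrC.
have mfs := strongly_measurable_shift (s (phi n)) lf.1.
apply: le_trans (pow_int_le_sub _ _ mfs lh.1) _.
apply: (@le_trans _ _ C%:E).
  rewrite EFinM EFinD lee_wpmul2l ?lee_fin ?powR_ge0//.
  rewrite Hfin leeD2r//; apply: ltW; apply: hN; exact: leq_maxl.
rewrite lee_fin; apply: le_trans (ltW (archi_boundP C0)) _.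
rewrite ler_nat; apply: leq_trans (extraction_ge incr n); exact: leq_maxr.
Qed.

(** On each window [h] is close to some translate of [f]. The index of that translate depends on the
    window, the bound does not. *)
Lemma AAS_limit_bound f h (s : nat -> R) C : Lploc p f -> Lploc p h ->
  (forall a, (pow_int f a (a + 1) <= C%:E)%E) ->
  (forall a, (fun n => pow_int (fun x => f (x + s n) - h x) a (a + 1)) @ \oo --> 0%E) ->
  forall a, (pow_int h a (a + 1) <= (2 `^ p * (1 + C))%:E)%E.
Proof.
move=> lf lh hC lim a.
have [N _ hN] := cvge0_lt ltr01 (lim a).
have mfs := strongly_measurable_shift (s N) lf.1.
apply: le_trans (pow_int_le_sub _ _ lh.1 mfs) _.
rewrite EFinM EFinD lee_wpmul2l ?lee_fin ?powR_ge0//.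
apply: leeD.
  by rewrite pow_int_dist; apply: ltW; apply: hN => /=.
by rewrite (pow_int_shift _ _ _ lf.1) [a + 1 + _]addrAC; exact: hC.
Qed.

End StepanovShift.

(** * Diagonal extraction and the limit kernel *)

Section Diagonal.
Variables (T : Type) (Q : nat -> (nat -> T) -> Prop).
Hypothesis Q_extract : forall k (s : nat -> T), exists phi : nat -> nat,
  (forall n, (phi n < phi n.+1)%N) /\ Q k (s \o phi).
(* Q k is insensitive to finitely many terms and passes to reindexings tending to infinity. *)
Hypothesis Q_reindex : forall k (s s' : nat -> T) (m : nat -> nat) (N : nat),
  Q k s -> (forall n, (n <= m n)%N) -> (forall n, (N <= n)%N -> s' n = s (m n)) -> Q k s'.

Lemma diagonal_extraction (s : nat -> T) : exists phi : nat -> nat,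
  (forall n, (phi n < phi n.+1)%N) /\ forall k, Q k (s \o phi).
Proof.
have /choice[F hF] : forall kpsi : nat * (nat -> nat), exists phi : nat -> nat,
    (forall n, (phi n < phi n.+1)%N) /\ Q kpsi.1 (s \o kpsi.2 \o phi).
  by move=> [k psi] /=; exact: Q_extract.
(* [psi k] composes the first k extractions; property [Q k] is gained in passing from [psi k] to
   [psi k.+1]. *)
pose psi := fix psi k := if k is k'.+1 then psi k' \o F (k', psi k') else id.
have psi_incr k : forall n, (psi k n < psi k n.+1)%N.
  elim: k => [//|k IH] n /=.
  have H : forall a b, (a < b)%N -> (psi k a < psi k b)%N.
    move=> a; elim=> // b IHb; rewrite ltnS leq_eqVlt => /predU1P[->|/IHb h]; first exact: IH.
    exact: ltn_trans (IH b).
  by apply: H; exact: (hF (k, psi k)).1.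
have psi_mono k a b : (a < b)%N -> (psi k a < psi k b)%N.
  elim: b => // b IHb; rewrite ltnS leq_eqVlt => /predU1P[->|/IHb h]; first exact: psi_incr.
  exact: ltn_trans (psi_incr k b).
have psiE k n : (k <= n)%N -> exists th : nat -> nat,
    (forall m, (m <= th m)%N) /\ forall m, psi n m = psi k (th m).
  elim: n => [|n IH]; first by rewrite leqn0 => /eqP ->; exists id.
  rewrite leq_eqVlt => /predU1P[->|]; first by exists id.
  rewrite ltnS => /IH[th [th1 th2]].
  exists (th \o F (n, psi n)); split => m /=; last by rewrite th2.
  apply: leq_trans (th1 _); exact: extraction_ge (hF (n, psi n)).1 m.
exists (fun n => psi n n); split.
  move=> n /=; apply: psi_mono.
  exact: extraction_ge (hF (n, psi n)).1 n.+1.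
move=> k.
(* From index k+1 on, the diagonal runs through values of [psi k.+1], the first stage where [Q k]
   holds. Earlier indices receive the dummy value m = n. *)
have /choice[m hm] : forall n, exists m, (n <= m)%N /\ ((k.+1 <= n)%N -> psi n n = psi k.+1 m).
  move=> n; have [kn|nk] := leqP k.+1 n; last by exists n; split.
  have [th [th1 th2]] := psiE _ _ kn.
  by exists (th n); split => // _; rewrite th2.
apply: (Q_reindex (s := s \o psi k.+1) (m := m) (N := k.+1)).
- exact: (hF (k, psi k)).2.
- by move=> n; have [] := hm n.
- by move=> n kn /=; have [_ ->] := hm n.
Qed.

End Diagonal.

Lemma norm_cvg_le {R : realType} {V : normedModType R} (u : nat -> V) (l : V) (C : R) :
  u @ \oo --> l -> (forall n, `|u n| <= C) -> `|l| <= C.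
Proof.
move=> ul uC; have h : (fun n => `|u n|) @ \oo --> `|l| by exact: cvg_norm.
rewrite -(cvg_lim _ h)//; apply: limr_le; first by apply/cvg_ex; eexists; exact: h.
by near=> n.
Unshelve. all: by end_near. Qed.

Section LimitGreen.
Context {R : realType} {X : completeNormedModType R}.
Local Notation lam := (@leb R).
Variables (U : R -> R -> X -> X) (P : R -> X -> X) (Ut : R -> R -> X -> X)
  (M delta : R).
Hypothesis evU : evolution_family U.
Hypothesis dich : exp_dichotomy U P Ut M delta.
Local Notation Gam := (green U P Ut).
Let M0 : 0 < M := dich_M_gt0 dich.
Let d0 : 0 < delta := dich_delta_gt0 dich.

Lemma greenB t s x y : Gam t s (x - y) = Gam t s x - Gam t s y.
Proof. by rewrite addrC -scaleN1r (green_lin evU dich) scaleN1r addrC. Qed.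

Section FixedSequence.
Variable sg : nat -> R.

(** [lim] is total, so this is meaningful only at vectors where the sequence converges. Linearity
    and bounds are therefore stated on [bi_aa_vector]. *)
Definition green_lim (t s : R) (x : X) : X :=
  lim ((fun n => Gam (t + sg n) (s + sg n) x) @ \oo).

(** Bi-almost automorphy of Gamma(., .)x along the given sequence itself, without extraction. Fixing
    the sequence is what makes these vectors a linear subspace. *)
Definition bi_aa_vector (x : X) : Prop := forall t s,
  (fun n => Gam (t + sg n) (s + sg n) x) @ \oo --> green_lim t s x /\
  (fun n => green_lim (t - sg n) (s - sg n) x) @ \oo --> Gam t s x.

Lemma bi_aa_vector_of_limit (G : R -> R -> X) x :
  (forall t s, (fun n => Gam (t + sg n) (s + sg n) x) @ \oo --> G t s /\
     (fun n => G (t - sg n) (s - sg n)) @ \oo --> Gam t s x) -> bi_aa_vector x.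
Proof.
move=> hG.
have GE t s : green_lim t s x = G t s by apply: cvg_lim => //; exact: (hG t s).1.
move=> t s; rewrite GE; split; first exact: (hG t s).1.
by under eq_fun do rewrite GE; exact: (hG t s).2.
Qed.

Lemma green_lim_lin a x y t s : bi_aa_vector x -> bi_aa_vector y ->
  green_lim t s (a *: x + y) = a *: green_lim t s x + green_lim t s y /\
  (fun n => Gam (t + sg n) (s + sg n) (a *: x + y)) @ \oo --> a *: green_lim t s x + green_lim t s y.
Proof.
move=> hx hy.
have h : (fun n => Gam (t + sg n) (s + sg n) (a *: x + y)) @ \oo -->
    a *: green_lim t s x + green_lim t s y.
  under eq_fun do rewrite (green_lin evU dich).
  by apply: cvgD; [apply: cvgZr; exact: (hx t s).1|exact: (hy t s).1].
by split => //; apply: cvg_lim.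
Qed.

Lemma bi_aa_vector_lin a x y : bi_aa_vector x -> bi_aa_vector y ->
  bi_aa_vector (a *: x + y).
Proof.
move=> hx hy t s; have [-> h1] := green_lim_lin a t s hx hy; split => //.
rewrite (green_lin evU dich).
under eq_fun do rewrite (green_lim_lin a _ _ hx hy).1.
by apply: cvgD; [apply: cvgZr; exact: (hx t s).2|exact: (hy t s).2].
Qed.

Lemma bi_aa_vector0 : bi_aa_vector 0.
Proof.
apply: (@bi_aa_vector_of_limit (fun _ _ => 0)) => t s.
have G0 t' s' : Gam t' s' 0 = 0 by rewrite -[X in Gam _ _ X](subrr (0 : X)) greenB subrr.
rewrite G0; split; last exact: cvg_cst.
by under eq_fun do rewrite G0; exact: cvg_cst.
Qed.

Lemma green_limB x y t s : bi_aa_vector x -> bi_aa_vector y ->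
  green_lim t s (x - y) = green_lim t s x - green_lim t s y.
Proof.
move=> hx hy; rewrite addrC -scaleN1r; have [-> _] := green_lim_lin (-1) t s hy hx.
by rewrite scaleN1r addrC.
Qed.

Lemma bi_aa_vectorB x y : bi_aa_vector x -> bi_aa_vector y -> bi_aa_vector (x - y).
Proof. by move=> hx hy; rewrite addrC -scaleN1r; exact: bi_aa_vector_lin. Qed.

(** Translating both times leaves t - s unchanged, so the exponential bound of Gamma passes to the
    limit. *)
Lemma green_lim_bound x t s : bi_aa_vector x ->
  `|green_lim t s x| <= M * expR (- delta * `|t - s|) * `|x|.
Proof.
move=> hx; apply: (norm_cvg_le (hx t s).1) => n.
apply: le_trans (green_bound dich _ _ _) _.
by rewrite opprD addrACA subrr addr0.
Qed.

(** The bound M on Gamma is uniform in time: it makes the forward sequence at [x] Cauchy, and it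
    yields the return limit by a three-term estimate. *)
Lemma bi_aa_vector_closed (xn : nat -> X) x : (forall n, bi_aa_vector (xn n)) ->
  xn @ \oo --> x -> bi_aa_vector x.
Proof.
move=> hxn xnx.
have small e : 0 < e -> exists m, M * `|x - xn m| < e.
  move=> e0; have eM : 0 < e / M by rewrite divr_gt0.
  move/cvgrPdist_lt : xnx => /(_ _ eM)[m _ hm]; exists m.
  by rewrite mulrC -ltr_pdivlMr//; exact: (hm m (leqnn m)).
have conv t s : (fun n => Gam (t + sg n) (s + sg n) x) @ \oo --> green_lim t s x.
  suff : cvgn (fun n => Gam (t + sg n) (s + sg n) x) by [].
  apply: cauchy_cvg; apply: cauchy_exP => e e0.
  have e2 : 0 < e / 2 by rewrite divr_gt0.
  have [m hm] := small _ e2; exists (green_lim t s (xn m)).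
  have /cvgrPdist_lt/(_ _ e2) := (hxn m t s).1.
  apply: filterS => n hn; rewrite -ball_normE /=.
  rewrite -(subrKA (Gam (t + sg n) (s + sg n) (xn m))) (splitr e).
  apply: le_lt_trans (ler_normD _ _) _; apply: ltrD => //.
  rewrite -greenB; apply: le_lt_trans (green_bound0 dich _ _ _) _.
  by rewrite distrC.
(* [green_limB] does not apply, since [x] is not yet known to lie in the subspace; the bound is
   taken on Gamma before passing to the limit. *)
have limB t s m : `|green_lim t s (xn m) - green_lim t s x| <= M * `|x - xn m|.
  have h : (fun n => Gam (t + sg n) (s + sg n) (xn m) - Gam (t + sg n) (s + sg n) x) @ \oo
      --> green_lim t s (xn m) - green_lim t s x.
    by apply: cvgB; [exact: (hxn m t s).1|exact: conv].
  apply: (norm_cvg_le h) => n; rewrite -greenB; apply: le_trans (green_bound0 dich _ _ _) _.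
  by rewrite distrC.
move=> t s; split; first exact: conv.
apply/cvgrPdist_lt => e e0.
have e3 : 0 < e / 3 by rewrite divr_gt0.
have [m hm] := small _ e3.
have /cvgrPdist_lt/(_ _ e3) := (hxn m t s).2.
apply: filterS => n hn.
rewrite -(subrKA (Gam t s (xn m))).
apply: le_lt_trans (ler_normD _ _) _.
rewrite -[X in _ + `|X|](subrKA (green_lim (t - sg n) (s - sg n) (xn m))).
have h1 : `|Gam t s x - Gam t s (xn m)| < e / 3.
  by rewrite -greenB; exact: le_lt_trans (green_bound0 dich _ _ _) hm.
have h2 := le_lt_trans (limB (t - sg n) (s - sg n) m) hm.
have := ler_normD (Gam t s (xn m) - green_lim (t - sg n) (s - sg n) (xn m))
  (green_lim (t - sg n) (s - sg n) (xn m) - green_lim (t - sg n) (s - sg n) x).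
by move=> h; lra.
Unshelve. all: by end_near. Qed.

Lemma bi_aa_vector_sfun (l : seq (set (LebR R) * X)) x :
  (forall q, q \in l -> bi_aa_vector q.2) -> bi_aa_vector (sfun_eval l x).
Proof.
elim: l => [|q l IH] h; first by rewrite /sfun_eval big_nil; exact: bi_aa_vector0.
rewrite sfun_eval_cons; apply: bi_aa_vector_lin; first by apply: h; rewrite mem_head.
by apply: IH => r rl; apply: h; rewrite in_cons rl orbT.
Qed.

Lemma bi_aa_vector_ae (k : R -> X) (l : nat -> seq (set (LebR R) * X)) :
  {ae lam, forall s : LebR R, setT s -> (fun n => sfun_eval (l n) s) @ \oo --> k s} ->
  (forall n q, q \in l n -> bi_aa_vector q.2) ->
  {ae lam, forall s : LebR R, bi_aa_vector (k s)}.
Proof.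
move=> hk hl; apply: filterS hk => s hs.
apply: (bi_aa_vector_closed _ (hs I)) => n.
by apply: bi_aa_vector_sfun => q; exact: hl.
Qed.

End FixedSequence.

Hypothesis H3 : forall x : X, bi_almost_automorphic (fun t s => Gam t s x).

Lemma bi_aa_vectors_extraction (e : nat -> X) (s : nat -> R) : exists phi : nat -> nat,
  (forall n, (phi n < phi n.+1)%N) /\ forall k, bi_aa_vector (s \o phi) (e k).
Proof.
apply: (diagonal_extraction (Q := fun k (sg : nat -> R) => bi_aa_vector sg (e k))).
- move=> k sg; have [phi [G [incr hG]]] := H3 (e k) sg.
  by exists phi; split => //; exact: (bi_aa_vector_of_limit (G := G)).
- move=> k sg sg' m N hk mge sgE.
  have near_eq (V : Type) (F : R -> V) : \forall n \near \oo, F (sg (m n)) = F (sg' n).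
    by exists N => // n /= Nn; rewrite sgE.
  apply: (bi_aa_vector_of_limit (G := fun t s0 => green_lim sg t s0 (e k))) => t s0.
  have [h1 h2] := hk t s0; split.
    apply: cvg_trans (cvg_comp _ _ (cvg_extraction mge) h1).
    by apply: near_eq_cvg; exact: (near_eq _ (fun r => Gam (t + r) (s0 + r) (e k))).
  apply: cvg_trans (cvg_comp _ _ (cvg_extraction mge) h2).
  by apply: near_eq_cvg; exact: (near_eq _ (fun r => green_lim sg (t - r) (s0 - r) (e k))).
Qed.

End LimitGreen.

(** * Almost automorphy of the solution *)

Section AlmostAutomorphic.
Context {R : realType} {X : completeNormedModType R}.
Local Notation lam := (@leb R).
Variables (U : R -> R -> X -> X) (P : R -> X -> X) (Ut : R -> R -> X -> X)
  (M delta : R).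
Hypothesis evU : evolution_family U.
Hypothesis dich : exp_dichotomy U P Ut M delta.
Local Notation Gam := (green U P Ut).
Let M0 : 0 <= M := ltW (dich_M_gt0 dich).
Let d0 : 0 < delta := dich_delta_gt0 dich.
Variable p : R.
Hypothesis p1 : 1 <= p.

Lemma green_shift_strongly_measurable t r (k : R -> X) :
  strongly_measurable lam setT k ->
  strongly_measurable lam setT (fun s => Gam (t + r) (s + r) (k s)).
Proof.
move=> mk; apply: (@strongly_measurable_opfamily R X (fun s => Gam (t + r) (s + r)) M t) => //.
- by move=> s a x y; exact: (green_lin evU dich).
- by move=> s x; exact: (green_bound0 dich).
- move=> s x st.
  have str : s + r != t + r by rewrite (inj_eq (addIr r)).
  have c := green_continuous_s evU dich (x := x) str; rewrite /prop_for /continuous_at in c.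
  have a : (fun s : R => s + r) @ s --> s + r by apply: cvgD; [exact: cvg_id|exact: cvg_cst].
  exact: (@cvg_comp _ _ _ (fun s : R => s + r) (fun s => Gam (t + r) s x) _ _ _ a c).
Qed.

Lemma green_shift_le_kernel t r (k : R -> X) (s : R) :
  `|Gam (t + r) (s + r) (k s)| <= M * (expR (- delta * `|t - s|) * `|k s|).
Proof.
by rewrite mulrA; apply: le_trans (green_bound dich _ _ _) _; rewrite opprD addrACA subrr addr0.
Qed.

Lemma green_lim_bochner (sg : nat -> R) t (k : R -> X) : BS p k ->
  {ae lam, forall s : LebR R, bi_aa_vector U P Ut sg (k s)} ->
  exists vn v, [/\ forall n, is_bochner lam setT (fun s => Gam (t + sg n) (s + sg n) (k s)) (vn n),
    is_bochner lam setT (fun s => green_lim U P Ut sg t s (k s)) v & vn @ \oo --> v].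
Proof.
move=> bk ak.
have bnd r : {ae lam, forall s : LebR R, `|Gam (t + r) (s + r) (k s)| <=
    M * (expR (- delta * `|t - s|) * `|k s|)}.
  by apply: aeW => s; exact: green_shift_le_kernel.
have fin := kernel_int_fin t d0 p1 bk.
have /choice[vn hvn] : forall n, exists v,
    is_bochner lam setT (fun s => Gam (t + sg n) (s + sg n) (k s)) v.
  move=> n; apply: (bochner_kernel_exists M0 bk.1.1 _ fin (bnd _)).
  exact: green_shift_strongly_measurable bk.1.1.
have bnd' : {ae lam, forall s : LebR R, forall n, `|Gam (t + sg n) (s + sg n) (k s)| <=
    M * (expR (- delta * `|t - s|) * `|k s|)}.
  by apply: aeW => s n; exact: green_shift_le_kernel.
have lim : {ae lam, forall s : LebR R, (fun n => Gam (t + sg n) (s + sg n) (k s)) @ \oo -->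
    green_lim U P Ut sg t s (k s)}.
  by apply: filterS ak => s hs; exact: (hs t s).1.
have [v [hv vlim]] := bochner_kernel_cvg M0 bk.1.1 fin hvn bnd' lim.
by exists vn, v.
Qed.

Lemma cvg_of_dist_le (x y : nat -> X) (l : X) (K : nat -> \bar R) :
  (forall n, (`|x n - y n|%:E <= M%:E * K n)%E) -> K @ \oo --> 0%E ->
  y @ \oo --> l -> x @ \oo --> l.
Proof.
move=> xyK K0 yl; apply/cvgrPdist_lt => e e0.
have e2 : 0 < e / 2 by rewrite divr_gt0.
have MK : (fun n => M%:E * K n)%E @ \oo --> 0%E.
  by rewrite -[X in _ --> X](mule0 M%:E); apply: cvgeZl.
near=> n; rewrite -(subrKA (y n)) (splitr e).
apply: le_lt_trans (ler_normD _ _) _; apply: ltrD.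
  by near: n; move/cvgrPdist_lt : yl; exact.
rewrite distrC -lte_fin; apply: le_lt_trans (xyK n) _.
by near: n; exact: cvge0_lt.
Unshelve. all: by end_near. Qed.

Hypothesis H3 : forall x : X, bi_almost_automorphic (fun t s => Gam t s x).

Lemma common_extraction (f h : R -> X) (s : nat -> R) :
  strongly_measurable lam setT f -> strongly_measurable lam setT h ->
  exists phi : nat -> nat, [/\ forall n, (phi n < phi n.+1)%N,
    {ae lam, forall r : LebR R, bi_aa_vector U P Ut (s \o phi) (f r)} &
    {ae lam, forall r : LebR R, bi_aa_vector U P Ut (s \o phi) (h r)}].
Proof.
move=> [lf [_ hf]] [lh [_ hh]].
(* Enumerates every vector in the simple approximants of [f] and [h]: [n] is the approximant, [j]
   the position in its list, [b] chooses the function. Other codes give 0. *)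
pose e (i : nat) : X := if @unpickle (nat * nat * bool)%type i is Some (n, j, b)
  then (nth (set0, 0) (if b then lf n else lh n) j).2 else 0.
have [phi [incr hphi]] := bi_aa_vectors_extraction H3 e s.
exists phi; split => //.
- apply: (bi_aa_vector_ae evU dich hf) => n q qn.
  have := hphi (pickle (n, index q (lf n), true)).
  by rewrite /e pickleK nth_index.
- apply: (bi_aa_vector_ae evU dich hh) => n q qn.
  have := hphi (pickle (n, index q (lh n), false)).
  by rewrite /e pickleK nth_index.
Qed.

Theorem green_solution_almost_automorphic (f u : R -> X) : AAS p f ->
  (forall t, is_bochner lam setT (fun s => Gam t s (f s)) (u t)) ->
  almost_automorphic u.
Proof.
move=> aaf hu; have bf := AAS_BS p1 aaf.
split; first exact: (green_solution_continuous evU dich p1 bf hu).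
move=> s'; have [lf haa] := aaf.
have [phi1 [h [incr1 lh lim1]]] := haa s'.
(* [h] is known only after the first extraction, so the vectors of [f] and [h] are handled along
   that subsequence; Stepanov limits persist under the second. *)
have [phi2 [incr2 aef aeh]] := common_extraction (s' \o phi1) lf.1 lh.1.
pose sg := s' \o phi1 \o phi2.
have [C hC] := bf.2.
have limfh a : (fun n => pow_int p (fun x => f (x + sg n) - h x) a (a + 1)) @ \oo --> 0%E.
  exact: (cvg_comp _ _ (cvg_extraction (extraction_ge incr2)) (lim1 a).1).
have limhf a : (fun n => pow_int p (fun x => h (x - sg n) - f x) a (a + 1)) @ \oo --> 0%E.
  exact: (cvg_comp _ _ (cvg_extraction (extraction_ge incr2)) (lim1 a).2).
have hCh := AAS_limit_bound p1 lf lh hC limfh.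
set Ch := 2 `^ p * (1 + C) in hCh.
have bh : BS p h by split => //; exists Ch.
have lfs n : Lploc p (fun x => f (x + sg n)) by exact: Lploc_shift.
have lhs n : Lploc p (fun x => h (x - sg n)) by exact: Lploc_shift.
have bfs n a : (pow_int p (fun x => f (x + sg n)%R) a (a + 1) <= C%:E)%E.
  by rewrite (pow_int_shift p _ _ _ lf.1) [a + 1 + _]addrAC; exact: hC.
have bhs n a : (pow_int p (fun x => h (x - sg n)%R) a (a + 1) <= Ch%:E)%E.
  by rewrite (pow_int_shift p _ _ _ lh.1) [a + 1 + _]addrAC; exact: hCh.
have Kfh t : (fun n => kernel_int delta (fun x => f (x + sg n) - h x) t) @ \oo --> 0%E.
  apply: (@kernel_int_cvg0 _ _ p p1 _ _ _ delta t (2 `^ p * (C + Ch)) _ d0 _ _ limfh).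
    by move=> n; exact: Lploc_sub.
  move=> n a; apply: le_trans (pow_int_sub_le p1 _ _ (lfs n).1 lh.1) _.
  by rewrite EFinM EFinD lee_wpmul2l ?lee_fin ?powR_ge0//; exact: leeD (bfs n a) (hCh a).
have Khf t : (fun n => kernel_int delta (fun x => h (x - sg n) - f x) t) @ \oo --> 0%E.
  apply: (@kernel_int_cvg0 _ _ p p1 _ _ _ delta t (2 `^ p * (Ch + C)) _ d0 _ _ limhf).
    by move=> n; exact: Lploc_sub.
  move=> n a; apply: le_trans (pow_int_sub_le p1 _ _ (lhs n).1 lf.1) _.
  by rewrite EFinM EFinD lee_wpmul2l ?lee_fin ?powR_ge0//; exact: leeD (bhs n a) (hC a).
(* The candidate limit of the translates of [u]: the limit kernel integrated against [h]. *)
have /choice[v hv] : forall t, exists v,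
    is_bochner lam setT (fun s => green_lim U P Ut sg t s (h s)) v.
  by move=> t; have [_ [v [_ hv _]]] := green_lim_bochner t bh aeh; exists v.
exists (phi1 \o phi2), v; split.
  have mono : {homo phi1 : a b / (a < b)%N}.
    by apply: homo_ltn => // a b c; exact: ltn_trans.
  by move=> n /=; apply: mono.
move=> t; split.
(* After a change of variables, u(t + s_n) integrates the translated kernel against f(. + s_n).
   Replacing this by [h] gives [vn], which tends to [v t]; the error is a kernel integral of f(. +
   s_n) - h. *)
- have [vn [v' [hvn hv' vlim]]] := green_lim_bochner t bh aeh.
  rewrite -(bochner_unique leb_complete measurableT hv' (hv t)) in vlim *.
  apply: (cvg_of_dist_le _ (Kfh t) vlim) => n.
  have hs := bochner_shift (sg n) (hu (t + sg n)).
  have hd := bochner_sub leb_complete measurableT hs (hvn n).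
  apply: (bochner_kernel_le M0 (Lploc_sub p1 (lfs n) lh).1 hd).
  apply: aeW => r; rewrite -(greenB evU dich).
  exact: (green_shift_le_kernel t (sg n) (fun x => f (x + sg n) - h x) r).
- have aefs n : {ae lam, forall r : LebR R, bi_aa_vector U P Ut sg (f (r + sg n))}.
    exact: (ae_shift (sg n) aef).
  have bfs' n : BS p (fun x => f (x + sg n)).
    by split; [exact: lfs|exists C; exact: bfs].
  (* The intermediate quantity of the way back: v(t - s_n) with the translate of [h] replaced by
     [f]. Its integrals exist by translating those for f(. + s_n), and they tend to [u t]. *)
  have /choice[w hw] : forall n, exists w, is_bochner lam setT
      (fun s => green_lim U P Ut sg (t - sg n) (s - sg n) (f s)) w.
    move=> n; have [_ [w [_ hw _]]] := green_lim_bochner (t - sg n) (bfs' n) (aefs n).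
    exists w; have := bochner_shift (- sg n) hw.
    by under [X in is_bochner _ _ X _ -> _]eq_fun do rewrite subrK.
  have bndw : {ae lam, forall r : LebR R, forall n,
      `|green_lim U P Ut sg (t - sg n) (r - sg n) (f r)| <= M * (expR (- delta * `|t - r|) * `|f r|)}.
    apply: filterS aef => r hr n; rewrite mulrA.
    apply: le_trans (green_lim_bound dich _ _ hr) _.
    by rewrite opprD addrACA opprK addNr addr0.
  have limw : {ae lam, forall r : LebR R,
      (fun n => green_lim U P Ut sg (t - sg n) (r - sg n) (f r)) @ \oo --> Gam t r (f r)}.
    by apply: filterS aef => r hr; exact: (hr t r).2.
  have [u' [hu' wlim]] := bochner_kernel_cvg M0 lf.1 (kernel_int_fin t d0 p1 bf) hw bndw limw.
  rewrite -(bochner_unique leb_complete measurableT hu' (hu t)) in wlim *.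
  apply: (cvg_of_dist_le _ (Khf t) wlim) => n.
  have hs := bochner_shift (- sg n) (hv (t - sg n)).
  have hd := bochner_sub leb_complete measurableT hs (hw n).
  apply: (bochner_kernel_le M0 (Lploc_sub p1 (lhs n) lf).1 hd).
  (* Subtracting inside [green_lim] requires both [f r] and h(r - s_n) in the subspace; the latter
     holds a.e. because translates of null sets are null. *)
  have aehs := ae_shift (- sg n) aeh.
  apply: filterS2 aef aehs => r hf hh.
  rewrite -(green_limB evU dich) // mulrA.
  apply: le_trans (green_lim_bound dich _ _ _) _.
    exact: (bi_aa_vectorB evU dich).
  by rewrite opprD addrACA opprK addNr addr0.
Qed.

End AlmostAutomorphic.

(** * Ergodic forcing *)

Section AbstractIntegrals.
Context {R : realType} {d : measure_display} {T : measurableType d}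
        (mu : {measure set T -> \bar R}).
Implicit Types D : set T.

Lemma integral_set_cvg D (A : set T) (An : nat -> set T) (w : T -> R) :
  measurable D -> measurable A -> (forall n, measurable (An n)) ->
  A `<=` D -> (forall n, An n `<=` D) ->
  measurable_fun D w -> (forall x, 0 <= w x) ->
  (\int[mu]_(x in D) (w x)%:E < +oo)%E ->
  {ae mu, forall x, \forall n \near \oo, (x \in An n) = (x \in A)} ->
  (fun n => \int[mu]_(x in An n) (w x)%:E)%E @ \oo --> (\int[mu]_(x in A) (w x)%:E)%E.
Proof.
move=> mD mA mAn AD AnD mw w0 fin lim.
have mkE B : B `<=` D ->
    (\int[mu]_(x in B) (w x)%:E = \int[mu]_(x in D) ((fun x => (w x)%:E) \_ B) x)%E.
  by move=> BD; rewrite -[in LHS](setIidr BD) integral_mkcondr.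
rewrite mkE//; under eq_cvg => n do rewrite mkE//.
have mwE : measurable_fun D (fun x => (w x)%:E) by apply/measurable_EFinP.
have mp B : measurable B -> B `<=` D -> measurable_fun D ((fun x => (w x)%:E) \_ B).
  move=> mB BD; apply/(measurable_restrict _ mB mD).
  by apply: measurable_funS mwE => //; exact: subIsetl.
have [|||||_ _] := @dominated_convergence _ _ _ mu D mD
  (fun n => (fun x => (w x)%:E) \_ (An n)) ((fun x => (w x)%:E) \_ A) (fun x => (w x)%:E); last exact.
- by move=> n; exact: mp.
- exact: mp.
- apply: filterS lim => x hx Dx; apply: cvg_near_cst.
  by apply: filterS hx => n hn; rewrite /patch hn.
- apply/integrableP; split => //.
  by under eq_integral do rewrite gee0_abs ?lee_fin//.
- apply: aeW => x n Dx; rewrite /patch; case: ifP => _; last by rewrite abse0 lee_fin.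
  by rewrite gee0_abs ?lee_fin.
Qed.

Lemma bounded_integral_fin_num D (F : T -> R) (B : R) : measurable D -> (mu D < +oo)%E ->
  measurable_fun D F -> (forall x, 0 <= F x <= B) -> (\int[mu]_(x in D) (F x)%:E \is a fin_num)%E.
Proof.
move=> mD fD mF F0; have Fpos x : 0 <= F x by have /andP[] := F0 x.
rewrite ge0_fin_numE; last by apply: integral_ge0 => x _; rewrite lee_fin.
apply: (@le_lt_trans _ _ (\int[mu]_(x in D) (cst B%:E) x)%E).
  apply: ge0_le_integral => //.
  - by move=> x _; rewrite lee_fin.
  - exact/measurable_EFinP.
  - by move=> x _; rewrite lee_fin; have /andP[] := F0 x.
by rewrite integral_cst//= lte_mul_pinfty// lee_fin; have /andP[/le_trans] := F0 point; exact.
Qed.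

Lemma integral_weighted_sum_le D (w : T -> R) (G : nat -> T -> R) (q B C : R) (N : nat) :
  measurable D -> (mu D < +oo)%E -> 0 <= q -> 0 <= C ->
  measurable_fun D w -> (forall j, measurable_fun D (G j)) ->
  (forall x, 0 <= w x) -> (forall j x, 0 <= G j x <= B) ->
  (forall x, w x <= \sum_(j < N) q ^+ j * G j x + C) ->
  (\int[mu]_(x in D) (w x)%:E <=
   (\sum_(j < N) q ^+ j * fine (\int[mu]_(x in D) (G j x)%:E) + C * fine (mu D))%:E)%E.
Proof.
move=> mD fD q0 C0 mw mG w0 G0 wG.
have Gpos j x : 0 <= G j x by have /andP[] := G0 j x.
have muD : mu D = (fine (mu D))%:E by rewrite fineK// ge0_fin_numE.
have finG j : (\int[mu]_(x in D) (G j x)%:E = (fine (\int[mu]_(x in D) (G j x)%:E))%:E)%E.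
  by rewrite fineK//; exact: (bounded_integral_fin_num mD fD (mG j) (G0 j)).
have mS : measurable_fun D (fun x => (\sum_(j < N) (q ^+ j)%:E * (G j x)%:E)%E).
  by apply: emeasurable_sum => j; apply: emeasurable_funM => //; apply/measurable_EFinP.
apply: (@le_trans _ _ (\int[mu]_(x in D) (\sum_(j < N) (q ^+ j)%:E * (G j x)%:E + C%:E))%E).
  apply: ge0_le_integral => //.
  - by move=> x _; rewrite lee_fin.
  - exact/measurable_EFinP.
  - exact: emeasurable_funD.
  - move=> x _; apply: le_trans (_ : (_ <= (\sum_(j < N) q ^+ j * G j x + C)%:E)%E) _.
      by rewrite lee_fin.
    by rewrite EFinD -sumEFin.
rewrite ge0_integralD//; last first.
  by move=> x _; apply: sume_ge0 => j _; rewrite -EFinM lee_fin mulr_ge0// exprn_ge0.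
rewrite ge0_integral_sum//; last 2 first.
- by move=> j; apply: emeasurable_funM => //; apply/measurable_EFinP.
- by move=> j x _; rewrite -EFinM lee_fin mulr_ge0// exprn_ge0.
rewrite EFinD; apply: leeD.
  rewrite -sumEFin; apply: lee_sum => j _.
  rewrite ge0_integralZl_EFin ?exprn_ge0//; last 2 first.
  - by move=> x _; rewrite lee_fin.
  - exact/measurable_EFinP.
  by rewrite [in leLHS]finG -EFinM.
by rewrite integral_cst//= muD -EFinM.
Qed.

Lemma integral_level_le D (F : T -> R) (B e : R) : measurable D -> 0 <= e -> 0 <= B ->
  measurable_fun setT F -> (forall x, 0 <= F x <= B) ->
  (\int[mu]_(x in D) (F x)%:E <= e%:E * mu D + B%:E * mu (D `&` [set x | (e < F x)%R]))%E.
Proof.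
move=> mD e0 B0 mF F0.
have mL : measurable [set x | e < F x].
  have := mF measurableT `]e, +oo[%classic (measurable_itv _); rewrite setTI.
  by congr measurable; apply/seteqP; split => x /=; rewrite in_itv/= andbT.
have mDL : measurable (D `&` [set x | e < F x]) by exact: measurableI.
have mDN : measurable (D `\` [set x | e < F x]) by exact: measurableD.
have DE : D = (D `\` [set x | e < F x]) `|` (D `&` [set x | e < F x]).
  by rewrite setUC setUIDK.
have mFE E : measurable E -> measurable_fun E (fun x => (F x)%:E).
  by move=> mE; apply/measurable_EFinP; exact: measurable_funS mF.
have F0' x : (0 <= (F x)%:E)%E by rewrite lee_fin; have /andP[] := F0 x.
have := @ge0_integral_setU_le _ _ _ mu _ _ (fun x => (F x)%:E) mDN mDL (mFE _ measurableT) F0'.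
rewrite -DE => /le_trans; apply; apply: leeD.
  apply: (@le_trans _ _ (\int[mu]_(x in D `\` [set x | (e < F x)%R]) (cst e%:E) x)%E).
    apply: ge0_le_integral => //; first exact: mFE.
    by move=> x [_ /= /negP]; rewrite -leNgt lee_fin.
  rewrite integral_cst//; apply: lee_wpmul2l; first by rewrite lee_fin.
  by apply: measure_mono => //; exact: subDsetl.
apply: (@le_trans _ _ (\int[mu]_(x in D `&` [set x | (e < F x)%R]) (cst B%:E) x)%E).
  apply: ge0_le_integral => //; first exact: mFE.
  by move=> x _; rewrite lee_fin; have /andP[] := F0 x.
by rewrite integral_cst.
Qed.

Lemma markov_level_le D (F : T -> R) (e : R) : measurable D -> 0 < e ->
  measurable_fun setT F -> (forall x, 0 <= F x) ->
  (mu (D `&` [set x | (e < F x)%R]) <= (e^-1)%:E * \int[mu]_(x in D) (F x)%:E)%E.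
Proof.
move=> mD e0 mF F0.
have mL : measurable [set x | e < F x].
  have := mF measurableT `]e, +oo[%classic (measurable_itv _); rewrite setTI.
  by congr measurable; apply/seteqP; split => x /=; rewrite in_itv/= andbT.
have mDL : measurable (D `&` [set x | e < F x]) by exact: measurableI.
have mFE E : measurable E -> measurable_fun E (fun x => (F x)%:E).
  by move=> mE; apply/measurable_EFinP; exact: measurable_funS mF.
rewrite -lee_pdivrMl ?invr_gt0// invrK -integral_cst//.
apply: (@le_trans _ _ (\int[mu]_(x in D `&` [set x | (e < F x)%R]) (F x)%:E)%E).
  apply: ge0_le_integral => //.
  - by move=> x _; rewrite /= lee_fin ltW.
  - exact: mFE.
  - by move=> x [_ /= /ltW]; rewrite lee_fin.
apply: ge0_subset_integral => //; first exact: mFE.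
by move=> x _; rewrite lee_fin.
Qed.

End AbstractIntegrals.

(** * Ergodic means under translation *)

Section ErgodicShift.
Context {R : realType}.
Variable mu : {measure set (LebR R) -> \bar R}.
Hypothesis mu_class : measure_class mu.
Hypothesis mu_M : condition_M mu.

Let Dr (r : R) : set (LebR R) := `[- r, r]%classic.
Let measurable_Dr r : measurable (Dr r). Proof. exact: measurable_itv_LebR. Qed.

Lemma measure_class_fin r : (mu (Dr r) < +oo)%E.
Proof.
have [r0|r0] := leP (- r) r; first exact: mu_class.2.
have -> : Dr r = set0; last by rewrite measure0.
by rewrite /Dr set_itv_ge// bnd_simp -ltNge.
Qed.

Let m (r : R) : R := fine (mu (Dr r)).

Let mE r : mu (Dr r) = (m r)%:E.
Proof. by rewrite fineK// ge0_fin_numE// measure_class_fin. Qed.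

Let m_ge0 r : 0 <= m r. Proof. exact: fine_ge0. Qed.

(** The intervals [-n, n] exhaust a line of infinite measure. This is what absorbs the additive
    constants left by the exceptional intervals. *)
Lemma measure_class_cvgy (C : R) : exists r0 : R, forall r, r0 < r -> C <= m r.
Proof.
have nd : nondecreasing_seq (fun n : nat => Dr n%:R).
  move=> a b ab; rewrite subsetEset => s; rewrite /Dr /= !in_itv/= => /andP[s1 s2].
  have ab' : a%:R <= b%:R :> R by rewrite ler_nat.
  by apply/andP; split; [apply: le_trans s1; rewrite lerN2|apply: le_trans ab'].
have UT : \bigcup_n Dr n%:R = setT.
  rewrite -subTset => s _; exists (Num.bound `|s : R|) => //.
  by have := ltW (archi_boundP (normr_ge0 (s : R))); rewrite ler_norml /Dr /= in_itv/=.
have := nondecreasing_cvg_mu (fun n => measurable_Dr n%:R) _ nd.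
rewrite UT => /(_ R mu measurableT); rewrite mu_class.1 => /cvgeyPge/(_ C)[N _ hN].
exists N%:R => r Nr.
have := hN N (leqnn N) => /= h; rewrite -lee_fin -mE; apply: le_trans h _.
apply: measure_mono => // s; rewrite /Dr /= !in_itv/= => /andP[s1 s2].
apply/andP; split; last exact: le_trans (ltW Nr).
by apply: le_trans s1; rewrite lerN2 ltW.
Qed.

Lemma condition_M_shift (k : R) : exists beta c : R, [/\ 0 <= beta, 0 <= c &
  forall A : set (LebR R), measurable A ->
   (mu [set x : R | A (x + k)%R] <= beta%:E * mu A + c%:E)%E].
Proof.
(* The preimage of [A] under translation by [k] is [A] moved by [- k]. The part of [A] inside the
   exceptional [a, b] is sent into [a - k, b - k], whose finite measure becomes the constant. *)
have [beta [a [b [b0 [ab hM]]]]] := mu_M (- k).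
have fI : (mu `[(a - k)%R, (b - k)%R]%classic < +oo)%E by apply: mu_class.2; rewrite lerD2r.
exists beta, (fine (mu `[(a - k)%R, (b - k)%R]%classic)); split.
- exact: ltW.
- exact: fine_ge0.
move=> A mA; rewrite fineK ?ge0_fin_numE//.
pose I0 : set (LebR R) := `[a, b]%classic.
have mI0 : measurable I0 by exact: measurable_itv_LebR.
have mAI : measurable (A `\` I0) by exact: measurableD.
have mI' : measurable (`[(a - k)%R, (b - k)%R]%classic : set (LebR R)) by exact: measurable_itv_LebR.
have mS : measurable ([set x : R | (A `\` I0) (x + k)%R] : set (LebR R)) := measurable_shift k mAI.
apply: (@le_trans _ _ (mu ([set x : R | (A `\` I0) (x + k)%R] `|` `[(a - k)%R, (b - k)%R]%classic))).
  apply: measure_mono.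
  - exact: (measurable_shift k mA).
  - exact: measurableU.
  move=> x /= Ax; have [h|h] := pselect (I0 (x + k)); last by left; split.
  by right; move: h; rewrite /I0 /= !in_itv/= lerBlDr lerBrDr.
apply: le_trans (measureU2 _ mS mI') _; apply: leeD => //.
have disj : (A `\` I0) `&` `[a, b]%classic = set0.
  by rewrite setDE -setIA setICl setI0.
have := hM _ mAI disj.
have -> : [set ((x : R) + - k)%R | x in A `\` I0]%classic = [set x : R | (A `\` I0) (x + k)%R].
  apply/seteqP; split => x /=; first by move=> [y hy <-]; rewrite subrK.
  by move=> hx; exists (x + k) => //; rewrite addrK.
move=> /le_trans; apply; apply: lee_wpmul2l; first by rewrite lee_fin ltW.
by apply: measure_mono => //; exact: subDsetl.
Qed.

Lemma measure_class_enlarge (k : R) : 0 <= k -> exists K c : R, [/\ 0 <= K, 0 <= c &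
  forall r, k <= r -> m (r + k) <= K * m r + c].
Proof.
move=> k0.
have [b1 [c1 [b10 c10 h1]]] := condition_M_shift k.
have [b2 [c2 [b20 c20 h2]]] := condition_M_shift (- k).
exists (1 + b1 + b2), (c1 + c2); split; [by rewrite !addr_ge0|by rewrite addr_ge0|].
move=> r kr; rewrite -lee_fin -mE.
have mS1 : measurable ([set x : R | Dr r (x + k)%R] : set (LebR R)) := measurable_shift k (measurable_Dr r).
have mS2 : measurable ([set x : R | Dr r (x - k)%R] : set (LebR R)) := measurable_shift (- k) (measurable_Dr r).
have mU1 : measurable (Dr r `|` [set x : R | Dr r (x + k)%R]) by exact: measurableU.
(* The enlarged window is covered by [-r, r] and its two translates by k; [k <= r] leaves no gap
   between them. *)
apply: (@le_trans _ _ (mu (Dr r `|` [set x : R | Dr r (x + k)%R] `|` [set x : R | Dr r (x - k)%R]))).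
  apply: measure_mono => //; first exact: measurableU.
  move=> s; rewrite /Dr /= !in_itv/= => /andP[s1 s2].
  have [h1'|h1'] := leP s r; last by right; apply/andP; split; lra.
  have [h2'|h2'] := leP (- r) s; first by left; left; apply/andP.
  by left; right; apply/andP; split; lra.
have e0 : (mu (Dr r) <= (m r)%:E)%E by rewrite mE.
have e1 : (mu [set x : R | Dr r (x + k)%R] <= (b1 * m r + c1)%:E)%E.
  by rewrite EFinD EFinM -mE; exact: h1.
have e2 : (mu [set x : R | Dr r (x - k)%R] <= (b2 * m r + c2)%:E)%E.
  by rewrite EFinD EFinM -mE; exact: h2.
apply: le_trans (measureU2 _ mU1 mS2) _.
apply: (@le_trans _ _ ((m r + (b1 * m r + c1)) + (b2 * m r + c2))%:E); last by rewrite lee_fin; lra.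
rewrite EFinD; apply: leeD => //.
apply: le_trans (measureU2 _ (measurable_Dr r) mS1) _.
by rewrite EFinD; exact: leeD.
Qed.

Definition mean_value (F : R -> R) (r : R) : \bar R :=
  (((fine (mu `[(- r)%R, r]%classic))^-1)%:E *
    \int[mu]_(t in `[(- r)%R, r]%classic) (F t)%:E)%E.

Let measurable_fun_shiftR (F : R -> R) k : measurable_fun setT (F : LebR R -> R) ->
  measurable_fun setT (fun x : LebR R => F ((x : R) + k)%R).
Proof. by move=> mF; exact: (measurableT_comp mF (measurable_fun_shift k)). Qed.

Lemma mean_value_shift_cvg0 (F : R -> R) (B k : R) :
  measurable_fun setT (F : LebR R -> R) -> (forall x, 0 <= F x <= B) ->
  mean_value F @ +oo --> 0%E -> mean_value (fun t => F (t + k)) @ +oo --> 0%E.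
Proof.
move=> mF FB lim.
have F0 x : 0 <= F x by have /andP[] := FB x.
have B0 : 0 <= B by have /andP[h1 h2] := FB 0; exact: le_trans h2.
have [beta [c [beta0 c0 hbeta]]] := condition_M_shift k.
have [K [c' [K0 c'0 hK]]] := measure_class_enlarge (normr_ge0 k).
have mFk := measurable_fun_shiftR k mF.
have FkB x : 0 <= F (x + k) <= B by exact: FB.
pose S r := (\int[mu]_(t in Dr r) (F t)%:E)%E.
have S0 r : (0 <= S r)%E by apply: integral_ge0 => x _; rewrite lee_fin.
pose avg r := fine (mean_value F r).
have small e : 0 < e -> exists r0, forall r, r0 < r ->
    (mean_value (fun t => F (t + k)%R) r <= e%:E)%E.
  move=> e0; have e3 : 0 < e / 3 by rewrite divr_gt0.
  (* [B] bounds F on the level set, [beta] comes from the translation, 3/e from Markov and [K + 1]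
     from the larger window; a mean of F below [e / 3 / W] makes their product at most a third of
     the target. The final 1 keeps [W] positive. *)
  pose W := B * beta * (e / 3)^-1 * (K + 1) + 1.
  have W0 : 0 < W.
    by rewrite ltr_wpDl// !mulr_ge0// ?invr_ge0 ?(ltW e3)// addr_ge0.
  have eta0 : 0 < e / 3 / W by rewrite divr_gt0.
  have /fine_cvgP[fin /cvgrPdist_lt/(_ _ eta0) hlim] := lim.
  have [r1 [_ hr1]] := fin; have [r2 [_ hr2]] := hlim.
  (* A window of measure at least [Q] has positive measure and absorbs both additive constants, [c']
     of the enlargement and [c] of the translation. *)
  pose Q := 1 + c' + B * c / (e / 3).
  have [r3 hr3] := measure_class_cvgy Q.
  exists (Num.max (Num.max r1 r2) (Num.max r3 `|k|)) => r.
  rewrite !gt_max => /andP[/andP[rr1 rr2] /andP[rr3 rk]].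
  have mQ := hr3 r rr3.
  have Bc0 : 0 <= B * c / (e / 3) by rewrite divr_ge0 ?mulr_ge0// ltW.
  have m1 : 1 <= m r by apply: le_trans mQ; rewrite /Q; lra.
  have m0 : 0 < m r by apply: lt_le_trans m1.
  have mc' : c' <= m r by apply: le_trans mQ; rewrite /Q; lra.
  have mBc : B * c <= e / 3 * m r.
    by rewrite [leRHS]mulrC -ler_pdivrMr//; apply: le_trans mQ; rewrite /Q; lra.
  (* Level points of F(. + k) in [-r, r] become level points of F in [-r', r'], where Markov's
     inequality is applied. *)
  pose r' := r + `|k|.
  have rr' : r <= r' by rewrite lerDl.
  have fin' : mean_value F r' \is a fin_num by apply: hr1; exact: lt_le_trans rr'.
  have avg_lt : avg r' < e / 3 / W.
    have := hr2 r' (lt_le_trans rr2 rr').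
    by rewrite sub0r normrN => /(le_lt_trans (ler_norm _)).
  have mr' := hK r (ltW rk); rewrite -/r' in mr'.
  have mr'1 : m r' <= (K + 1) * m r by rewrite mulrDl mul1r; apply: le_trans mr' _; rewrite lerD2l.
  have mrr' : m r <= m r'.
    rewrite -lee_fin -!mE; apply: measure_mono => // s; rewrite /Dr /= !in_itv/= => /andP[s1 s2].
    by apply/andP; split; [apply: le_trans s1; rewrite lerN2|exact: le_trans rr'].
  have m'0 : 0 < m r' by exact: lt_le_trans mrr'.
  have SE : S r' = (m r' * avg r')%:E.
    have : mean_value F r' = (avg r')%:E by rewrite /avg fineK.
    rewrite /mean_value -/(Dr r') -/(S r') -/(m r') => h.
    by rewrite EFinM -h muleA -EFinM divff ?mul1e// gt_eqF.
  have avg0 : 0 <= avg r'.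
    by have := S0 r'; rewrite SE lee_fin pmulr_rge0.
  have level : (mu (Dr r `&` [set x : R | (e / 3 < F (x + k))%R]) <=
      (beta * ((e / 3)^-1 * (m r' * avg r')) + c)%:E)%E.
    pose A := Dr r' `&` [set x : R | (e / 3 < F x)%R].
    have mL : measurable ([set x : R | (e / 3 < F x)%R] : set (LebR R)).
      have := mF measurableT `]e / 3, +oo[%classic (measurable_itv _); rewrite setTI.
      by congr measurable; apply/seteqP; split => x /=; rewrite in_itv/= andbT.
    have mLk : measurable ([set x : R | (e / 3 < F (x + k))%R] : set (LebR R)).
      exact: (measurable_shift k mL).
    have mA : measurable A by exact: measurableI.
    apply: (@le_trans _ _ (mu [set x : R | A (x + k)%R])).
      apply: measure_mono.
      - exact: measurableI.
      - exact: (measurable_shift k mA).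
      move=> x [Dx Fx]; split => //; move: Dx; rewrite /Dr /r' /= !in_itv/= => /andP[x1 x2].
      have := ler_norm k; have := ler_norm (- k); rewrite normrN => k1 k2.
      by apply/andP; split; lra.
    apply: le_trans (hbeta _ mA) _; rewrite EFinD; apply: leeD => //.
    rewrite EFinM; apply: lee_wpmul2l; first by rewrite lee_fin.
    rewrite EFinM -SE; exact: (markov_level_le mu (measurable_Dr r') e3 mF F0).
  have main : (\int[mu]_(t in Dr r) (F ((t : R) + k)%R)%:E <= (e * m r)%:E)%E.
    have h := integral_level_le mu (measurable_Dr r) (ltW e3) B0 mFk FkB.
    apply: le_trans h _.
    apply: le_trans (leeD (le_refl _) (lee_wpmul2l _ level)) _; first by rewrite lee_fin.
    rewrite mE -EFinM -EFinM -EFinD lee_fin.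
    have h2 : B * beta * (e / 3)^-1 * (m r' * avg r') <= e / 3 * m r.
      have X0 : 0 <= B * beta * (e / 3)^-1 by rewrite !mulr_ge0// invr_ge0 ltW.
      apply: (@le_trans _ _ (B * beta * (e / 3)^-1 * ((K + 1) * m r * (e / 3 / W)))).
        by rewrite ler_wpM2l// ler_pM// ltW.
      have -> : B * beta * (e / 3)^-1 * ((K + 1) * m r * (e / 3 / W)) =
         (e / 3 * m r) * ((B * beta * (e / 3)^-1 * (K + 1)) / W) by ring.
      apply: ler_piMr; first by rewrite mulr_ge0 ?(ltW e3) ?(ltW m0).
      by rewrite ler_pdivrMr// mul1r /W lerDl.
    have -> : B * (beta * ((e / 3)^-1 * (m r' * avg r')) + c) =
      B * beta * (e / 3)^-1 * (m r' * avg r') + B * c by ring.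
    have -> : e * m r = e / 3 * m r + (e / 3 * m r + e / 3 * m r) by field.
    by rewrite lerD2l; exact: lerD.
  rewrite /mean_value -/(Dr r) -/(m r).
  apply: le_trans (lee_wpmul2l _ main) _; first by rewrite lee_fin invr_ge0.
  by rewrite -EFinM lee_fin mulrCA mulVf ?mulr1// gt_eqF.
have pos r : (0 <= mean_value (fun t => F (t + k)%R) r)%E.
  rewrite /mean_value mule_ge0 ?lee_fin ?invr_ge0//.
  by apply: integral_ge0 => x _; rewrite lee_fin.
apply/fine_cvgP; split.
  have [r0 h0] := small 1 ltr01; exists r0; split; first exact: num_real.
  by move=> r /h0 h; rewrite ge0_fin_numE//; exact: le_lt_trans h (ltry _).
apply/cvgrPdist_le => e e0; have [r0 h0] := small e e0; exists r0; split; first exact: num_real.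
move=> r /h0 h; rewrite sub0r normrN ger0_norm ?fine_ge0// -lee_fin fineK//.
by rewrite ge0_fin_numE//; exact: le_lt_trans h (ltry _).
Qed.

End ErgodicShift.

Section StepanovNorm.
Context {R : realType} {X : completeNormedModType R}.
Local Notation lam := (@leb R).
Variable p : R.
Hypothesis p1 : 1 <= p.

(** This makes the Stepanov norm measurable in the window, so that it can be integrated against
    [mu]. As the window moves, membership of a point stabilises unless the point is t or t + 1. *)
Lemma pow_int_continuous (k : R -> X) : Lploc p k ->
  continuous (fun t => fine (pow_int p k t (t + 1))).
Proof.
move=> [mk fin] t; apply: continuous_at_seq => tn tn1 tnt.
(* Contains every unit window starting within 1 of [t], hence supplies the majorant. *)
pose D : set (LebR R) := `[t - 1, t + 2]%classic.
have mD : measurable D by exact: measurable_itv_LebR.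
have mw : measurable_fun D (fun s : LebR R => `|k s| `^ p).
  apply: (measurableT_comp (measurable_powR p)); exact: measurable_norm_LebR.
have subD (a : R) : `|t - a| <= 1 -> `[a, (a + 1)%R]%classic `<=` D.
  move=> ta s; move: ta; rewrite ler_norml /D /= !in_itv/= => /andP[a1 a2] /andP[s1 s2].
  by apply/andP; split; lra.
have lim : {ae lam, forall s : LebR R, \forall n \near \oo,
    (s \in (`[tn n, (tn n + 1)%R]%classic : set (LebR R))) =
    (s \in (`[t, (t + 1)%R]%classic : set (LebR R)))}.
  apply: filterS2 (ae_notin_set1 t) (ae_notin_set1 (t + 1)) => s0 /eqP st /eqP st1.
  pose s : R := s0; rewrite -/s in st st1.
  suff : \forall n \near \oo, (tn n <= s <= tn n + 1) = (t <= s <= t + 1).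
    apply: filterS => n h; apply/idP/idP; rewrite !inE /= !in_itv/= -/s h//.
  move: st st1; rewrite !neq_lt => /orP[st|ts] /orP[st1|ts1].
  - near=> n; have : s < tn n by near: n; exact: (cvgr_gt _ tnt).
    by move=> h; rewrite leNgt h [t <= s]leNgt st.
  - by exfalso; lra.
  - have h1 : \forall n \near \oo, tn n < s by exact: (cvgr_lt _ tnt).
    have h2 : \forall n \near \oo, s - 1 < tn n by apply: (cvgr_gt _ tnt); lra.
    near=> n; have : tn n < s by near: n.
    have : s - 1 < tn n by near: n.
    move=> a1 a2; rewrite (ltW a2) (ltW ts) (ltW st1) /=; apply/idP; lra.
  - have h1 : \forall n \near \oo, tn n < s - 1 by apply: (cvgr_lt _ tnt); lra.
    near=> n; have a1 : tn n < s - 1 by near: n.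
    have -> : (t <= s <= t + 1) = false by apply/negP => /andP[_]; rewrite leNgt ts1.
    by apply/negP => /andP[_]; lra.
have H := @integral_set_cvg _ _ _ lam D `[t, (t + 1)%R]%classic
  (fun n => `[tn n, (tn n + 1)%R]%classic) (fun s => `|k s| `^ p) mD (measurable_itv_LebR _)
  (fun n => measurable_itv_LebR _) (subD t _) (fun n => subD _ (tn1 n)) mw
  (fun s => powR_ge0 _ _) (fin _ _) lim.
have {}H : (fun n => pow_int p k (tn n) (tn n + 1)) @ \oo --> pow_int p k t (t + 1).
  by apply: H; rewrite subrr normr0.
have E : pow_int p k t (t + 1) = (fine (pow_int p k t (t + 1)))%:E.
  by rewrite fineK// ge0_fin_numE; [exact: fin|exact: pow_int_ge0].
by rewrite E in H; have /fine_cvgP[_] := H.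
Unshelve. all: by end_near. Qed.

Lemma measurable_stepanov_norm (k : R -> X) : Lploc p k ->
  measurable_fun setT (stepanov_norm p k : LebR R -> R).
Proof.
move=> lk; apply: (measurableT_comp (measurable_powR p^-1)).
exact: (continuous_measurable_LebR (pow_int_continuous lk)).
Qed.

Lemma Lploc0 : Lploc p (fun _ : R => 0 : X).
Proof.
split.
  exists (fun=> [::]); split => // ; apply: aeW => x _.
  by under eq_cvg => n do rewrite /sfun_eval big_nil; exact: cvg_cst.
move=> a b; rewrite (eq_integral (fun=> 0%E)) ?integral0// => x _.
by rewrite normr0 powR0// gt_eqF// (lt_le_trans _ p1).
Qed.

Lemma BS_add (f g : R -> X) : BS p f -> BS p g -> BS p (f \+ g).
Proof.
move=> [lf [C hC]] [lg [C' hC']].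
have lNg : Lploc p (fun s => 0 - g s) := Lploc_sub p1 Lploc0 lg.
have -> : f \+ g = (fun s => f s - (0 - g s)).
  by apply/funext => s /=; rewrite sub0r opprK.
split; first exact: (Lploc_sub p1 lf lNg).
exists (2 `^ p * (C + C')) => t.
apply: le_trans (pow_int_sub_le p1 t (t + 1) lf.1 lNg.1) _.
rewrite EFinM EFinD lee_wpmul2l ?lee_fin ?powR_ge0//.
have -> : pow_int p (fun s => 0 - g s) t (t + 1) = pow_int p g t (t + 1).
  by apply: eq_integral => s _; rewrite sub0r normrN.
exact: leeD (hC t) (hC' t).
Qed.

End StepanovNorm.

Section ScaledSum.
Context {R : realType} {d : measure_display} {T : measurableType d}
        (mu : {measure set T -> \bar R}).

Lemma ge0_integral_scaled_add (D : set T) (c : R) (F1 F2 : T -> R) : measurable D -> 0 <= c ->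
  measurable_fun D F1 -> measurable_fun D F2 -> (forall x, 0 <= F1 x) -> (forall x, 0 <= F2 x) ->
  (\int[mu]_(x in D) (c * (F1 x + F2 x))%:E =
   c%:E * (\int[mu]_(x in D) (F1 x)%:E + \int[mu]_(x in D) (F2 x)%:E))%E.
Proof.
move=> mD c0 m1 m2 F10 F20.
have m1' : measurable_fun D (fun x => (F1 x)%:E) by apply/measurable_EFinP.
have m2' : measurable_fun D (fun x => (F2 x)%:E) by apply/measurable_EFinP.
rewrite -ge0_integralD//; [|by move=> x _; rewrite lee_fin|by move=> x _; rewrite lee_fin].
rewrite -ge0_integralZl_EFin//.
- by move=> x _; rewrite -EFinD lee_fin addr_ge0.
- exact: emeasurable_funD.
Qed.

End ScaledSum.

Section Ergodic.
Context {R : realType} {X : completeNormedModType R}.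
Local Notation lam := (@leb R).
Variable mu : {measure set (LebR R) -> \bar R}.
Hypothesis mu_class : measure_class mu.
Hypothesis mu_M : condition_M mu.
Variables (U : R -> R -> X -> X) (P : R -> X -> X) (Ut : R -> R -> X -> X)
  (M delta : R).
Hypothesis evU : evolution_family U.
Hypothesis dich : exp_dichotomy U P Ut M delta.
Local Notation Gam := (green U P Ut).
Let M0 : 0 <= M := ltW (dich_M_gt0 dich).
Let d0 : 0 < delta := dich_delta_gt0 dich.

Theorem green_solution_ergodic (p : R) (k u : R -> X) : 1 <= p -> ergodicp mu p k ->
  (forall t, is_bochner lam setT (fun s => Gam t s (k s)) (u t)) ->
  ergodic0 mu u.
Proof.
move=> p1 [bk ek] hu.
split; first exact: (green_solution_bounded dich p1 bk hu).
have cu := green_solution_continuous evU dich p1 bk hu.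
split; first exact: cu.
have [B hB] := stepanov_norm_bounded p1 bk.
pose Phi := stepanov_norm p k.
have Phi0 x : 0 <= Phi x by have /andP[] := hB x.
have mPhi : measurable_fun setT (Phi : LebR R -> R) := measurable_stepanov_norm bk.1.
have eshift c : mean_value mu (fun t => Phi (t + c)) @ +oo --> 0%E.
  exact: (mean_value_shift_cvg0 mu_class mu_M c mPhi hB ek).
pose q := expR (- delta).
have q0 : 0 < q by exact: expR_gt0.
have q1 : q < 1 by rewrite -expR0 ltr_expR oppr_lt0.
pose C := B *+ 2 / (1 - q).
have B0 : 0 <= B by have /andP[h1 h2] := hB 0; exact: le_trans h2.
have C0 : 0 <= C by rewrite divr_ge0 ?mulrn_wge0// subr_ge0 ltW.
(* The contribution of the two unit windows at distance j, written as translates of [Phi] so that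
   [eshift] applies to each. *)
pose G (j : nat) (t : R) := M * (Phi (t + j%:R) + Phi (t + (- j%:R - 1))).
have mPhis c : measurable_fun setT (fun t : LebR R => Phi ((t : R) + c)).
  exact: (measurableT_comp mPhi (measurable_fun_shift c)).
have mG j : measurable_fun setT (G j : LebR R -> R).
  exact: (measurable_funM (measurable_cst _) (measurable_funD (mPhis _) (mPhis _))).
have mDr r : measurable (`[(- r)%R, r]%classic : set (LebR R)) by exact: measurable_itv_LebR.
have mGr r j : measurable_fun (`[(- r)%R, r]%classic : set (LebR R)) (G j : LebR R -> R).
  exact: (measurable_funS measurableT (@subsetT _ _) (mG j)).
have GB j x : 0 <= G j x <= M * (B *+ 2).
  have /andP[a1 a2] := hB (x + j%:R); have /andP[b1 b2] := hB (x + (- j%:R - 1)).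
  apply/andP; split; first exact: (mulr_ge0 M0 (addr_ge0 (Phi0 _) (Phi0 _))).
  by apply: (ler_wpM2l M0); rewrite mulr2n; exact: (lerD a2 b2).
have mw : measurable_fun setT (fun t : LebR R => `|u t|).
  apply: (@continuous_measurable_LebR R setT (fun t => `|u t|)) => t.
  exact: (cvg_comp _ _ (cu t) (@norm_continuous _ _ (u t))).
have wG N x : `|u x| <= \sum_(j < N) q ^+ j * G j x + M * C * q ^+ N.
  rewrite -lee_fin; apply: le_trans (green_solution_le dich bk hu x) _.
  apply: le_trans (lee_wpmul2l _ (kernel_int_le x N d0 p1 bk.1 hB)) _; first by rewrite lee_fin.
  rewrite -EFinM lee_fin mulrDr; apply: lerD; last by rewrite mulrA.
  by rewrite mulr_sumr; apply: ler_sum => j _; rewrite /G mulrCA addrA.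
pose m r := fine (mu `[(- r)%R, r]%classic).
have m0 r : 0 <= m r by exact: fine_ge0.
have GE j r : mean_value mu (G j) r = (M%:E * (mean_value mu (fun t => Phi (t + j%:R)%R) r +
    mean_value mu (fun t => Phi (t + (- j%:R - 1))%R) r))%E.
  have mD c : measurable_fun (`[(- r)%R, r]%classic : set (LebR R))
      (fun t : LebR R => Phi ((t : R) + c)).
    exact: (measurable_funS measurableT (@subsetT _ _) (mPhis c)).
  rewrite /mean_value.
  rewrite (ge0_integral_scaled_add mu (mDr r) M0 (mD _) (mD _) (fun=> Phi0 _) (fun=> Phi0 _)).
  by rewrite muleCA ge0_muleDr//; apply: integral_ge0 => x _; rewrite lee_fin; exact: Phi0.
have limG j : mean_value mu (G j) @ +oo --> 0%E.
  have h : (fun r => mean_value mu (fun t => Phi (t + j%:R)%R) r +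
      mean_value mu (fun t => Phi (t + (- j%:R - 1))%R) r)%E @ +oo --> 0%E.
    by rewrite -[X in _ --> X](adde0 0%E); exact: (cvgeD _ (eshift j%:R) (eshift (- j%:R - 1))).
  have {}h := @cvgeZl _ _ _ _ _ M%:E erefl h.
  rewrite mule0 in h.
  by apply: cvg_trans h; apply: near_eq_cvg; apply: filterE => r; rewrite GE.
apply: (@geometric_cvg0 _ q _ _ _ _ (fun r j => fine (mean_value mu (G j) r)) (M * C) q0 q1).
- move=> N; apply: filterE => r; split.
    by apply: mule_ge0; [rewrite lee_fin invr_ge0; exact: m0|exact: integral_ge0].
  have MCq : 0 <= M * C * q ^+ N := mulr_ge0 (mulr_ge0 M0 C0) (exprn_ge0 N (ltW q0)).
  have h := @integral_weighted_sum_le _ _ _ mu _ _ _ _ _ _ N (mDr r) (measure_class_fin mu_class r) (ltW q0) MCq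
    (measurable_funS measurableT (@subsetT _ _) mw) (mGr r) (fun _ => normr_ge0 _) GB (wG N).
  apply: le_trans (lee_wpmul2l _ h) _; first by rewrite lee_fin invr_ge0; exact: m0.
  rewrite -EFinM lee_fin mulrDr -/(m r); apply: lerD.
    rewrite mulr_sumr; apply: ler_sum => j _; rewrite mulrCA ler_wpM2l ?exprn_ge0 ?(ltW q0)//.
    have finG := bounded_integral_fin_num (mDr r) (measure_class_fin mu_class r)
      (mGr r j) (GB j).
    by rewrite /mean_value fineM.
  rewrite mulrCA ler_piMr//.
  (* The mean of the constant remainder is the remainder itself, or 0 when the window is null, as
     the inverse of 0 is 0. *)
  have [->|mn0] := eqVneq (m r) 0; first by rewrite mulr0.
  by rewrite mulVf.
- by move=> j; have /fine_cvgP[] := limG j.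
Qed.

End Ergodic.

(** * Assembling the two parts of the forcing *)

Unset Implicit Arguments.

Theorem mainTheorem2 (R : realType) (X : completeNormedModType R) (p : R)
    (mu : {measure set (LebR R) -> \bar R})
    (U : R -> R -> X -> X) (P : R -> X -> X) (Ut : R -> R -> X -> X)
    (M delta : R) (g : R -> X) :
  1 <= p ->
  measure_class mu ->
  condition_M mu ->
  evolution_family U ->
  exp_dichotomy U P Ut M delta ->
  (forall x : X, bi_almost_automorphic (fun t s => green U P Ut t s x)) ->
  PAAS mu p g ->
  exists u : R -> X,
    [/\ bdd_fun u /\ mild_solution U g u,
        forall w : R -> X, bdd_fun w -> mild_solution U g w -> w = u,
        forall t : R,
          is_bochner (@leb R) setT (fun s => green U P Ut t s (g s)) (u t)
      & PAA mu u].
Proof.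
move=> p1 muc muM evU dich H3 [f [phi [aaf ephi gE]]].
have bf : BS p f := AAS_BS p1 aaf.
have bphi : BS p phi := ephi.1.
have bg : BS p g by rewrite gE; exact: BS_add.
have /choice[u hu] : forall t, exists v,
    is_bochner (@leb R) setT (fun s => green U P Ut t s (g s)) v.
  by move=> t; exact: (green_bochner_exists evU dich t p1 bg).
have /choice[u1 hu1] : forall t, exists v,
    is_bochner (@leb R) setT (fun s => green U P Ut t s (f s)) v.
  by move=> t; exact: (green_bochner_exists evU dich t p1 bf).
(* The ergodic component is taken as the difference of the solutions for [g] and [f]; linearity of
   Gamma identifies it with the integral against [phi], and the decomposition of [u] is then
   immediate. *)
have hu2 t : is_bochner (@leb R) setT (fun s => green U P Ut t s (phi s)) (u t - u1 t).
  have h := bochner_sub leb_complete measurableT (hu t) (hu1 t).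
  rewrite (_ : (fun s => green U P Ut t s (phi s)) =
    (fun s => green U P Ut t s (g s) - green U P Ut t s (f s)))//.
  apply/funext => s; rewrite -(greenB evU dich); congr green.
  by rewrite gE /= addrC addKr.
exists u; split.
- split; first exact: (green_solution_bounded dich p1 bg hu).
  exact: (green_solution_mild evU dich p1 bg hu).
- by move=> w bw mw; exact: (green_solution_unique evU dich p1 bg hu bw mw).
- exact: hu.
- exists u1, (fun t => u t - u1 t); split.
  + exact: (green_solution_almost_automorphic evU dich p1 H3 aaf hu1).
  + exact: (green_solution_ergodic muc muM evU dich p1 ephi hu2).
  + by apply/funext => t /=; rewrite addrC subrK.
Qed.
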